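(* Under the assumptions in the context, for every $\varepsilon>0$ the problem \[ M\Big(\iint_{\mathbb{R}^6}\frac{|u(x)-u(y)|^2}{|x-y|^{3+2s}}dxdy+\int_{\mathbb{R}^3}V(\varepsilon x)u^2dx\Big)\big[(-\Delta)^su+V(\varepsilon x)u\big]=g(\varepsilon x,u)\quad\text{in }\mathbb{R}^3 \] has a nonnegative ground state solution (a nonnegative nontrivial critical point of $\mathcal J_\varepsilon$).
   Context: Let $s\in(\frac34,1)$, $[u]^2=\iint_{\mathbb{R}^6}\frac{|u(x)-u(y)|^2}{|x-y|^{3+2s}}dxdy$, $H^s(\mathbb{R}^3)=\{u\in L^2(\mathbb{R}^3):[u]<\infty\}$. $M:[0,\infty)\to[0,\infty)$ continuous with $(M_1)$ $M(t)\ge m_0>0$ for all $t\ge0$; $(M_2)$ $M$ increasing; $(M_3)$ $\frac{M(t_1)}{t_1}-\frac{M(t_2)}{t_2}\le m_0(\frac1{t_1}-\frac1{t_2})$ for $t_1\ge t_2>0$; $\widehat M(t)=\int_0^tM$. $V\in C(\mathbb{R}^3,\mathbb{R})$ with $V_0:=\inf V>0$. $f:\mathbb{R}\to\mathbb{R}$ continuous, $f=0$ on $(-\infty,0)$, $F(t)=\int_0^tf$, with $(f_1)$ $f(t)/t^3\to0$ as $t\to0^+$; $(f_2)$ $f(t)/t^{q-1}\to0$ as $t\to\infty$ for some $q\in(4,\frac6{3-2s})$; $(f_3)$ $0<\vartheta F(t)\le f(t)t$ for $t>0$, some $\vartheta\in(4,\frac6{3-2s})$; $(f_4)$ $f(t)/t^3$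 nondecreasing on $(0,\infty)$. Fix a bounded Lipschitz domain $\Omega\subset\mathbb{R}^3$ with $V_0<\min_{\partial\Omega}V$ and $\{x\in\Omega:V(x)=V_0\}\ne\emptyset$. Fix $K>2/m_0$ and $a>0$ with $f(a)=\frac{V_0}{K}a$; let $\tilde f(t)=f(t)$ for $t\le a$, $\tilde f(t)=\frac{V_0}{K}t$ for $t>a$; $g(x,t)=\chi_\Omega(x)f(t)+(1-\chi_\Omega(x))\tilde f(t)$, $G(x,t)=\int_0^tg(x,\tau)d\tau$. For $\varepsilon>0$ let $\mathcal H_\varepsilon=\{u\in H^s(\mathbb{R}^3):\int V(\varepsilon x)u^2<\infty\}$ with norm $\|u\|_\varepsilon^2=[u]^2+\int_{\mathbb{R}^3}V(\varepsilon x)u^2dx$, and $\mathcal J_\varepsilon(u)=\frac12\widehat M(\|u\|_\varepsilon^2)-\int_{\mathbb{R}^3}G(\varepsilon x,u)dx$. A ground state is a nontrivial critical point of $\mathcal J_\varepsilon$ at the level $\inf_{\mathcal N_\varepsilon}\mathcal J_\varepsilon$, where $\mathcal N_\varepsilon=\{u\in\mathcal H_\varepsilon\setminus\{0\}:\langle\mathcal J_\varepsilon'(u),u\rangle=0\}$. *)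

(* Defs.v *)
From mathcomp Require Import all_boot all_order all_algebra.
From mathcomp Require Import all_classical all_reals all_analysis.
Import Order.TTheory GRing.Theory Num.Theory.
Import numFieldNormedType.Exports.

Set Implicit Arguments.
Unset Strict Implicit.
Unset Printing Implicit Defensive.

Local Open Scope classical_set_scope.
Local Open Scope ring_scope.

Definition pt3 (R : realType) := (R * R * R)%type.
Definition c1 {R : realType} (x : pt3 R) : R := x.1.1.
Definition c2 {R : realType} (x : pt3 R) : R := x.1.2.
Definition c3 {R : realType} (x : pt3 R) : R := x.2.
Definition coord3 {R : realType} (x : pt3 R) (j : 'I_3) : R :=
  nth 0 [:: c1 x; c2 x; c3 x] j.
Definition sub3 {R : realType} (x y : pt3 R) : pt3 R :=
  (c1 x - c1 y, c2 x - c2 y, c3 x - c3 y).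
Definition dist3 {R : realType} (x y : pt3 R) : R :=
  Num.sqrt ((c1 x - c1 y) ^+ 2 + (c2 x - c2 y) ^+ 2 + (c3 x - c3 y) ^+ 2).
Definition scale3 {R : realType} (e : R) (x : pt3 R) : pt3 R :=
  (e * c1 x, e * c2 x, e * c3 x).

Definition leb3 (R : realType) :=
  (((@lebesgue_measure R) \x (@lebesgue_measure R)) \x (@lebesgue_measure R))%E.
Definition leb6 (R : realType) := (@leb3 R \x @leb3 R)%E.

Definition int0 {R : realType} (h : R -> R) (t : R) : R :=
  if 0 <= t then (\int[@lebesgue_measure R]_(x in `[0, t]) h x)%R
  else (- \int[@lebesgue_measure R]_(x in `[t, 0]) h x)%R.

Definition gagliardo {R : realType} (s : R) (u : pt3 R -> R) : \bar R :=
  (\int[@leb6 R]_z ((u z.1 - u z.2) ^+ 2 / (dist3 z.1 z.2) `^ (3 + 2 * s))%:E)%E.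
Definition L2sq {R : realType} (u : pt3 R -> R) : \bar R :=
  (\int[@leb3 R]_x (u x ^+ 2)%:E)%E.
Definition Vsq {R : realType} (V : pt3 R -> R) (eps : R) (u : pt3 R -> R)
  : \bar R := (\int[@leb3 R]_x (V (scale3 eps x) * u x ^+ 2)%:E)%E.

Definition in_Heps {R : realType} (s : R) (V : pt3 R -> R) (eps : R)
  (u : pt3 R -> R) : Prop :=
  [/\ measurable_fun setT u, (L2sq u < +oo)%E, (gagliardo s u < +oo)%E
    & (Vsq V eps u < +oo)%E].

Definition normeps2 {R : realType} (s : R) (V : pt3 R -> R) (eps : R)
  (u : pt3 R -> R) : R := fine (gagliardo s u) + fine (Vsq V eps u).

Definition ftilde {R : realType} (f : R -> R) (V0 K a : R) (t : R) : R :=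
  if t <= a then f t else V0 / K * t.
Definition gfun {R : realType} (Omega : set (pt3 R)) (f : R -> R) (V0 K a : R)
  (x : pt3 R) (t : R) : R :=
  \1_Omega x * f t + (1 - \1_Omega x) * ftilde f V0 K a t.
Definition Gfun {R : realType} (Omega : set (pt3 R)) (f : R -> R) (V0 K a : R)
  (x : pt3 R) (t : R) : R := int0 (gfun Omega f V0 K a x) t.

Definition Jeps {R : realType} (s : R) (M : R -> R) (V : pt3 R -> R)
  (Omega : set (pt3 R)) (f : R -> R) (V0 K a eps : R) (u : pt3 R -> R) : R :=
  2^-1 * int0 M (normeps2 s V eps u)
  - (\int[@leb3 R]_x Gfun Omega f V0 K a (scale3 eps x) (u x))%R.

(** <J'(u), phi> = 0, expressed as the derivative of t |-> J(u + t phi) at 0. *)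
Definition dir_deriv_zero {R : realType} (J : (pt3 R -> R) -> R)
  (u phi : pt3 R -> R) : Prop :=
  is_derive (0 : R) (1 : R) (fun t : R => J (fun x => u x + t * phi x)) 0.

Definition nontrivial {R : realType} (u : pt3 R -> R) : Prop :=
  ~ {ae @leb3 R, forall x, u x = 0}.

Definition bounded3 {R : realType} (A : set (pt3 R)) : Prop :=
  exists r : R, forall x, A x -> [/\ `|c1 x| <= r, `|c2 x| <= r & `|c3 x| <= r].
Definition boundary3 {R : realType} (A : set (pt3 R)) : set (pt3 R) :=
  closure A `\` interior A.
Definition lipschitz_boundary {R : realType} (A : set (pt3 R)) : Prop :=
  forall p, boundary3 A p ->
  exists (r L : R) (Q : 'M[R]_3) (gam : R -> R -> R),
    [/\ 0 < r, Q *m Q^T = 1%:M,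
        (forall a b a' b', `|gam a b - gam a' b'| <=
                           L * Num.sqrt ((a - a') ^+ 2 + (b - b') ^+ 2))
      & forall x, dist3 x p < r ->
          let y := fun i : 'I_3 => \sum_(j < 3) Q i j * coord3 (sub3 x p) j in
          (A x <-> gam (y 0%R) (y 1%R) < y 2%R)].
Definition bounded_lipschitz_domain {R : realType} (A : set (pt3 R)) : Prop :=
  [/\ open A, connected A, A !=set0, bounded3 A & lipschitz_boundary A].

(* Main.v *)
Require Import Defs.
From HB Require Import structures.
From mathcomp Require Import all_boot all_order all_algebra.
From mathcomp Require Import all_classical all_reals all_analysis.
From mathcomp Require Import measurable_realfun lebesgue_integral_fubini.
From mathcomp Require Import ring lra.
Import Order.TTheory GRing.Theory Num.Theory.
Import numFieldNormedType.Exports.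
Local Open Scope classical_set_scope.
Local Open Scope ring_scope.

(* The ground state is obtained by minimising J over the Nehari set
   N = {v : A(v) > 0, J'(v)v = 0}, where A(v) is the squared energy norm, without
   any weak topology.

   Along a ray, J'(tv)v / t^3 is strictly decreasing in t: (M3) makes the
   Kirchhoff term decrease at rate m0, while (f4) and the truncation control the
   nonlinear term at rate 1/K < m0/2.  Hence J(tv) <= J(v) for v in N, and
   J(v) >= (m0/8) A(v) on N.

   A minimising sequence is therefore bounded.  The compactness needed is only
   almost everywhere convergence of a subsequence: averages over dyadic cubes
   converge along an ultrafilter, and a Poincare inequality on cubes turns this
   into a geometric rate.  The embedding into L^q, 2 <= q < 6/(3-2s), is proved by
   estimating the measures of the superlevel sets {|u| > 2^k}.  Fatou's lemma,
   applied to integrands made nonnegative with the subcritical growth of f, shows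
   that the limit does not vanish in Omega and that its energy along the ray does
   not exceed the infimum; its positive part, projected onto N, is a minimiser.

   Criticality: if w = u + zp with z small, then tw is in N for some t near 1, so
   J(tw) >= J(u) >= J(tu), and the mean value theorem gives J'(u)p >= 0. *)

Set Implicit Arguments.
Unset Strict Implicit.

(** [V] need not grow at infinity, so mass may escape and no compact embedding of the energy space
    is available. The truncation repairs this: outside the scaled [Omega] the primitive is at most
    [V0 / (2K) t^2], which [m0 / 2 * V t^2] absorbs pointwise because [K > 2 / m0]; inside, the
    measure is finite and constants are integrable. Both regions thus yield nonnegative integrands,
    and Fatou's lemma asks only for convergence almost everywhere. The coefficient [M (A u)] is
    nonlocal, and [A] may drop in the limit. The limits [g] of the seminorm part and [p] of the
    potential part are therefore kept as separate numbers, and the loss [p - Apot v] pays, through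
    [M >= m0], for the potential energy borrowed by the Fatou integrand. [M] and [f] are only
    continuous, so the Nehari set has no evident manifold structure and Lagrange multipliers are out
    of reach; hence the perturbation argument, which uses continuity of the derivative on
    two-dimensional planes only. *)

Lemma sigma_finite_product_measure1 {d1 d2} {T1 : measurableType d1}
  {T2 : measurableType d2} {R : realType}
  (m1 : {sigma_finite_measure set T1 -> \bar R})
  (m2 : {sigma_finite_measure set T2 -> \bar R}) :
  sigma_finite setT (m1 \x m2)%E.
Proof.
have /sigma_finiteP[F [TF ndF Ffin]] := sigma_finiteT m1.
have /sigma_finiteP[G [TG ndG Gfin]] := sigma_finiteT m2.
exists (fun n => F n `*` G n); last first.
  move=> n; have [mF finF] := Ffin n; have [mG finG] := Gfin n.
  split; first exact: measurableX.
  rewrite (product_measure1E m1 m2)//.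
  by rewrite lte_mul_pinfty// ge0_fin_numE.
apply/seteqP; split=> // -[x y] _.
have [i _ Fix] : (\bigcup_n F n) x by rewrite -TF.
have [j _ Gjy] : (\bigcup_n G n) y by rewrite -TG.
exists (i + j)%N => //; split => /=.
- by move: x Fix; exact/subsetPset/ndF/leq_addr.
- by move: y Gjy; exact/subsetPset/ndG/leq_addl.
Qed.

(** * Lebesgue measure on the powers of the line as a sigma-finite measure *)

Section lebesgue_instances.
Context (R : realType).
Local Notation leb1 := (@lebesgue_measure R).
Definition leb2 : set (measurableTypeR R * measurableTypeR R) -> \bar R :=
  (leb1 \x leb1)%E.
HB.instance Definition _ := Measure.copy leb2 (leb1 \x leb1)%E.
Lemma sigma_finite_leb2 : sigma_finite setT leb2.
Proof. exact: (@sigma_finite_product_measure1 _ _ _ _ R leb1 leb1). Qed.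
HB.instance Definition _ := Measure_isSigmaFinite.Build _ _ _ leb2
  sigma_finite_leb2.
HB.instance Definition _ := Measure.copy (@leb3 R) (leb2 \x leb1)%E.
Lemma sigma_finite_leb3 : sigma_finite setT (@leb3 R).
Proof. exact: (@sigma_finite_product_measure1 _ _ _ _ R leb2 leb1). Qed.
HB.instance Definition _ := Measure_isSigmaFinite.Build _ _ _ (@leb3 R)
  sigma_finite_leb3.
HB.instance Definition _ := Measure.copy (@leb6 R) (@leb3 R \x @leb3 R)%E.
Lemma sigma_finite_leb6 : sigma_finite setT (@leb6 R).
Proof. exact: (@sigma_finite_product_measure1 _ _ _ _ R (@leb3 R) (@leb3 R)). Qed.
HB.instance Definition _ := Measure_isSigmaFinite.Build _ _ _ (@leb6 R)
  sigma_finite_leb6.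
End lebesgue_instances.

(** * Measurability on the three-dimensional space *)

Section measurability3.
Context {R : realType}.
Implicit Types (x y : pt3 R).

Lemma measurable_c1 : measurable_fun setT (@c1 R).
Proof. exact: (measurableT_comp (f := fst)) measurable_fst measurable_fst. Qed.

Lemma measurable_c2 : measurable_fun setT (@c2 R).
Proof. exact: (measurableT_comp (f := snd)) measurable_snd measurable_fst. Qed.

Lemma measurable_c3 : measurable_fun setT (@c3 R).
Proof. exact: measurable_snd. Qed.

Lemma measurable_comp_fst (h : pt3 R -> R) : measurable_fun setT h ->
  measurable_fun setT (fun z : pt3 R * pt3 R => h z.1).
Proof. by move=> mh; apply: (measurableT_comp mh); exact: measurable_fst. Qed.

Lemma measurable_comp_snd (h : pt3 R -> R) : measurable_fun setT h ->
  measurable_fun setT (fun z : pt3 R * pt3 R => h z.2).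
Proof. by move=> mh; apply: (measurableT_comp mh); exact: measurable_snd. Qed.

(** For [s > 0] the value on the diagonal is [0^-1 = 0]. Nothing is lost, since the numerator
    [(u x - u y)^2] vanishes there too. *)
Definition kern (s : R) (z : pt3 R * pt3 R) : R :=
  ((dist3 z.1 z.2) `^ (3 + 2 * s))^-1.

Lemma kern_ge0 s z : 0 <= kern s z.
Proof. by rewrite invr_ge0 powR_ge0. Qed.

Lemma measurable_kern s : measurable_fun setT (kern s).
Proof.
rewrite (_ : kern s = fun z => (dist3 z.1 z.2) `^ (- (3 + 2 * s))); last first.
  by apply/funext => z; rewrite powRN.
apply: (measurableT_comp (measurable_powR _)).
rewrite /dist3.
have msq : measurable_fun setT (@Num.sqrt R).
  by apply: continuous_measurable_fun; exact: sqrt_continuous.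
apply: (measurableT_comp msq).
by do 2?apply: measurable_funD; apply: measurable_funX; apply: measurable_funB;
  (apply: measurable_comp_fst || apply: measurable_comp_snd);
  (exact: measurable_c1 || exact: measurable_c2 || exact: measurable_c3).
Qed.

Lemma measurable_scale3 (e : R) : measurable_fun setT (@scale3 R e).
Proof.
apply: measurable_fun_pair => /=; first apply: measurable_fun_pair => /=.
- by apply: measurable_funM => //; exact: measurable_c1.
- by apply: measurable_funM => //; exact: measurable_c2.
- by apply: measurable_funM => //; exact: measurable_c3.
Qed.

(* The library knows the Borel sets of the line only: in the product, an open
   set is a countable union of boxes with rational centers. *)
Lemma open_measurable3 (A : set (pt3 R)) : open A -> measurable A.
Proof.
move=> oA.
pose box (q : rat * rat * rat * nat) : set (pt3 R) :=
  (ball (ratr q.1.1.1 : R) q.2.+1%:R^-1 `*` ball (ratr q.1.1.2 : R) q.2.+1%:R^-1)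
  `*` ball (ratr q.1.2 : R) q.2.+1%:R^-1.
have -> : A = \bigcup_(q in [set: rat * rat * rat * nat])
    (if `[< box q `<=` A >] then box q else set0).
  apply/seteqP; split => x; last first.
    by move=> [q _]; case: ifPn => // /asboolP qA /qA.
  move=> Ax; have /nbhs_ballP[e /= e0 xeA] : nbhs x A by exact: open_nbhs_nbhs.
  (* A box of radius [r] around a rational point that contains [x] stays in the [e]-ball around [x],
     as [2r < e]. *)
  have [n [r [rE r0 re]]] : exists n r, [/\ r = n.+1%:R^-1, 0 < r & 2 * r < e].
    have e2 : 0 < e / 2 by lra.
    have [n] := ltr_add_invr e2; rewrite add0r => ne.
    exists n, n.+1%:R^-1; split=> //; move: ne; set r := _^-1 => ne.
    by lra.
  have rq (a : R) : exists q : rat, ball (ratr q : R) r a.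
    have /rat_in_itvoo[q] : a - r < a + r by lra.
    rewrite in_itv/= => /andP[h1 h2]; exists q.
    by rewrite -ball_normE/= ltr_norml; apply/andP; split; lra.
  have [q1 h1] := rq x.1.1; have [q2 h2] := rq x.1.2; have [q3 h3] := rq x.2.
  exists (q1, q2, q3, n) => //; rewrite ifT; first by rewrite /box/= -rE; split.
  apply/asboolP => y; rewrite /box/= -rE => -[[/= y1 y2] y3]; apply: xeA.
  have tri (a b c : R) : ball c r a -> ball c r b -> ball a e b.
    rewrite -!ball_normE/= => ca cb; rewrite (le_lt_trans (ler_distD c _ _))//.
    by rewrite (distrC a); lra.
  by split; [split|]; [exact: tri h1 y1|exact: tri h2 y2|exact: tri h3 y3].
apply: countable_bigcupT_measurable => // q; case: ifP => // _.
by apply: measurableX => //; [apply: measurableX|]; exact: measurable_ball.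
Qed.

Lemma continuous_measurable3 (V : pt3 R -> R) : continuous V ->
  measurable_fun setT V.
Proof.
move=> /continuousP cV; apply: (measurability _ (RGenOpens.measurableE R)).
move=> _ [_ [a [b ->] <-]]; rewrite setTI; apply: open_measurable3.
exact/cV/interval_open.
Qed.

Lemma measurable_indic_scale (A : set (pt3 R)) (e : R) : measurable A ->
  measurable_fun setT (fun x => \1_A (scale3 e x) : R).
Proof.
move=> mA; apply: (measurableT_comp (f := \1_A : pt3 R -> R)).
  exact: measurable_indic.
exact: measurable_scale3.
Qed.

End measurability3.

(** * Primitives and increments in one variable *)

Section primitive.
Context {R : realType}.
Implicit Types h : R -> R.

Lemma continuous_integrable_itv h (a b : R) : continuous h ->
  (@lebesgue_measure R).-integrable `[a, b] (EFin \o h).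
Proof.
move=> ch; apply: continuous_compact_integrable; first exact: segment_compact.
exact: continuous_subspaceT.
Qed.

(** With a base point [c] to the left of [0] and [x], the two signed cases become one difference of
    integrals starting at [c], the form to which the fundamental theorem of calculus applies. *)
Lemma int0E h (c x : R) : continuous h -> c < 0 -> c < x ->
  int0 h x = (\int[@lebesgue_measure R]_(y in `[c, x]) h y)%R -
             (\int[@lebesgue_measure R]_(y in `[c, 0%R]) h y)%R.
Proof.
move=> ch c0 cx; have ih a b := @continuous_integrable_itv h a b ch.
rewrite /int0; case: ifPn => [x0|]; last rewrite -ltNge => x0.
  have -> := @Rintegral_itvB _ h (BLeft c) (BRight x) 0 (ih c x).
  - rewrite Rintegral_itv_obnd_cbnd//.
    by apply: integrableS (ih 0 x) => //; exact: subset_itv_oc_cc.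
  - by rewrite bnd_simp ltW.
  - by rewrite bnd_simp.
rewrite -[RHS]opprB; congr (- _).
have -> := @Rintegral_itvB _ h (BLeft c) (BRight 0) x (ih c 0).
- rewrite Rintegral_itv_obnd_cbnd//.
  by apply: integrableS (ih x 0) => //; exact: subset_itv_oc_cc.
- by rewrite bnd_simp ltW.
- by rewrite bnd_simp ltW.
Qed.

Lemma is_derive_int0 h (t : R) : continuous h ->
  is_derive t (1 : R) (int0 h) (h t).
Proof.
move=> ch; pose c := Num.min 0 t - 1.
have c0 : c < 0 by rewrite /c; case: (ltP 0 t); lra.
have ct : c < t by rewrite /c; case: (ltP 0 t); lra.
pose F x := (\int[@lebesgue_measure R]_(y in `[c, x]) h y)%R.
have [dF F'] : derivable F t 1 /\ derive1 F t = h t.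
  apply: (@continuous_FTC1_closed _ h c t (t + 1)) => //; first lra.
    exact: continuous_integrable_itv.
  exact: ch.
have dF' : is_derive t (1 : R) (fun x => F x - F 0) (h t).
  have := derivableP dF; rewrite -derive1E F' => dFt.
  have := @is_deriveB _ _ _ F (cst (F 0)) t 1 _ _ dFt (is_derive_cst _ _ _).
  by rewrite subr0.
apply: near_eq_is_derive dF'; near=> x.
by apply/esym/int0E => //; near: x; exact: lt_nbhsr.
Unshelve. all: by end_near. Qed.

Lemma int00 h : int0 h 0 = 0.
Proof. by rewrite /int0 lexx set_itv1 Rintegral_set1. Qed.

Lemma eq_int0 h1 h2 (t : R) : 0 <= t -> (forall x, 0 <= x -> h1 x = h2 x) ->
  int0 h1 t = int0 h2 t.
Proof.
move=> t0 h12; rewrite /int0 t0; apply: eq_Rintegral => x.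
by rewrite inE/= in_itv/= => /andP[x0 _]; exact: h12.
Qed.

End primitive.

Section increments.
Context {R : realType}.

Lemma le_increment (F f : R -> R) (a b C : R) : a <= b ->
  (forall x, a <= x <= b -> is_derive x (1 : R) F (f x)) ->
  (forall x, a < x < b -> f x <= C) -> F b - F a <= C * (b - a).
Proof.
move=> ab dF fC; have cF : {within `[a, b], continuous F}.
  apply: derivable_within_continuous => x; rewrite in_itv/= => xab.
  by have [] := dF x xab.
move: ab; rewrite le_eqVlt => /predU1P[->|ab]; first by rewrite !subrr mulr0.
have dF' x : x \in `]a, b[ -> is_derive x (1 : R) F (f x).
  by rewrite in_itv/= => /andP[/ltW ax /ltW xb]; apply: dF; rewrite ax.
have [c cab ->] := MVT ab dF' cF.
by rewrite ler_wpM2r ?subr_ge0 ?(ltW ab)// fC// (itvP cab).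
Qed.

Lemma ge_increment (F f : R -> R) (a b C : R) : a <= b ->
  (forall x, a <= x <= b -> is_derive x (1 : R) F (f x)) ->
  (forall x, a < x < b -> C <= f x) -> C * (b - a) <= F b - F a.
Proof.
move=> ab dF fC; rewrite -lerN2 -mulNr opprD.
have := @le_increment (fun x => - F x) (fun x => - f x) a b (- C) ab.
apply => x xab; first by have ? := dF x xab; exact: is_deriveN.
by rewrite lerN2; exact: fC.
Qed.

End increments.

Lemma nneseries_geometric {R : realType} (c z : R) : 0 <= z -> z < 1 ->
  (\sum_(0 <= k <oo) (c * z ^+ k)%:E = (c / (1 - z))%:E)%E.
Proof.
move=> z0 z1; have cz : series (geometric c z) @ \oo --> c / (1 - z).
  by apply: cvg_geometric_series; rewrite ger0_norm.
have cze : (fun n => (series (geometric c z) n)%:E) @ \oo --> (c / (1 - z))%:E.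
  by apply: cvg_EFin => //; exact: nearW.
rewrite -(cvg_lim _ cze)//; congr (limn _); apply/funext => n.
by rewrite /series/= sumEFin.
Qed.

(** * Fatou's lemma for real-valued functions *)

Section fatou_real.
Context {d} {T : measurableType d} {R : realType} (mu : {measure set T -> \bar R}).

Lemma le_limn_einf (u v : nat -> \bar R) : (forall n, u n <= v n)%E ->
  (limn_einf u <= limn_einf v)%E.
Proof.
move=> uv; rewrite !limn_einf_lim; apply: lee_lim.
- exact: is_cvg_einfs.
- exact: is_cvg_einfs.
- apply: nearW => n; apply: le_ereal_inf_tmp => _ [k nk <-].
  by apply: le_trans (uv k); apply: ereal_inf_lbound; exists k.
Qed.

Lemma limn_einf_EFin (u : nat -> R) (l : R) : u n @[n --> \oo] --> l ->
  limn_einf (fun n => (u n)%:E) = l%:E.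
Proof.
by move=> ul; have [|->] := @cvg_limn_einf_sup _ (fun n => (u n)%:E) l%:E;
  first (apply: cvg_EFin; [exact: nearW|exact: ul]).
Qed.

(** Only the upper bounds [c n] have to converge, not the integrals, so the bounds may be read off
    from energies along a sequence. *)
Lemma fatou_real (h : nat -> T -> R) (g : T -> R) (c : nat -> R) (l : R) :
  (forall n, measurable_fun setT (h n)) -> measurable_fun setT g ->
  (forall n x, 0 <= h n x) -> (forall x, 0 <= g x) ->
  {ae mu, forall x, h n x @[n --> \oo] --> g x} ->
  (forall n, (\int[mu]_x (h n x)%:E <= (c n)%:E)%E) ->
  c n @[n --> \oo] --> l ->
  (\int[mu]_x (g x)%:E <= l%:E)%E.
Proof.
move=> mh mg h0 g0 hg hc cl.
pose H n x := (h n x)%:E.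
have mH n : measurable_fun setT (H n) by exact/measurable_EFinP.
have H0 n x : setT x -> (0 <= H n x)%E by rewrite lee_fin h0.
rewrite -(limn_einf_EFin cl).
apply: (@le_trans _ _ (\int[mu]_x limn_einf (H^~ x))%E); last first.
  apply: le_trans (fatou mu measurableT mH H0) _.
  by apply: le_limn_einf => n; exact: hc.
apply: ae_ge0_le_integral => //.
- by move=> x _; rewrite lee_fin.
- exact/measurable_EFinP.
- move=> x _; rewrite -[leLHS]/(0%:E) -(@limn_einf_EFin (cst 0) 0); last exact: cvg_cst.
  by apply: le_limn_einf => n; exact: H0.
(* The lower limit is by definition minus the upper limit of the opposites, so its measurability
   follows from that of [limn_esup]. *)
- rewrite (_ : (fun x => _) = fun x => - limn_esup (fun n => - H n x))%E.
    apply: measurableT_comp => //; apply: measurable_fun_limn_esup => // n.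
    exact: measurableT_comp.
  by [].
- by apply: filterS hg => x /limn_einf_EFin hgx _; rewrite -hgx.
Qed.

End fatou_real.

(** * Cubes and the singular kernel *)

Section cubes.
Context {R : realType}.
Implicit Types (a x y z : pt3 R) (h r s : R).

(** Half-open, so that the cubes of a grid are disjoint and still cover. *)
Definition cube a h : set (pt3 R) :=
  (`[c1 a, c1 a + h[%classic `*` `[c2 a, c2 a + h[%classic)
  `*` `[c3 a, c3 a + h[%classic.

Lemma cubeE a h y : cube a h y <->
  [/\ c1 a <= c1 y < c1 a + h, c2 a <= c2 y < c2 a + h
    & c3 a <= c3 y < c3 a + h].
Proof.
rewrite /cube/= !in_itv/=; split; first by move=> [[]].
by move=> [].
Qed.

Lemma measurable_cube a h : measurable (cube a h).
Proof. by apply: measurableX => //; apply: measurableX. Qed.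

Lemma leb3_cube a h : 0 <= h -> @leb3 R (cube a h) = (h ^+ 3)%:E.
Proof.
move=> h0; rewrite /leb3 product_measure1E//=; last exact: measurableX.
rewrite product_measure1E//=; rewrite !lebesgue_measure_itv/= !lte_fin.
have E (u : R) : (if (u < u + h)%R then (u + h)%:E - u%:E else 0)%E = h%:E.
  rewrite ltrDl; case: ltP => [_|h0']; first by rewrite -EFinB; congr (_%:E); ring.
  by congr (_%:E); apply/eqP; rewrite eq_le h0 h0'.
by rewrite !E -!EFinM; congr (_%:E); ring.
Qed.

(** The factor [2] is a convenient bound for [sqrt 3]. *)
Lemma dist3_le r x y : 0 <= r -> `|c1 x - c1 y| <= r -> `|c2 x - c2 y| <= r ->
  `|c3 x - c3 y| <= r -> dist3 x y <= 2 * r.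
Proof.
move=> r0 h1 h2 h3; have sq t : `|t| <= r -> t ^+ 2 <= r ^+ 2.
  by move=> tr; rewrite -[t ^+ 2]ger0_norm ?sqr_ge0// normrX lerXn2r ?nnegrE.
rewrite -[leRHS]ger0_norm; last lra.
rewrite -sqrtr_sqr ler_wsqrtr//.
by have := sq _ h1; have := sq _ h2; have := sq _ h3; have := sqr_ge0 r; nra.
Qed.

Lemma dist3_center x y r : 0 < r ->
  cube (c1 x - r / 2, c2 x - r / 2, c3 x - r / 2) r y -> dist3 x y <= r.
Proof.
move=> r0 /cubeE[/= /andP[a1 b1] /andP[a2 b2] /andP[a3 b3]].
rewrite /dist3 -[leRHS]ger0_norm ?(ltW r0)// -sqrtr_sqr ler_wsqrtr//.
have sq t : - (r / 2) <= t -> t <= r / 2 -> t ^+ 2 <= r ^+ 2 / 4 by nra.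
have q1 : (c1 x - c1 y) ^+ 2 <= r ^+ 2 / 4.
  by apply: sq; move: a1 b1; rewrite /c1/=; lra.
have q2 : (c2 x - c2 y) ^+ 2 <= r ^+ 2 / 4.
  by apply: sq; move: a2 b2; rewrite /c2/=; lra.
have q3 : (c3 x - c3 y) ^+ 2 <= r ^+ 2 / 4.
  by apply: sq; move: a3 b3; rewrite /c3/=; lra.
by have := sqr_ge0 r; lra.
Qed.

Lemma dist3_eq0 x y : dist3 x y <= 0 -> x = y.
Proof.
move=> d0; have /eqP : dist3 x y == 0 by rewrite eq_le d0 sqrtr_ge0.
move/eqP; rewrite sqrtr_eq0 => e0.
have h1 := sqr_ge0 (c1 x - c1 y); have h2 := sqr_ge0 (c2 x - c2 y).
have h3 := sqr_ge0 (c3 x - c3 y).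
have z (t : R) : t ^+ 2 <= 0 -> t = 0.
  by move=> t0; apply/eqP; rewrite -sqrf_eq0 eq_le t0 sqr_ge0.
have e1 := z _ (le_trans (_ : (c1 x - c1 y) ^+ 2 <= _) e0).
have {}e1 : c1 x = c1 y by apply/eqP; rewrite -subr_eq0; apply/eqP/e1; lra.
have e2 := z _ (le_trans (_ : (c2 x - c2 y) ^+ 2 <= _) e0).
have {}e2 : c2 x = c2 y by apply/eqP; rewrite -subr_eq0; apply/eqP/e2; lra.
have e3 := z _ (le_trans (_ : (c3 x - c3 y) ^+ 2 <= _) e0).
have {}e3 : c3 x = c3 y by apply/eqP; rewrite -subr_eq0; apply/eqP/e3; lra.
by move: e1 e2 e3; rewrite /c1 /c2 /c3; case: x {d0 e0 h1 h2 h3} => [[? ?] ?];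
  case: y => [[? ?] ?] /= -> -> ->.
Qed.

Lemma sqr_le_kern s r (u : pt3 R -> R) x y : 0 < s -> dist3 x y <= r ->
  (u x - u y) ^+ 2 <= r `^ (3 + 2 * s) * ((u x - u y) ^+ 2 * kern s (x, y)).
Proof.
move=> s0 xyr; have [d0|d0] := ltP 0 (dist3 x y); last first.
  by rewrite (dist3_eq0 d0) subrr expr0n/= mul0r mulr0.
rewrite mulrCA ler_peMr ?sqr_ge0// /kern/= ler_pdivlMr ?powR_gt0// mul1r.
rewrite ge0_ler_powR ?nnegrE//; first lra.
- exact: ltW.
- exact: le_trans (ltW d0) xyr.
Qed.

Lemma gagliardoE s (u : pt3 R -> R) : gagliardo s u =
  (\int[@leb6 R]_z ((u z.1 - u z.2) ^+ 2 * kern s z)%:E)%E.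
Proof. by []. Qed.

Lemma measurable_gagliardo s (u : pt3 R -> R) : measurable_fun setT u ->
  measurable_fun setT
    (fun z : pt3 R * pt3 R => (u z.1 - u z.2) ^+ 2 * kern s z).
Proof.
move=> mu; apply: measurable_funM; last exact: measurable_kern.
apply: measurable_funX; apply: measurable_funB.
- exact: measurable_comp_fst.
- exact: measurable_comp_snd.
Qed.

Lemma gagliardo_fubini s (u : pt3 R -> R) : measurable_fun setT u ->
  gagliardo s u = (\int[@leb3 R]_x \int[@leb3 R]_y
    ((u x - u y) ^+ 2 * kern s (x, y))%:E)%E.
Proof.
move=> mu; rewrite gagliardoE.
rewrite (@fubini_tonelli1 _ _ _ _ R (@leb3 R) (@leb3 R))//.
- by apply/measurable_EFinP; exact: measurable_gagliardo.
- by move=> z; rewrite lee_fin mulr_ge0 ?sqr_ge0 ?kern_ge0.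
Qed.

End cubes.

Lemma ge0_lty_EFin {R : realType} (x : \bar R) : (0 <= x)%E -> (x < +oo)%E ->
  exists2 m : R, 0 <= m & x = m%:E.
Proof. by case: x => [m| |]//; rewrite lee_fin => m0 _; exists m. Qed.

(** * Fractional Sobolev embedding through superlevel sets *)

Section weak_sobolev.
Context {R : realType} (s : R).
Hypotheses (s0 : 0 < s) (s1 : s < 1).

Definition superlevel (u : pt3 R -> R) (lam : R) : set (pt3 R) :=
  [set x | lam < `|u x|].

Lemma measurable_superlevel (u : pt3 R -> R) (lam : R) : measurable_fun setT u ->
  measurable (superlevel u lam).
Proof.
move=> mu; rewrite (_ : superlevel u lam =
  setT `&` (fun x => `|u x|) @^-1` `]lam, +oo[%classic).
  have := measurableT_comp (@normr_measurable R setT) mu.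
  by apply => //; exact: measurable_itv.
by rewrite setTI; apply/seteqP; split => x /=; rewrite in_itv/= andbT.
Qed.

(** If [{|u| > lam}] has at most half the volume of a cube of side [r], then the cube centred at a
    point [x] with [|u x| > 2 lam] contains a volume of at least [r^3 / 2] of points [y] with
    [|u y| <= lam]. Each such pair has [|u x - u y| >= lam] at distance at most [r], so the
    integrand is at least [c]; dividing [g] by [c * r^3 / 2] bounds the measure of the points
    [x]. *)
Lemma superlevel_step (u : pt3 R -> R) (lam r g : R) : measurable_fun setT u -> 0 < lam ->
  0 < r -> (gagliardo s u <= g%:E)%E ->
  (2%:E * @leb3 R (superlevel u lam) <= (r ^+ 3)%:E)%E ->
  (@leb3 R (superlevel u (2 * lam)) <= (2 * g * r `^ (2 * s) / lam ^+ 2)%:E)%E.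
Proof.
move=> mu l0 r0 gag Er.
set E1 := superlevel u lam; set E2 := superlevel u (2 * lam).
have mE1 : measurable E1 by exact: measurable_superlevel.
have mE2 : measurable E2 by exact: measurable_superlevel.
pose c := lam ^+ 2 / r `^ (3 + 2 * s).
have c0 : 0 < c by rewrite divr_gt0 ?exprn_gt0 ?powR_gt0.
have inner x : E2 x -> ((c * (r ^+ 3 / 2))%:E <= \int[@leb3 R]_y
    ((u x - u y) ^+ 2 * kern s (x, y))%:E)%E.
  move=> E2x; pose a : pt3 R := (c1 x - r / 2, c2 x - r / 2, c3 x - r / 2).
  have mQ : measurable (cube a r `\` E1).
    by apply: measurableD => //; exact: measurable_cube.
  have mF : measurable_fun setT
      (fun y => ((u x - u y) ^+ 2 * kern s (x, y))%:E).
    apply/measurable_EFinP.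
    exact: (measurable_fun_pair2 _ (measurable_gagliardo s mu)).
  apply: (@le_trans _ _ (\int[@leb3 R]_(y in cube a r `\` E1)
      ((u x - u y) ^+ 2 * kern s (x, y))%:E)%E); last first.
    apply: ge0_subset_integral => //.
    by move=> y _; rewrite lee_fin mulr_ge0 ?sqr_ge0 ?kern_ge0.
  apply: (@le_trans _ _ (\int[@leb3 R]_(y in cube a r `\` E1) c%:E)%E).
    rewrite integral_cst// EFinM lee_pmul2l// ?lte_fin//.
    have [m m0 Em] : exists2 m : R, 0 <= m & @leb3 R E1 = m%:E.
      apply: ge0_lty_EFin; first exact: measure_ge0.
      have : (2%:E * @leb3 R E1 < +oo)%E by rewrite (le_lt_trans Er) ?ltry.
      by apply: contraTT; rewrite -!leNgt !leye_eq => /eqP ->;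
        rewrite gt0_muley ?lte_fin.
    apply: (@le_trans _ _ (@leb3 R (cube a r) - @leb3 R E1)%E).
      rewrite leb3_cube ?(ltW r0)//; move: Er.
      by rewrite Em -EFinM -EFinB !lee_fin => ?; lra.
    rewrite leeBlDr ?Em// -Em.
    apply: (@le_trans _ _ (@leb3 R ((cube a r `\` E1) `|` E1))).
      apply: le_measure; rewrite ?inE; [exact: measurable_cube|exact: measurableU|].
      by move=> y ay; have [E1y|E1y] := pselect (E1 y); [right|left].
    exact: measureU2.
  apply: ge0_le_integral => //.
  - by move=> y _; rewrite lee_fin ltW.
  - exact: measurable_funTS.
  - move=> y [] Qy /negP; rewrite -leNgt => nE1.
    rewrite lee_fin /c ler_pdivrMr ?powR_gt0// mulrC.
    have xyr : dist3 x y <= r by exact: dist3_center.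
    apply: le_trans (sqr_le_kern u s0 xyr).
    rewrite -[leRHS]ger0_norm ?sqr_ge0// normrX lerXn2r ?nnegrE//; first exact: ltW.
    have := ler_normB (u x) (u y); have := lerB_normD (u x) (- u y).
    by move: E2x nE1; rewrite /E2 /superlevel/= normrN; lra.
have : ((c * (r ^+ 3 / 2))%:E * @leb3 R E2 <= g%:E)%E.
  apply: le_trans gag; rewrite gagliardo_fubini//.
  rewrite -integral_cst//.
  apply: (@le_trans _ _ (\int[@leb3 R]_(x in E2) \int[@leb3 R]_y
    ((u x - u y) ^+ 2 * kern s (x, y))%:E)%E).
    apply: ge0_le_integral => //.
    - by move=> x _; rewrite lee_fin mulr_ge0 ?(ltW c0)// divr_ge0 ?exprn_ge0 ?(ltW r0).
    - apply: measurable_funTS.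
      apply: (@measurable_fun_fubini_tonelli_F _ _ _ _ R (@leb3 R)
        (fun z => ((u z.1 - u z.2) ^+ 2 * kern s z)%:E)).
      + by apply/measurable_EFinP; exact: measurable_gagliardo.
      + by move=> z; rewrite lee_fin mulr_ge0 ?sqr_ge0 ?kern_ge0.
  apply: ge0_subset_integral => //.
  - apply: (@measurable_fun_fubini_tonelli_F _ _ _ _ R (@leb3 R)
      (fun z => ((u z.1 - u z.2) ^+ 2 * kern s z)%:E)).
    + by apply/measurable_EFinP; exact: measurable_gagliardo.
    + by move=> z; rewrite lee_fin mulr_ge0 ?sqr_ge0 ?kern_ge0.
  - move=> x _; apply: integral_ge0 => y _.
    by rewrite lee_fin mulr_ge0 ?sqr_ge0 ?kern_ge0.
have k0 : 0 < c * (r ^+ 3 / 2) by apply: mulr_gt0 => //; rewrite divr_gt0 ?exprn_gt0.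
move=> kg; have [m m0 Em] : exists2 m : R, 0 <= m & @leb3 R E2 = m%:E.
  apply: ge0_lty_EFin; first exact: measure_ge0.
  move: (le_lt_trans kg (ltry g)); apply: contraTT.
  by rewrite -!leNgt !leye_eq => /eqP ->; rewrite gt0_muley ?lte_fin.
move: kg; rewrite Em -EFinM !lee_fin mulrC -ler_pdivlMr// => /le_trans; apply.
rewrite le_eqVlt; apply/orP; left; apply/eqP; rewrite /c.
rewrite powRD; last by apply/implyP => _; rewrite gt_eqF.
rewrite (_ : r `^ 3 = r ^+ 3); last by rewrite -powR_mulrn ?(ltW r0).
by field; rewrite ?gt_eqF ?powR_gt0.
Qed.

(** The critical Sobolev exponent [2n / (n - 2s)] in dimension [n = 3]. *)
Definition pstar : R := 6 / (3 - 2 * s).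

(** This identity makes [2^(- pstar)] a fixed point of the recursion in [superlevel_decay]: the cube
    side contributes the factor [2s / 3], and the division by [lam^2] the summand [2]. *)
Lemma pstarE : pstar * (2 * s / 3) + 2 = pstar.
Proof. by rewrite /pstar; field; move: s1; lra. Qed.

(** A weak-type estimate at the critical exponent, by induction on the level. At step [k] the side
    [r] is the smallest that [superlevel_step] admits, [r^3 = 2 D b^k]; the step then returns
    [A D^e b^(k+1)], because [b^e / 4 = b]. As [e = 2s / 3 < 1], a large [D] satisfies [A D^e <= D]
    and the induction closes. The case [k = 0] is Chebyshev's inequality. *)
Lemma superlevel_decay : exists2 D : R, 0 < D & forall u : pt3 R -> R,
  measurable_fun setT u -> (gagliardo s u <= 1)%E -> (L2sq u <= 1)%E ->
  forall k, (@leb3 R (superlevel u (2 ^+ k)) <= (D * (2 `^ (- pstar)) ^+ k)%:E)%E.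
Proof.
set b := 2 `^ (- pstar); have b0 : 0 < b by rewrite powR_gt0.
pose e := 2 * s / 3; have e01 : 0 < e < 1 by move: s0 s1; rewrite /e => ? ?; apply/andP; split; lra.
have be : b `^ e / 4 = b.
  rewrite /b -powRrM (_ : 4 = 2 `^ 2 :> R); last first.
    by rewrite (_ : 2 `^ 2 = 2 ^+ 2); [ring|rewrite -powR_mulrn].
  rewrite -powRN -powRD; last by apply/implyP => _; rewrite pnatr_eq0.
  by congr powR; rewrite /e -[in RHS]pstarE; ring.
pose A := 2 * 2 `^ e / b; have A0 : 0 < A by rewrite divr_gt0 ?mulr_gt0 ?powR_gt0.
pose D := Num.max 1 (A `^ (1 - e)^-1).
have D1 : 1 <= D by rewrite le_max lexx.
have D0 : 0 < D by lra.
have AD : A * D `^ e <= D.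
  have AD1 : A <= D `^ (1 - e).
    rewrite -[leLHS]powRr1 ?(ltW A0)//.
    rewrite -[X in A `^ X](@mulVf _ (1 - e)); last by rewrite gt_eqF; lra.
    rewrite powRrM ge0_ler_powR ?nnegrE ?powR_ge0 ?(ltW D0)//; first lra.
    by rewrite le_max lexx orbT.
  apply: le_trans (ler_wpM2r (powR_ge0 _ _) AD1) _.
  rewrite -powRD ?subrK ?powRr1 ?(ltW D0)//.
  by apply/implyP => _; rewrite gt_eqF.
exists D => // u mu gag l2; elim=> [|k IH].
  rewrite !expr0 mulr1.
  have mE : measurable (superlevel u 1) by exact: measurable_superlevel.
  apply: (@le_trans _ _ (L2sq u)); last by apply: le_trans l2 _; rewrite lee_fin.
  apply: (@le_trans _ _ (\int[@leb3 R]_(x in superlevel u 1) (u x ^+ 2)%:E)%E).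
    rewrite -[leLHS]mul1e -integral_cst//; apply: ge0_le_integral => //.
    - by apply: measurable_funTS; apply/measurable_EFinP; exact: measurable_funX.
    - move=> x; rewrite /superlevel/= => ux; rewrite lee_fin.
      by rewrite -[u x ^+ 2]ger0_norm ?sqr_ge0// normrX exprn_ege1// ltW.
  apply: ge0_subset_integral => //.
  - by apply/measurable_EFinP; exact: measurable_funX.
  - by move=> x _; rewrite lee_fin sqr_ge0.
pose r := (2 * (D * b ^+ k)) `^ 3^-1.
have Dk0 : 0 < 2 * (D * b ^+ k) by rewrite !mulr_gt0 ?exprn_gt0.
have r0 : 0 < r by rewrite powR_gt0.
have r3 : r ^+ 3 = 2 * (D * b ^+ k).
  by rewrite -powR_mulrn ?ltW// -powRrM mulVf// powRr1// ltW.
have k2 : 0 < 2 ^+ k :> R by rewrite exprn_gt0.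
rewrite exprS; apply: le_trans (superlevel_step mu k2 r0 gag _) _.
  by rewrite r3 EFinM lee_pmul2l// lte_fin.
rewrite lee_fin mulr1.
have -> : r `^ (2 * s) = 2 `^ e * (D `^ e * (b `^ e) ^+ k).
  rewrite /r -powRrM (_ : 3^-1 * (2 * s) = e); last by rewrite /e; ring.
  rewrite !powRM ?mulr_ge0 ?exprn_ge0 ?(ltW D0) ?(ltW b0)//.
  rewrite -(powR_mulrn k (ltW b0)) -(powR_mulrn k (powR_ge0 b e)) -!powRrM.
  by rewrite [e * _]mulrC.
have -> : b `^ e = 4 * b by rewrite -[in RHS]be; field.
rewrite exprMn -exprM mulnC exprM (_ : 2 ^+ 2 = 4 :> R); last by ring.
have k4 : 0 < 4 ^+ k :> R by rewrite exprn_gt0.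
rewrite (_ : _ / _ = (A * D `^ e) * b ^+ k.+1); last first.
  by rewrite /A exprS; field; rewrite ?gt_eqF.
by rewrite ler_wpM2r ?exprn_ge0 ?(ltW b0).
Qed.

(** Below [1] the square dominates, as [q >= 2]; above it, the term of the sum with
    [2^k < |t| <= 2^(k+1)] dominates alone. *)
Lemma powR_le_dyadic (q t : R) : 2 <= q -> (((`|t| `^ q)%:E <= (t ^+ 2)%:E +
  \sum_(0 <= k <oo) (2 `^ (q * k.+1%:R) * \1_[set t | (2 ^+ k < `|t|)%R] t)%:E))%E.
Proof.
move=> q2; have F0 k : (0 <= (2 `^ (q * k.+1%:R) *
    \1_[set t : R | (2 ^+ k < `|t|)%R] t)%:E)%E.
  by rewrite lee_fin mulr_ge0 ?powR_ge0.
have [t1|t1] := leP `|t| 1.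
  apply: (@le_trans _ _ (t ^+ 2)%:E).
    rewrite lee_fin -[t ^+ 2]ger0_norm ?sqr_ge0// normrX -powR_mulrn//.
    have [->|t0] := eqVneq `|t| 0; first by rewrite !powR0// gt_eqF//; lra.
    by rewrite ger_powR// t1 andbT lt_neqAle eq_sym t0 normr_ge0.
  by rewrite leeDl// nneseries_ge0.
have [n tn] : exists n, `|t| <= 2 ^+ n.
  exists (Num.truncn `|t|).+1; apply: le_trans (ltW (truncnS_gt _)) _.
  by rewrite -natrX ler_nat ltnW// ltn_expl.
have ex : exists n, `|t| <= 2 ^+ n.+1.
  by exists n; rewrite (le_trans tn)// ler_weXn2l// ler1n.
pose k := ex_minn ex.
have [kt kmin] : `|t| <= 2 ^+ k.+1 /\ 2 ^+ k < `|t|.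
  rewrite /k; case: ex_minnP => m mt mmin; split=> //.
  case: m mt mmin => [|m] mt mmin; first by rewrite expr0.
  by rewrite ltNge; apply/negP => /mmin; rewrite ltnn.
apply: (@le_trans _ _ (2 `^ (q * k.+1%:R))%:E).
  rewrite lee_fin mulrC powRrM powR_mulrn// ge0_ler_powR ?nnegrE ?exprn_ge0//.
  lra.
rewrite -[leLHS]add0e leeD ?lee_fin ?sqr_ge0//.
rewrite (@nneseriesD1 _ _ k)//.
rewrite indicE mem_set//= mulr1 leeDl// nneseries_ge0// => m _ _; case: ifP => //.
Qed.

(** Integrating the dyadic majorant turns the weak-type decay into a geometric series of ratio
    [2^(q - pstar)], which converges because [q] is subcritical. *)
Lemma sobolev_unit (q : R) : 2 <= q -> q < pstar -> exists2 C : R, 0 < C &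
  forall u : pt3 R -> R, measurable_fun setT u -> (gagliardo s u <= 1)%E ->
    (L2sq u <= 1)%E -> (\int[@leb3 R]_x (`|u x| `^ q)%:E <= C%:E)%E.
Proof.
move=> q2 qp; have [D D0 HD] := superlevel_decay.
set b := 2 `^ (- pstar) in HD; have b0 : 0 < b by rewrite powR_gt0.
pose z := b * 2 `^ q; have z0 : 0 < z by rewrite mulr_gt0 ?powR_gt0.
have z1 : z < 1.
  rewrite /z /b -powRD; last by apply/implyP => _; rewrite pnatr_eq0.
  have ln2 : 0 < ln 2 :> R by rewrite ln_gt0// ltr1n.
  by rewrite /powR pnatr_eq0/= -[ltRHS]expR0 ltr_expR; nra.
exists (1 + 2 `^ q * D / (1 - z)).
  by rewrite ltr_pwDl// divr_ge0 ?mulr_ge0 ?powR_ge0//; lra.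
move=> u mu gag l2.
have mind k : measurable_fun setT (fun x => (2 `^ (q * k.+1%:R) *
    \1_[set t : R | (2 ^+ k < `|t|)%R] (u x))%:E).
  apply/measurable_EFinP; apply: measurable_funM => //.
  exact: (measurable_indic (measurable_superlevel (2 ^+ k) mu)).
have ind0 k x : (0 <= (2 `^ (q * k.+1%:R) *
    \1_[set t : R | (2 ^+ k < `|t|)%R] (u x))%:E)%E.
  by rewrite lee_fin mulr_ge0 ?powR_ge0.
have mq : measurable_fun setT (fun x => (`|u x| `^ q)%:E).
  apply/measurable_EFinP; apply: (measurableT_comp (measurable_powR _)).
  exact: measurableT_comp.
have m2 : measurable_fun setT (fun x => (u x ^+ 2)%:E).
  by apply/measurable_EFinP; exact: measurable_funX.
apply: (@le_trans _ _ (\int[@leb3 R]_x ((u x ^+ 2)%:E + \sum_(0 <= k <oo)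
  (2 `^ (q * k.+1%:R) * \1_[set t | (2 ^+ k < `|t|)%R] (u x))%:E))%E).
  apply: ge0_le_integral => //.
  - apply: emeasurable_funD => //; apply: ge0_emeasurable_sum => // k _; exact: mind.
  - by move=> x _; exact: powR_le_dyadic.
rewrite ge0_integralD//; last 3 first.
- by move=> x _; rewrite lee_fin sqr_ge0.
- by move=> x _; exact: nneseries_ge0.
- by apply: ge0_emeasurable_sum => // k _; exact: mind.
rewrite integral_nneseries// EFinD leeD//.
apply: (@le_trans _ _ (\sum_(0 <= k <oo) (2 `^ q * D * z ^+ k)%:E)%E).
  apply: lee_nneseries => [k *|k *]; first by apply: integral_ge0.
  under eq_integral do rewrite EFinM.
  rewrite ge0_integralZl_EFin ?powR_ge0//; last first.
    by apply/measurable_EFinP; exact: (measurable_indic (measurable_superlevel (2 ^+ k) mu)).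
  rewrite (_ : (\int[_]_x _)%E = @leb3 R (superlevel u (2 ^+ k))); last first.
    rewrite -[in RHS](setIT (superlevel _ _)) -integral_indic//.
    exact: measurable_superlevel.
  apply: le_trans (lee_wpmul2l _ (HD u mu gag l2 k)) _; first by rewrite lee_fin powR_ge0.
  rewrite -EFinM lee_fin /z exprMn -[(2 `^ q) ^+ k]powR_mulrn ?powR_ge0// -powRrM.
  rewrite -[k.+1%:R]natr1 mulrDr mulr1 powRD; last by apply/implyP => _; rewrite pnatr_eq0.
  by rewrite le_eqVlt; apply/orP; left; apply/eqP; ring.
by rewrite nneseries_geometric// ltW.
Qed.

(** By homogeneity, [u / a] falls under the unit case. *)
Lemma sobolev (q : R) : 2 <= q -> q < pstar -> exists2 C : R, 0 < C &
  forall (u : pt3 R -> R) (a : R), measurable_fun setT u -> 0 < a ->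
    (gagliardo s u <= (a ^+ 2)%:E)%E -> (L2sq u <= (a ^+ 2)%:E)%E ->
    (\int[@leb3 R]_x (`|u x| `^ q)%:E <= (C * a `^ q)%:E)%E.
Proof.
move=> q2 qp; have [C C0 HC] := sobolev_unit q2 qp.
exists C => // u a mu a0 gag l2.
pose w x := a^-1 * u x.
have mw : measurable_fun setT w by exact: measurable_funM.
have a20 : 0 <= (a ^+ 2)^-1 by rewrite invr_ge0 exprn_ge0 ?ltW.
have aa : (a ^+ 2)^-1 * a ^+ 2 = 1 by rewrite mulVf// gt_eqF// exprn_gt0.
have gw : (gagliardo s w <= 1)%E.
  have -> : gagliardo s w = (((a ^+ 2)^-1)%:E * gagliardo s u)%E.
    rewrite !gagliardoE -ge0_integralZl_EFin//.
    - by apply: eq_integral => z _; rewrite -EFinM; congr (_%:E); rewrite /w; field; rewrite gt_eqF.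
    - by move=> z _; rewrite lee_fin mulr_ge0 ?sqr_ge0 ?kern_ge0.
    - by apply/measurable_EFinP; exact: measurable_gagliardo.
  apply: le_trans (lee_wpmul2l _ gag) _; first by rewrite lee_fin.
  by rewrite -EFinM aa.
have lw : (L2sq w <= 1)%E.
  have -> : L2sq w = (((a ^+ 2)^-1)%:E * L2sq u)%E.
    rewrite /L2sq -ge0_integralZl_EFin//.
    - by apply: eq_integral => z _; rewrite -EFinM; congr (_%:E); rewrite /w; field; rewrite gt_eqF.
    - by move=> z _; rewrite lee_fin sqr_ge0.
    - by apply/measurable_EFinP; exact: measurable_funX.
  apply: le_trans (lee_wpmul2l _ l2) _; first by rewrite lee_fin.
  by rewrite -EFinM aa.
have -> : (\int[@leb3 R]_x (`|u x| `^ q)%:E =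
    (a `^ q)%:E * \int[@leb3 R]_x (`|w x| `^ q)%:E)%E.
  rewrite -ge0_integralZl_EFin ?powR_ge0//.
  - apply: eq_integral => z _; rewrite -EFinM -powRM ?(ltW a0)//.
    by congr (_ `^ _)%:E; rewrite /w normrM gtr0_norm ?invr_gt0// mulVKf// gt_eqF.
  apply/measurable_EFinP; apply: (measurableT_comp (measurable_powR _)).
  exact: measurableT_comp.
rewrite mulrC EFinM; apply: lee_wpmul2l; first by rewrite lee_fin powR_ge0.
exact: HC.
Qed.

End weak_sobolev.

(** * Integrability of real-valued functions on a set *)

Section integrability_tools.
Context {d} {T : measurableType d} {R : realType} (mu : {measure set T -> \bar R}).
Implicit Types (D : set T) (f g : T -> R).

Lemma ae_imp (P Q : T -> Prop) : (forall x, P x -> Q x) ->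
  {ae mu, forall x, P x} -> {ae mu, forall x, Q x}.
Proof. by move=> PQ; apply: filterS. Qed.

Lemma integrable_ge0_lty D f : measurable D -> measurable_fun D f ->
  (forall x, D x -> 0 <= f x) -> (\int[mu]_(x in D) (f x)%:E < +oo)%E ->
  mu.-integrable D (EFin \o f).
Proof.
move=> mD mf f0 fi; apply/integrableP; split; first exact/measurable_EFinP.
rewrite (eq_integral (fun x => (f x)%:E))// => x; rewrite inE => Dx.
by rewrite /= ger0_norm// f0.
Qed.

Lemma le_integrableR D f g : measurable D -> measurable_fun D f ->
  (forall x, D x -> `|f x| <= g x) -> mu.-integrable D (EFin \o g) ->
  mu.-integrable D (EFin \o f).
Proof.
move=> mD mf fg ig; apply: le_integrable ig => //; first exact/measurable_EFinP.
move=> x Dx; rewrite /= lee_fin; apply: le_trans (fg x Dx) _; exact: ler_norm.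
Qed.

Lemma Rintegral_EFin D f : mu.-integrable D (EFin \o f) -> measurable D ->
  (\int[mu]_(x in D) (f x)%:E)%E = (\int[mu]_(x in D) f x)%:E.
Proof. by move=> fi mD; rewrite /Rintegral fineK//; exact: integrable_fin_num. Qed.

Lemma integral_indicM D f :
  (\int[mu]_(x in D) (f x)%:E = \int[mu]_x (\1_D x * f x)%:E)%E.
Proof.
rewrite integral_mkcond; apply: eq_integral => x _.
by rewrite patchE indicE; case: ifPn; rewrite ?mul1r ?mul0r.
Qed.

Lemma integrable_cst_lty D (c : R) : measurable D -> (mu D < +oo)%E ->
  mu.-integrable D (EFin \o cst c).
Proof.
move=> mD muD; apply/integrableP; split.
  exact/measurable_EFinP.
have [m m0 Em] := ge0_lty_EFin (measure_ge0 mu D) muD.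
by rewrite (integral_cst mu mD `|c%:E|%E) Em -EFinM ltry.
Qed.

Lemma eq_integrableR D f g : measurable D -> (forall x, D x -> f x = g x) ->
  mu.-integrable D (EFin \o f) -> mu.-integrable D (EFin \o g).
Proof.
move=> mD fg; apply: eq_integrable => // x; rewrite inE => Dx.
by rewrite /= fg.
Qed.

Lemma integrableRD D f g : measurable D -> mu.-integrable D (EFin \o f) ->
  mu.-integrable D (EFin \o g) ->
  mu.-integrable D (EFin \o (fun x => f x + g x)).
Proof. by move=> mD fi gi; have := integrableD mD fi gi; exact: eq_integrable. Qed.

Lemma integrableRZ D (c : R) f : measurable D -> mu.-integrable D (EFin \o f) ->
  mu.-integrable D (EFin \o (fun x => c * f x)).
Proof. by move=> mD fi; have := integrableZl mD c fi; exact: eq_integrable. Qed.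

Lemma le_norm_1sqr (t : R) : `|t| <= 1 + t ^+ 2.
Proof.
by have := sqr_ge0 (`|t| - 1); rewrite -[t ^+ 2]real_normK ?num_real//; nra.
Qed.

(** On a set of finite measure the inequality [|t| <= 1 + t^2] replaces Cauchy-Schwarz. *)
Lemma integrable_of_sqr D f (m B : R) : measurable D -> measurable_fun D f ->
  mu D = m%:E -> (\int[mu]_(x in D) (f x ^+ 2)%:E <= B%:E)%E ->
  mu.-integrable D (EFin \o f) /\ `|\int[mu]_(x in D) f x| <= m + B.
Proof.
move=> mD mf Dm fB.
have i2 : mu.-integrable D (EFin \o (fun x => f x ^+ 2)).
  apply: integrable_ge0_lty => //.
  - exact: measurable_funX.
  - by move=> x _; exact: sqr_ge0.
  - exact: le_lt_trans fB (ltry _).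
have i0 : mu.-integrable D (EFin \o cst 1).
  by apply: integrable_cst_lty; rewrite ?Dm ?ltry.
have i12 := integrableRD mD i0 i2.
have i1 : mu.-integrable D (EFin \o f).
  by apply: le_integrableR i12 => // x _; exact: le_norm_1sqr.
split=> //; apply: le_trans (le_normr_Rintegral mD i1) _.
apply: (@le_trans _ _ (\int[mu]_(x in D) (cst 1 x + f x ^+ 2))).
  apply: le_Rintegral => // [|x _]; last exact: le_norm_1sqr.
  by have := integrable_abse i1; apply: eq_integrable.
rewrite RintegralD//; apply: lerD.
  by rewrite Rintegral_cst// Dm mul1r.
by rewrite -lee_fin -Rintegral_EFin.
Qed.

Lemma integral_sqrB_le (k f g : T -> R) : measurable_fun setT k ->
  measurable_fun setT f -> measurable_fun setT g -> (forall x, 0 <= k x) ->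
  (\int[mu]_x ((f x - g x) ^+ 2 * k x)%:E <=
   2%:E * (\int[mu]_x (f x ^+ 2 * k x)%:E + \int[mu]_x (g x ^+ 2 * k x)%:E))%E.
Proof.
move=> mk mf mg k0.
have mfk : measurable_fun setT (fun x => (f x ^+ 2 * k x)%:E).
  by apply/measurable_EFinP; apply: measurable_funM => //; exact: measurable_funX.
have mgk : measurable_fun setT (fun x => (g x ^+ 2 * k x)%:E).
  by apply/measurable_EFinP; apply: measurable_funM => //; exact: measurable_funX.
have p0 h x : (0 <= (h x ^+ 2 * k x)%:E)%E.
  by rewrite lee_fin mulr_ge0 ?sqr_ge0.
rewrite -ge0_integralD// -ge0_integralZl_EFin//;
  [|by move=> x _; rewrite adde_ge0|exact: emeasurable_funD].
apply: ge0_le_integral => //.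
- by move=> x _; exact: (p0 (fun x => f x - g x)).
- apply/measurable_EFinP; apply: measurable_funM => //; apply: measurable_funX.
  exact: measurable_funB.
- by apply: measurable_funeM; exact: emeasurable_funD.
- move=> x _; rewrite -EFinD -EFinM lee_fin -mulrDl mulrA ler_wpM2r//.
  by have := sqr_ge0 (f x + g x); rewrite sqrrD sqrrB; lra.
Qed.

End integrability_tools.

Lemma dist3_cube {R : realType} (a x y : pt3 R) (h : R) : 0 < h ->
  cube a h x -> cube a h y -> dist3 x y <= 2 * h.
Proof.
move=> h0 /cubeE[/andP[? ?] /andP[? ?] /andP[? ?]].
move=> /cubeE[/andP[? ?] /andP[? ?] /andP[? ?]].
apply: dist3_le; first exact: ltW.
- by rewrite ler_norml; apply/andP; split; lra.
- by rewrite ler_norml; apply/andP; split; lra.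
- by rewrite ler_norml; apply/andP; split; lra.
Qed.

(** * A Poincare inequality on cubes *)

Section poincare.
Context {R : realType} (s : R).
Hypothesis (s0 : 0 < s).
Implicit Types (w : pt3 R -> R).
Local Notation mu3 := (@leb3 R).

(** Over pairs of points of [Q] the integral of [(w x - w y)^2] equals [2 h^3 S - 2 m^2], with [S]
    and [m] the integrals of [w^2] and [w]. The kernel integral bounds it, since two points of [Q]
    are at distance at most [2h]. The inner integral runs over the whole space, so that summing over
    disjoint cubes costs no more than one full seminorm. *)
Lemma cube_poincare w (a : pt3 R) (h : R) : s < 1 -> 0 < h ->
  measurable_fun setT w -> (L2sq w < +oo)%E ->
  (\int[mu3]_(x in cube a h) (w x ^+ 2)%:E <=
   (16 * h `^ (2 * s))%:E * \int[mu3]_(x in cube a h) \int[mu3]_y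
     ((w x - w y) ^+ 2 * kern s (x, y))%:E
   + ((\int[mu3]_(x in cube a h) w x) ^+ 2 / h ^+ 3)%:E)%E.
Proof.
move=> s1 h0 mw wfin; set Q := cube a h.
have mQ : measurable Q by exact: measurable_cube.
have QE : mu3 Q = (h ^+ 3)%:E by rewrite leb3_cube// ltW.
have h30 : 0 < h ^+ 3 by rewrite exprn_gt0.
have mwQ : measurable_fun Q w by exact: measurable_funTS.
have i2 : mu3.-integrable Q (EFin \o (fun x => w x ^+ 2)).
  apply: integrable_ge0_lty => //; first exact: measurable_funX.
    by move=> x _; exact: sqr_ge0.
  apply: le_lt_trans wfin; apply: ge0_subset_integral => //.
    by apply/measurable_EFinP; exact: measurable_funX.
  by move=> x _; rewrite lee_fin sqr_ge0.
have i0 (c : R) : mu3.-integrable Q (EFin \o cst c).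
  by apply: integrable_cst_lty => //; rewrite -[X in (X < _)%E]/(mu3 Q) QE ltry.
have i1 : mu3.-integrable Q (EFin \o w).
  apply: (@le_integrableR _ _ _ mu3 Q w (fun x => 1 + w x ^+ 2)) => //.
    by move=> x _; exact: le_norm_1sqr.
  exact: integrableRD (i0 1) i2.
set S := \int[mu3]_(x in Q) (w x ^+ 2); set m := \int[mu3]_(x in Q) w x.
have RQ (c : R) : \int[mu3]_(x in Q) c = c * h ^+ 3.
  by rewrite /Rintegral (integral_cst mu3 mQ) -[X in (_ * X)%E]/(mu3 Q) QE.
have inner x : (\int[mu3]_(y in Q) ((w x - w y) ^+ 2)%:E)%E =
    (h ^+ 3 * w x ^+ 2 + (- 2 * m) * w x + S)%:E.
  have iA : mu3.-integrable Q (EFin \o (fun y => w x ^+ 2 + (- 2 * w x) * w y)).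
    apply: integrableRD => //; first exact: (i0 (w x ^+ 2)).
    exact: integrableRZ.
  have iB : mu3.-integrable Q (EFin \o (fun y => (w x - w y) ^+ 2)).
    have iC := @integrableRD _ _ _ mu3 Q _ _ mQ iA i2.
    by apply: (@eq_integrableR _ _ _ mu3 Q _ _ mQ _ iC) => y _; ring.
  rewrite Rintegral_EFin//; congr (_%:E).
  rewrite (@eq_Rintegral _ _ _ mu3 Q
    (fun y => (w x ^+ 2 + (- 2 * w x) * w y) + w y ^+ 2)); last first.
    by move=> y _; ring.
  rewrite RintegralD// RintegralD//; last 2 first.
  - exact: (i0 (w x ^+ 2)).
  - exact: integrableRZ.
  have Z : \int[mu3]_(y in Q) (- 2 * w x * w y) = - 2 * w x * m.
    by rewrite RintegralZl.
  rewrite -[LHS]/(\int[mu3]_(_ in Q) (w x ^+ 2) +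
    \int[mu3]_(y in Q) (- 2 * w x * w y) + S) Z RQ.
  by ring.
pose P x := h ^+ 3 * w x ^+ 2 + (- 2 * m) * w x + S.
have iA : mu3.-integrable Q
    (EFin \o (fun x => h ^+ 3 * w x ^+ 2 + (- 2 * m) * w x)).
  by apply: integrableRD => //; exact: integrableRZ.
have iB : mu3.-integrable Q (EFin \o P).
  exact: integrableRD iA (i0 S).
have PE : (\int[mu3]_(x in Q) (P x)%:E)%E = (2 * h ^+ 3 * S - 2 * m ^+ 2)%:E.
  rewrite Rintegral_EFin//; congr (_%:E); rewrite /P.
  have Z1 : \int[mu3]_(y in Q) (h ^+ 3 * w y ^+ 2) = h ^+ 3 * S.
    by rewrite RintegralZl.
  have Z2 : \int[mu3]_(y in Q) (- 2 * m * w y) = - 2 * m * m.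
    by rewrite RintegralZl.
  transitivity (\int[mu3]_(y in Q) (h ^+ 3 * w y ^+ 2 + - 2 * m * w y) +
    \int[mu3]_(_ in Q) S).
    exact: (@RintegralD _ _ _ mu3 Q _ (cst S) mQ iA (i0 S)).
  transitivity (\int[mu3]_(y in Q) (h ^+ 3 * w y ^+ 2) +
    \int[mu3]_(y in Q) (- 2 * m * w y) + \int[mu3]_(_ in Q) S).
    congr (_ + _); apply: (@RintegralD _ _ _ mu3 Q _ _ mQ); exact: integrableRZ.
  rewrite Z1 Z2 RQ.
  by ring.
have mF : measurable_fun setT (fun z : pt3 R * pt3 R =>
    ((w z.1 - w z.2) ^+ 2 * kern s z)%:E).
  by apply/measurable_EFinP; exact: measurable_gagliardo.
have F0 z : (0 <= ((w z.1 - w z.2) ^+ 2 * kern s z)%:E)%E.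
  by rewrite lee_fin mulr_ge0 ?sqr_ge0 ?kern_ge0.
pose c := (2 * h) `^ (3 + 2 * s); have c0 : 0 <= c by exact: powR_ge0.
have Pc x : Q x -> ((P x)%:E <=
   c%:E * \int[mu3]_y ((w x - w y) ^+ 2 * kern s (x, y))%:E)%E.
  move=> Qx; rewrite -inner; have mFx : measurable_fun setT
      (fun y => ((w x - w y) ^+ 2 * kern s (x, y))%:E).
    exact: (measurable_fun_pair2 x mF).
  apply: (@le_trans _ _ (\int[mu3]_(y in Q)
      (c%:E * ((w x - w y) ^+ 2 * kern s (x, y))%:E))%E).
    apply: ge0_le_integral => //.
    - by move=> y _; rewrite lee_fin sqr_ge0.
    - apply: measurable_funTS; apply/measurable_EFinP; apply: measurable_funX.
      exact: measurable_funB.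
    - by apply: measurable_funTS; apply: measurable_funeM.
    - move=> y Qy; rewrite -EFinM lee_fin; apply: sqr_le_kern => //.
      exact: dist3_cube Qx Qy.
  rewrite ge0_integralZl_EFin//; last 2 first.
  - by move=> y _; exact: (F0 (x, y)).
  - exact: measurable_funTS.
  apply: lee_wpmul2l; first by rewrite lee_fin.
  by apply: ge0_subset_integral => // y _; exact: (F0 (x, y)).
have mI : measurable_fun setT
    (fun x => \int[mu3]_y ((w x - w y) ^+ 2 * kern s (x, y))%:E)%E.
  exact: (@measurable_fun_fubini_tonelli_F _ _ _ _ R mu3 _ mF F0).
have I0 x : (0 <= \int[mu3]_y ((w x - w y) ^+ 2 * kern s (x, y))%:E)%E.
  by apply: integral_ge0 => y _; exact: (F0 (x, y)).
have : (\int[mu3]_(x in Q) (P x)%:E <= c%:E * \int[mu3]_(x in Q) \int[mu3]_y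
     ((w x - w y) ^+ 2 * kern s (x, y))%:E)%E.
  rewrite -ge0_integralZl_EFin//; last exact: measurable_funTS.
  apply: ge0_le_integral => //.
  - move=> x _; rewrite -inner; apply: integral_ge0 => y _.
    by rewrite lee_fin sqr_ge0.
  - exact: (measurable_int mu3).
  - by apply: measurable_funTS; exact: measurable_funeM.
rewrite PE Rintegral_EFin// -/S.
have J0 : (0 <= \int[mu3]_(x in Q) \int[mu3]_y
     ((w x - w y) ^+ 2 * kern s (x, y))%:E)%E by apply: integral_ge0.
case: (\int[mu3]_(x in Q) \int[mu3]_y _)%E J0 => [J| |]//; last first.
  move=> _ _; rewrite gt0_muley ?lte_fin ?mulr_gt0 ?powR_gt0// addye//.
  exact: leey.
rewrite -!EFinM -EFinD !lee_fin => J0 SJ.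
(* [2^(3 + 2s) <= 32] for [s < 1], hence the constant [16 = 32 / 2]. *)
have cE : c <= 2 * h ^+ 3 * (16 * h `^ (2 * s)).
  rewrite /c powRM ?(ltW h0)//.
  rewrite [h `^ _]powRD; last by apply/implyP => _; rewrite gt_eqF.
  rewrite (_ : h `^ 3 = h ^+ 3); last by rewrite -powR_mulrn ?(ltW h0).
  rewrite (_ : 2 * h ^+ 3 * _ = 32 * (h ^+ 3 * h `^ (2 * s))); last by ring.
  apply: ler_wpM2r; first by rewrite mulr_ge0 ?powR_ge0 ?ltW.
  rewrite (_ : 32 = 2 `^ 5%:R :> R); last by rewrite powR_mulrn//; ring.
  by rewrite ler_powR//; move: s1; lra.
rewrite -(ler_pM2l (_ : 0 < 2 * h ^+ 3)); last by rewrite mulr_gt0.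
rewrite mulrDr (_ : 2 * h ^+ 3 * (m ^+ 2 / h ^+ 3) = 2 * m ^+ 2); last first.
  by field; rewrite gt_eqF.
by rewrite -lerBlDr (le_trans SJ)// mulrA ler_wpM2r.
Qed.

End poincare.

(** * Dyadic grids on growing boxes *)

Section grid.
Context {R : realType}.
Local Notation mu3 := (@leb3 R).

Definition mesh (j : nat) : R := 2^-1 ^+ j.

Lemma mesh_gt0 j : 0 < mesh j.
Proof. by rewrite exprn_gt0// invr_gt0. Qed.

Lemma meshV j : 2 ^+ j * mesh j = 1.
Proof. by rewrite -exprMn mulfV// expr1n. Qed.

(** An edge of length [2 * 2^j] cut into steps of length [2^-j] has [2 * 4^j] pieces: the mesh
    shrinks while the box grows to the whole space. *)
Definition gindex (j : nat) : finType :=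
  ('I_(2 * 4 ^ j) * 'I_(2 * 4 ^ j) * 'I_(2 * 4 ^ j))%type.

Definition gcube (j : nat) (t : gindex j) : set (pt3 R) :=
  cube (- 2 ^+ j + t.1.1%:R * mesh j, - 2 ^+ j + t.1.2%:R * mesh j,
        - 2 ^+ j + t.2%:R * mesh j) (mesh j).

Lemma measurable_gcube j (t : gindex j) : measurable (gcube t).
Proof. exact: measurable_cube. Qed.

Lemma trivIset_gcube j : trivIset setT (@gcube j).
Proof.
apply/trivIsetP => -[[i1 i2] i3] [[k1 k2] k3] _ _; apply: contraNP.
move=> /eqP/set0P[x [/cubeE[/= a1 a2 a3] /cubeE[/= b1 b2 b3]]].
have h0 := mesh_gt0 j.
have lei (i k : nat) (y : R) : - 2 ^+ j + i%:R * mesh j <= y ->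
    y < - 2 ^+ j + k%:R * mesh j + mesh j -> (i <= k)%N.
  move=> iy yk; rewrite -ltnS -(ltr_nat R) -(ltr_pM2r h0) -natr1 [ltRHS]mulrDl mul1r.
  by lra.
have same (n : nat) (i k : 'I_n) (y : R) :
    - 2 ^+ j + i%:R * mesh j <= y < - 2 ^+ j + i%:R * mesh j + mesh j ->
    - 2 ^+ j + k%:R * mesh j <= y < - 2 ^+ j + k%:R * mesh j + mesh j -> i = k.
  move=> /andP[i1' i2'] /andP[k1' k2']; apply/val_inj/eqP => /=.
  by rewrite eqn_leq (lei _ _ _ i1' k2') (lei _ _ _ k1' i2').
by rewrite (same _ _ _ _ a1 b1) (same _ _ _ _ a2 b2) (same _ _ _ _ a3 b3).
Qed.

Definition gbox (j : nat) : set (pt3 R) :=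
  [set x | [/\ `|c1 x| < 2 ^+ j, `|c2 x| < 2 ^+ j & `|c3 x| < 2 ^+ j]].

Lemma gbox_cover j x : gbox j x -> exists t : gindex j, gcube t x.
Proof.
have h0 := mesh_gt0 j; have k0 : 0 < 2 ^+ j :> R by rewrite exprn_gt0.
have ex (y : R) : `|y| < 2 ^+ j -> exists i : 'I_(2 * 4 ^ j),
    - 2 ^+ j + i%:R * mesh j <= y < - 2 ^+ j + i%:R * mesh j + mesh j.
  rewrite ltr_norml => /andP[y1 y2]; pose z := (y + 2 ^+ j) * 2 ^+ j.
  have z0 : 0 <= z by rewrite /z mulr_ge0 ?ltW//; lra.
  have zn : z < (2 * 4 ^ j)%N%:R.
    rewrite natrM natrX (_ : 4%:R = 2 * 2 :> R); last by ring.
    by rewrite exprMn mulrA /z ltr_pM2r//; lra.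
  have it : (Num.truncn z < 2 * 4 ^ j)%N by rewrite truncn_lt_nat.
  exists (Ordinal it) => /=; have /andP[t1 t2] := truncn_itv z0.
  have yz : y = - 2 ^+ j + z * mesh j by rewrite /z -mulrA meshV mulr1; ring.
  rewrite {1 2}yz lerD2l -addrA ltrD2l -[X in _ + X]mul1r -mulrDl natr1.
  by rewrite ler_pM2r// ltr_pM2r// t1 t2.
move=> [/ex[i1 h1] /ex[i2 h2] /ex[i3 h3]]; exists (i1, i2, i3).
by apply/cubeE.
Qed.

Lemma measurable_gbox j : measurable (gbox j).
Proof.
rewrite (_ : gbox j = (`]- 2 ^+ j, 2 ^+ j[%classic `*` `]- 2 ^+ j, 2 ^+ j[%classic)
    `*` `]- 2 ^+ j, 2 ^+ j[%classic).
  by apply: measurableX => //; apply: measurableX.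
apply/seteqP; split => x; rewrite /gbox/= !in_itv/= !ltr_norml; first by move=> [].
by move=> [[]].
Qed.

(* If the averages of [w] over the cubes of side [2^-j] are tiny then the
   Poincare inequality bounds [w] on a large box by its seminorm only. *)
Lemma grid_estimate (s : R) (w : pt3 R -> R) (G : R) j : 1 / 2 <= s -> s < 1 ->
  measurable_fun setT w -> (L2sq w < +oo)%E -> (gagliardo s w <= G%:E)%E ->
  (forall t : gindex j, `|\int[mu3]_(x in gcube t) w x| <= 32^-1 ^+ j) ->
  (\int[mu3]_(x in gbox j) (w x ^+ 2)%:E <= ((16 * G + 8) * mesh j)%:E)%E.
Proof.
move=> s12 s1 mw wfin wG wavg; have s0 : 0 < s by lra.
have h0 := mesh_gt0 j.
have w20 x : (0 <= (w x ^+ 2)%:E)%E by rewrite lee_fin sqr_ge0.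
have mw2 : measurable_fun setT (fun x => (w x ^+ 2)%:E).
  by apply/measurable_EFinP; exact: measurable_funX.
pose I x := (\int[mu3]_y ((w x - w y) ^+ 2 * kern s (x, y))%:E)%E.
have mI : measurable_fun setT I.
  apply: (@measurable_fun_fubini_tonelli_F _ _ _ _ R mu3
    (fun z => ((w z.1 - w z.2) ^+ 2 * kern s z)%:E)).
    by apply/measurable_EFinP; exact: measurable_gagliardo.
  by move=> z; rewrite lee_fin mulr_ge0 ?sqr_ge0 ?kern_ge0.
have I0 x : (0 <= I x)%E.
  by apply: integral_ge0 => y _; rewrite lee_fin mulr_ge0 ?sqr_ge0 ?kern_ge0.
pose r := enum (gindex j).
have trivr : trivIset [set` r] (@gcube j) by exact: sub_trivIset (@trivIset_gcube j).
have mU : measurable (\big[setU/set0]_(t <- r) @gcube j t).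
  by apply: bigsetU_measurable => t _; exact: measurable_gcube.
apply: (@le_trans _ _ (\int[mu3]_(x in \big[setU/set0]_(t <- r) gcube t) (w x ^+ 2)%:E)%E).
  apply: ge0_subset_integral => //.
  - exact: measurable_gbox.
  - exact: measurable_funTS.
  - move=> x /gbox_cover[t tx]; rewrite -bigcup_seq; exists t => //=.
    by rewrite mem_enum.
rewrite ge0_integral_bigsetU//; last 3 first.
- by move=> t; exact: measurable_gcube.
- exact: enum_uniq.
- exact: measurable_funTS.
apply: (@le_trans _ _ (\sum_(t <- r) ((16 * mesh j)%:E *
    \int[mu3]_(x in gcube t) I x + (32^-1 ^+ j ^+ 2 / mesh j ^+ 3)%:E))%E).
  apply: lee_sum => t _; apply: le_trans (cube_poincare s0 _ s1 h0 mw wfin) _.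
  apply: leeD.
    apply: (@lee_wpmul2r _ (\int[mu3]_(x in gcube t) I x)%E).
      exact: integral_ge0.
    (* With [h <= 1] and [2s >= 1], [h^(2s) <= h]; the linear gain in the mesh is enough. *)
    rewrite lee_fin ler_pM2l//.
    rewrite -[leRHS]powRr1 ?(ltW h0)// ger_powR//; last lra.
    by rewrite h0 exprn_ile1//; lra.
  rewrite lee_fin ler_pM2r ?invr_gt0 ?exprn_gt0//.
  rewrite -[leLHS]ger0_norm ?sqr_ge0// normrX lerXn2r ?nnegrE ?exprn_ge0//.
  exact: (wavg t).
rewrite [X in (_ <= X%:E)%E]mulrDl EFinD.
have -> : (\sum_(t <- r) ((16 * mesh j)%:E *
      \int[mu3]_(x in gcube t) I x + (32^-1 ^+ j ^+ 2 / mesh j ^+ 3)%:E) =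
    \sum_(t <- r) (16 * mesh j)%:E * \int[mu3]_(x in gcube t) I x +
    \sum_(t <- r) (32^-1 ^+ j ^+ 2 / mesh j ^+ 3)%:E)%E by rewrite big_split.
apply: leeD.
  rewrite -ge0_sume_distrr; last by move=> t _; exact: integral_ge0.
  rewrite -ge0_integral_bigsetU//; last 3 first.
  - by move=> t; exact: measurable_gcube.
  - exact: enum_uniq.
  - exact: measurable_funTS.
  rewrite (_ : 16 * G * mesh j = 16 * mesh j * G); last by ring.
  rewrite [X in (_ <= X)%E]EFinM; apply: lee_wpmul2l.
    by rewrite lee_fin mulr_ge0 ?ltW.
  apply: le_trans wG; rewrite gagliardo_fubini//.
  exact: ge0_subset_integral.
(* There are [8 * 64^j] cubes, and each contributes [32^(-2j) * 8^j = 2^(-7j)]; the total is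
   [8 * 2^-j]. The base [32] is chosen for this. *)
rewrite sumEFin lee_fin big_const_seq iter_addr_0 count_predT -cardE.
rewrite !card_prod !card_ord.
rewrite -[_ *+ (_ * _ * _)]mulr_natl !natrM !natrX /mesh le_eqVlt; apply/orP; left; apply/eqP.
have -> : 32^-1 ^+ j ^+ 2 = (2^-1 ^+ j) ^+ 10 :> R.
  by rewrite -!exprM [in LHS]mulnC [in RHS]mulnC !exprM; congr (_ ^+ j); field.
have -> : 4 ^+ j = (2^-1 ^+ j) ^- 2 :> R.
  by rewrite -exprM exprVn invrK mulnC exprM; congr (_ ^+ j); ring.
by field; rewrite expf_neq0.
Qed.

End grid.

(** From [2 a t <= t^2 + a^2], divided by [a]; this replaces a square root of [a b]. *)
Lemma le_of_sqr_le {R : realType} (t a b L : R) : 0 <= t -> 0 < a -> a <= b ->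
  0 <= L -> t ^+ 2 <= L * (a * b) -> t <= (1 + L) * b.
Proof.
move=> t0 a0 ab L0 tL; have b0 : 0 < b by exact: lt_le_trans ab.
have Lb : 0 <= L * b by rewrite mulr_ge0// ltW.
have ta : a * (2 * t) <= a * (a + L * b).
  have := sqr_ge0 (t - a); move: tL; rewrite sqrrB mulrDr.
  have -> : L * (a * b) = a * (L * b) by ring.
  by rewrite -expr2 (_ : a * (2 * t) = t * a *+ 2); [lra|ring].
by move: ta; rewrite ler_pM2l// mulrDl mul1r; lra.
Qed.

(** * Almost everywhere compactness of bounded sequences *)

Section rellich.
Context {R : realType}.
Local Notation mu3 := (@leb3 R).

(** One ultrafilter makes all bounded sequences converge at the same time, so the averages over all
    cubes of all grids need no diagonal extraction. *)
Lemma bounded_ultra_cvg (U : set_system nat) (v : nat -> R) (M : R) :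
  UltraFilter U -> (forall n, `|v n| <= M) ->
  exists l, forall e, 0 < e -> U [set n | `|v n - l| < e].
Proof.
move=> UU vM; pose F := fmap v U.
have FU : UltraFilter F.
  split=> [|G GP FG]; first exact: fmap_proper_filter.
  apply/seteqP; split => // A GA; have [//|] := @in_ultra_setVsetC _ U (v @^-1` A) UU.
  move=> UAC; have : G (~` A) by apply: FG.
  move=> GAC; have : G (A `&` ~` A) by apply: filterI.
  by rewrite setICr => /filter_ex[].
have := @segment_compact R (- M) M; rewrite compact_ultra => /(_ F FU).
have FM : F `[- M, M]%classic.
  apply: (@filterS _ U _ setT); last exact: filterT.
  by move=> n _ /=; rewrite in_itv/= -ler_norml.
move=> /(_ FM)[l [_ Fl]]; exists l => e e0; have := Fl (ball l e).
move=> /(_ (nbhsx_ballx _ _ e0)) => Ul.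
have {}Ul : U (v @^-1` ball l e) := Ul.
by apply: (@filterS _ U _ _ _ _ Ul) => n; rewrite /= -ball_normE/= distrC.
Qed.

(** Weighting the squared increments by [(3/2)^j] still leaves integrals of order [(3/4)^j], so the
    weighted sum is finite almost everywhere. At such a point the increments are eventually at most
    a constant times [(5/6)^j], hence summable. *)
Lemma ae_geometric_cvg (v : nat -> pt3 R -> R) (C : R) :
  (forall j, measurable_fun setT (v j)) ->
  (forall j, (\int[mu3]_(x in gbox j) ((v j.+1 x - v j x) ^+ 2)%:E <=
              (C * mesh j)%:E)%E) ->
  {ae mu3, forall x, cvgn (fun j => v j x)}.
Proof.
move=> mv vC; have C0 : 0 <= C.
  rewrite -(ler_pM2r (@mesh_gt0 R 0)) mul0r -lee_fin; apply: le_trans (vC 0%N).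
  by apply: integral_ge0 => x _; rewrite lee_fin sqr_ge0.
pose S j x := ((3 / 2) ^+ j * (\1_(gbox j) x * (v j.+1 x - v j x) ^+ 2))%:E : \bar R.
have mgb j : measurable_fun setT (\1_(gbox j) : pt3 R -> R).
  by apply: measurable_indic; exact: measurable_gbox.
have md j : measurable_fun setT (fun x => (v j.+1 x - v j x) ^+ 2).
  by apply: measurable_funX; apply: measurable_funB.
have mS j : measurable_fun setT (S j).
  apply/measurable_EFinP; apply: measurable_funM => //; apply: measurable_funM => //.
have S0 j x : (0 <= S j x)%E.
  rewrite lee_fin mulr_ge0 ?(mulr_ge0 _ (sqr_ge0 _))// ?indicE ?ler0n//.
have iS j : (\int[mu3]_x S j x <= (C * (3 / 4) ^+ j)%:E)%E.
  have -> : (\int[mu3]_x S j x = ((3 / 2) ^+ j)%:E *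
      \int[mu3]_(x in gbox j) ((v j.+1 x - v j x) ^+ 2)%:E)%E.
    rewrite [in RHS]integral_indicM.
    rewrite -ge0_integralZl_EFin//.
    - by move=> x _; rewrite lee_fin mulr_ge0 ?sqr_ge0.
    - apply/measurable_EFinP; apply: measurable_funM; first exact: mgb.
      exact: md.
  apply: (@le_trans _ _ (((3 / 2) ^+ j)%:E * (C * mesh j)%:E)%E).
    by apply: lee_wpmul2l; rewrite ?lee_fin ?exprn_ge0.
  rewrite -EFinM lee_fin /mesh mulrCA -exprMn ler_wpM2l// le_eqVlt.
  by apply/orP; left; apply/eqP; congr (_ ^+ j); field.
have Sfin : (\int[mu3]_x \sum_(0 <= j <oo) S j x < +oo)%E.
  rewrite integral_nneseries//; apply: (@le_lt_trans _ _
      (\sum_(0 <= j <oo) (C * (3 / 4) ^+ j)%:E)%E).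
    by apply: lee_nneseries => [j *|j *]; [exact: integral_ge0|exact: iS].
  rewrite nneseries_geometric; [|lra|lra].
  exact: ltry.
have mSS : measurable_fun setT (fun x => \sum_(0 <= j <oo) S j x)%E.
  by apply: ge0_emeasurable_sum => // j _; exact: mS.
have intS : mu3.-integrable setT (fun x => \sum_(0 <= j <oo) S j x)%E.
  apply/integrableP; split=> //; apply: le_lt_trans Sfin.
  apply: ge0_le_integral => //.
  - exact: measurableT_comp.
  - by move=> x _; rewrite gee0_abs// nneseries_ge0.
have := integrable_ae measurableT intS.
apply: filterS => x0 /(_ I); pose x : pt3 R := x0; rewrite -/x => fx.
have [L L0 LE] : exists2 L, 0 <= L & (\sum_(0 <= j <oo) S j x)%E = L%:E.
  apply: ge0_lty_EFin; first exact: nneseries_ge0.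
  by rewrite ltey_eq fx.
have SL j : (S j x <= L%:E)%E.
  by rewrite -LE (@nneseriesD1 _ _ j)// leeDl// nneseries_ge0.
(* The boxes exhaust the space: from [j0] on, the indicator at [x] is [1]. *)
have [j0 hj0] : exists j0, forall j, (j0 <= j)%N -> gbox j x.
  have [n xn] : exists n : nat, `|c1 x| + `|c2 x| + `|c3 x| < n%:R.
    by exists (Num.truncn (`|c1 x| + `|c2 x| + `|c3 x|)).+1; exact: truncnS_gt.
  exists n => j nj; have nj2 : n%:R <= 2 ^+ j :> R.
    by rewrite -natrX ler_nat (leq_trans nj)// ltnW// ltn_expl.
  by rewrite /gbox/=; split; apply: lt_le_trans nj2; apply: le_lt_trans xn;
    have := normr_ge0 (c1 x); have := normr_ge0 (c2 x); have := normr_ge0 (c3 x); lra.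
pose dd j := v (j + j0).+1 x - v (j + j0)%N x.
have ddb j : `|dd j| <= (1 + L) * (5 / 6) ^+ j.
  have Sj := SL (j + j0)%N; move: Sj; rewrite /S lee_fin indicE mem_set; last first.
    by apply: hj0; exact: leq_addl.
  rewrite mul1r -/(dd j) => Sj.
  have h32 : (3 / 2) ^+ j <= (3 / 2) ^+ (j + j0) :> R.
    by apply: ler_weXn2l; [lra|exact: leq_addr].
  have {}Sj : (3 / 2) ^+ j * dd j ^+ 2 <= L.
    by apply: le_trans Sj; rewrite ler_wpM2r ?sqr_ge0.
  have e1 : (3 / 2) ^+ j * (2 / 3) ^+ j = 1 :> R.
    by rewrite -exprMn (_ : _ * _ = 1 :> R) ?expr1n//; field.
  (* [2/3 = 4/5 * 5/6] with [4/5 <= 5/6], so [le_of_sqr_le] extracts the rate [5/6] without a square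
     root of [2/3]. *)
  have e2 : (2 / 3) ^+ j = (4 / 5) ^+ j * (5 / 6) ^+ j :> R.
    by rewrite -exprMn; congr (_ ^+ j); field.
  have e3 : (4 / 5) ^+ j <= (5 / 6) ^+ j :> R.
    by apply: lerXn2r; rewrite ?nnegrE; lra.
  have p45 : 0 < (4 / 5) ^+ j :> R by rewrite exprn_gt0//; lra.
  have p56 : 0 < (5 / 6) ^+ j :> R by rewrite exprn_gt0//; lra.
  have d2 : dd j ^+ 2 <= L * ((4 / 5) ^+ j * (5 / 6) ^+ j).
    rewrite -e2 (_ : dd j ^+ 2 = (3 / 2) ^+ j * dd j ^+ 2 * (2 / 3) ^+ j).
      by rewrite ler_wpM2r// exprn_ge0.
    by rewrite mulrAC e1 mul1r.
  rewrite -(real_normK (num_real (dd j))) in d2.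
  exact: le_of_sqr_le d2.
have cdd : cvgn (series dd).
  apply: normed_cvg; apply: (@series_le_cvg _ _ (fun j => (1 + L) * (5 / 6) ^+ j)) => //.
  - by move=> j; exact: normr_ge0.
  - by move=> j; apply: mulr_ge0; rewrite ?exprn_ge0//; lra.
  - by apply: is_cvg_geometric_series; rewrite ger0_norm; lra.
have : cvgn (fun j => v (j + j0)%N x).
  have -> : (fun j => v (j + j0)%N x) = (fun j => series dd j + v j0 x).
    apply/funext => j; rewrite /series/= /dd.
    rewrite (@telescope_sumr _ 0 j (fun k => v (k + j0)%N x))//.
    by rewrite add0n subrK.
  by apply: is_cvgD => //; exact: is_cvg_cst.
by move=> /cvg_ex[l hl]; apply/cvg_ex; exists l; rewrite -(cvg_shiftn j0).
Qed.

Lemma rellich (s B : R) (u : nat -> pt3 R -> R) : 1 / 2 <= s -> s < 1 ->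
  (forall n, measurable_fun setT (u n)) ->
  (forall n, (gagliardo s (u n) <= B%:E)%E) -> (forall n, (L2sq (u n) <= B%:E)%E) ->
  exists (phi : nat -> nat) (v : pt3 R -> R), [/\ forall k, (k <= phi k)%N,
    measurable_fun setT v &
    {ae mu3, forall x, u (phi k) x @[k --> \oo] --> v x}].
Proof.
move=> s12 s1 mu gu lu.
have B0 : 0 <= B.
  rewrite -lee_fin; apply: le_trans (lu 0%N).
  by apply: integral_ge0 => x _; rewrite lee_fin sqr_ge0.
have [U [UU oU]] := @ultraFilterLemma nat \oo _.
have mq2 n : measurable_fun setT (fun x => (u n x ^+ 2)%:E).
  by apply/measurable_EFinP; exact: measurable_funX.
have iu n j (t : gindex j) : mu3.-integrable (gcube t) (EFin \o u n) /\
    `|\int[mu3]_(x in gcube t) u n x| <= @mesh R j ^+ 3 + B.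
  apply: integrable_of_sqr.
  - exact: measurable_gcube.
  - exact: (measurable_funTS (mu n)).
  - exact: (leb3_cube _ (ltW (mesh_gt0 j))).
  - apply: le_trans (lu n); apply: ge0_subset_integral => //.
    + exact: measurable_gcube.
    + exact: (mq2 n).
    + by move=> x _; rewrite lee_fin sqr_ge0.
pose avg j (t : gindex j) n := \int[mu3]_(x in gcube t) u n x.
have lim_avg j (t : gindex j) : {l : R | forall e, 0 < e ->
    U [set n | `|avg j t n - l| < e]}.
  by apply/cid/(@bounded_ultra_cvg U _ (@mesh R j ^+ 3 + B)) => // n; exact: (iu n j t).2.
(* The margin is half of [32^-j], so that the averages of two members of [good j] differ by no more
   than [grid_estimate] allows. *)
pose good j := [set n : nat | forall t : gindex j,
  `|avg j t n - sval (lim_avg j t)| < 32^-1 ^+ j / 2].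
have Ugood j : U (good j).
  apply: filter_forall => t; apply: (svalP (lim_avg j t)).
  by rewrite divr_gt0// exprn_gt0// invr_gt0.
(* Consecutive terms must be comparable on one grid: [phi j] lies in [good j], and so does
   [phi (j + 1)], through the predecessor. *)
have /choice[phi hphi] : forall k, exists n, [/\ (k <= n)%N, good k n & good k.-1 n].
  move=> k; have : U (good k `&` good k.-1 `&` [set n | (k <= n)%N]).
    by apply: filterI; [exact: filterI|apply: oU; exact: nbhs_infty_ge].
  by move=> /filter_ex[n [[g1 g2] kn]]; exists n.
pose v k := u (phi k).
have vC j : (\int[mu3]_(x in @gbox R j) ((v j.+1 x - v j x) ^+ 2)%:E <=
    ((16 * (4 * B) + 8) * @mesh R j)%:E)%E.
  apply: (@grid_estimate _ s) => //.
  - exact: (measurable_funB (mu _) (mu _)).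
  - apply: le_lt_trans (ltry (2 * (B + B))).
    have m1 : measurable_fun setT (cst 1 : pt3 R -> R) by exact: measurable_cst.
    have := integral_sqrB_le mu3 m1 (mu (phi j.+1)) (mu (phi j)) (fun=> ler01).
    have E h : (\int[mu3]_x (h x ^+ 2 * cst 1 x)%:E)%E = L2sq h.
      by apply: eq_integral => x _; rewrite mulr1.
    rewrite -[X in (X <= _)%E]/(\int[mu3]_x (((v j.+1 x - v j x)) ^+ 2 * cst 1 x)%:E)%E.
    rewrite !E => /le_trans; apply; rewrite EFinM.
    by apply: lee_wpmul2l => //; rewrite EFinD; apply: leeD; exact: lu.
  - have md n : measurable_fun setT (fun z : pt3 R * pt3 R => u n z.1 - u n z.2).
      by apply: measurable_funB; [exact: measurable_comp_fst|exact: measurable_comp_snd].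
    have := integral_sqrB_le (@leb6 R) (measurable_kern s) (md (phi j.+1)) (md (phi j))
      (@kern_ge0 _ s).
    rewrite -!gagliardoE => h; rewrite gagliardoE.
    have -> : 4 * B = 2 * (B + B) by ring.
    have guu : (gagliardo s (u (phi j.+1)) + gagliardo s (u (phi j)) <= (B + B)%:E)%E.
      by rewrite EFinD; apply: leeD; exact: gu.
    rewrite EFinM; apply: le_trans (lee_wpmul2l _ guu) => //.
    apply: le_trans h; rewrite le_eqVlt; apply/orP; left; apply/eqP.
    by apply: eq_integral => z _; congr (_ * _)%:E; rewrite /v; ring.
  - move=> t; have [_ g1 _] := hphi j; have [_ _ g2] := hphi j.+1.
    rewrite RintegralB//; last 3 first.
    + exact: measurable_gcube.
    + exact: (iu _ _ _).1.
    + exact: (iu _ _ _).1.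
    rewrite -/(avg j t (phi j.+1)) -/(avg j t (phi j)).
    have := ler_distD (sval (lim_avg j t)) (avg j t (phi j.+1)) (avg j t (phi j)).
    rewrite [X in _ <= _ + X]distrC.
    have := g1 t; have := g2 t; rewrite /=; set r := 32^-1 ^+ j.
    set a := `|_ - _|; set b := `|_ - _|; lra.
have cv := ae_geometric_cvg (fun j => mu (phi j)) vC.
(* The upper limit is measurable everywhere and agrees with the limit wherever that exists. *)
exists phi, (fun x => fine (limn_esup (fun k => (v k x)%:E))); split.
- by move=> k; have [] := hphi k.
- apply: measurableT_comp => //; apply: measurable_fun_limn_esup => k.
  by apply/measurable_EFinP; exact: mu.
- apply: (ae_imp _ cv) => x /cvg_ex[l xl].
  have -> : limn_esup (fun k => (v k x)%:E) = l%:E.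
    have := @cvg_limn_einf_sup _ (fun k => (v k x)%:E) l%:E.
    by case; first (apply: cvg_EFin => //; exact: nearW).
  exact: xl.
Qed.

End rellich.

(** * A compactly supported test function of finite energy *)

Section bump.
Context {R : realType}.
Local Notation mu3 := (@leb3 R).
Implicit Types (x y z : pt3 R).

(** The sup-norm distance, whose balls are cubes and therefore have a known measure. *)
Definition distm x y : R :=
  Num.max (Num.max `|c1 x - c1 y| `|c2 x - c2 y|) `|c3 x - c3 y|.

Lemma distm_lt x y r : (distm x y < r) =
  [&& `|c1 x - c1 y| < r, `|c2 x - c2 y| < r & `|c3 x - c3 y| < r].
Proof. by rewrite /distm !gt_max andbA. Qed.

Lemma distm_le x y r : (distm x y <= r) =
  [&& `|c1 x - c1 y| <= r, `|c2 x - c2 y| <= r & `|c3 x - c3 y| <= r].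
Proof. by rewrite /distm !ge_max andbA. Qed.

Lemma distm_ge0 x y : 0 <= distm x y.
Proof. by rewrite /distm le_max normr_ge0 orbT. Qed.

Lemma distm_eq0 x y : distm x y <= 0 -> x = y.
Proof.
rewrite distm_le !normr_le0 !subr_eq0 => /and3P[/eqP + /eqP + /eqP].
rewrite /c1 /c2 /c3; case: x => [[? ?] ?]; case: y => [[? ?] ?] /=.
by move=> -> -> ->.
Qed.

Lemma distmC x y : distm x y = distm y x.
Proof.
by rewrite /distm (distrC (c1 x)) (distrC (c2 x)) (distrC (c3 x)).
Qed.

Lemma distm_triangle x y z : distm x z <= distm x y + distm y z.
Proof.
have := lexx (distm x y); rewrite {1}distm_le => /and3P[a1 a2 a3].
have := lexx (distm y z); rewrite {1}distm_le => /and3P[b1 b2 b3].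
rewrite distm_le; apply/and3P; split.
- by apply: le_trans (ler_distD (c1 y) _ _) _; exact: lerD.
- by apply: le_trans (ler_distD (c2 y) _ _) _; exact: lerD.
- by apply: le_trans (ler_distD (c3 y) _ _) _; exact: lerD.
Qed.

Lemma distm_le_dist3 x y : distm x y <= dist3 x y.
Proof.
have sq a b c : `|a| <= Num.sqrt (a ^+ 2 + b ^+ 2 + c ^+ 2) :> R.
  by rewrite -sqrtr_sqr ler_wsqrtr// -addrA lerDl addr_ge0 ?sqr_ge0.
rewrite distm_le /dist3; apply/and3P; split; first exact: sq.
- by rewrite [X in X + (c3 x - c3 y) ^+ 2]addrC; exact: sq.
- by rewrite [X in Num.sqrt X]addrC addrA; exact: sq.
Qed.

Lemma distm_cube x y r : distm x y < r ->
  cube (c1 x - r, c2 x - r, c3 x - r) (2 * r) y.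
Proof.
rewrite distm_lt !ltr_norml => /and3P[/andP[? ?] /andP[? ?] /andP[? ?]].
by apply/cubeE; rewrite /c1 /c2 /c3/=; split; apply/andP; split; lra.
Qed.

Lemma measurable_distm x : measurable_fun setT (distm x).
Proof.
have ab (h : pt3 R -> R) c : measurable_fun setT h ->
    measurable_fun setT (fun y => `|c - h y|).
  by move=> mh; apply: measurableT_comp => //; apply: measurable_funB.
apply: measurable_maxr; first apply: measurable_maxr.
- by apply: ab; exact: measurable_c1.
- by apply: ab; exact: measurable_c2.
- by apply: ab; exact: measurable_c3.
Qed.

Definition tent z (rho : R) x : R := Num.max 0 (rho - distm z x).

Lemma tent_ge0 z rho x : 0 <= tent z rho x.
Proof. by rewrite le_max lexx. Qed.

Lemma tent_le z rho x : 0 <= rho -> tent z rho x <= rho.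
Proof. by move=> r0; rewrite ge_max r0/= gerBl distm_ge0. Qed.

Lemma tent_gt0 z rho x : (0 < tent z rho x) = (distm z x < rho).
Proof. by rewrite lt_max ltxx/= subr_gt0. Qed.

Lemma tent_lip z rho x y : `|tent z rho x - tent z rho y| <= distm x y.
Proof.
have := distm_triangle z x y; have := distm_triangle z y x.
rewrite (distmC y x) /tent.
by case: (leP 0 (rho - distm z x)) => ?; case: (leP 0 (rho - distm z y)) => ? ? ?;
  rewrite ler_norml; apply/andP; split; have := distm_ge0 x y; lra.
Qed.

Lemma measurable_tent z rho : measurable_fun setT (tent z rho).
Proof.
by apply: measurable_maxr => //; apply: measurable_funB => //; exact: measurable_distm.
Qed.

Lemma dyadic_le (t : R) : 1 <= t -> exists k, 2 ^+ k <= t < 2 ^+ k.+1.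
Proof.
move=> t1; have ex : exists n, t < 2 ^+ n.
  exists (Num.truncn t).+1; apply: lt_le_trans (truncnS_gt _) _.
  by rewrite -natrX ler_nat ltnW// ltn_expl.
case: (ex_minnP ex) => -[|k] tk kmin; first by move: tk; rewrite expr0; lra.
exists k; rewrite tk andbT leNgt; apply/negP => /kmin; by rewrite ltnn.
Qed.

Lemma dyadic_lt (t : R) : 1 < t -> exists k, 2 ^+ k < t <= 2 ^+ k.+1.
Proof.
move=> t1; have ex : exists n, t <= 2 ^+ n.
  by have [k /andP[_ /ltW]] := dyadic_le (ltW t1); exists k.+1.
case: (ex_minnP ex) => -[|k] tk kmin; first by move: tk; rewrite expr0; lra.
exists k; rewrite tk andbT ltNge; apply/negP => /kmin; by rewrite ltnn.
Qed.

(* Majorant of the singular integrand by dyadic shells around [x]. *)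
Lemma tent_shells (s rho : R) z x y : 0 < s -> 0 <= rho ->
  (((tent z rho x - tent z rho y) ^+ 2 * kern s (x, y))%:E <=
   \sum_(0 <= k <oo) ((4^-1 * 2 `^ (3 + 2 * s)) ^+ k * 2 `^ (3 + 2 * s) *
     \1_(cube (c1 x - 2 ^- k, c2 x - 2 ^- k, c3 x - 2 ^- k) (2 * 2 ^- k)) y)%:E +
   \sum_(0 <= k <oo) (rho ^+ 2 * (2 `^ (3 + 2 * s))^-1 ^+ k *
     \1_(cube (c1 x - 2 ^+ k.+1, c2 x - 2 ^+ k.+1, c3 x - 2 ^+ k.+1)
          (2 * 2 ^+ k.+1)) y)%:E)%E.
Proof.
move=> s0 r0; set E := 3 + 2 * s; set A := 2 `^ E.
have A0 : 0 < A by rewrite powR_gt0.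
set S1 := (\sum_(0 <= k <oo) (_ ^+ k * A * _)%:E)%E.
set S2 := (\sum_(0 <= k <oo) (rho ^+ 2 * _ * _)%:E)%E.
have p1 k : (0 <= ((4^-1 * A) ^+ k * A *
     \1_(cube (c1 x - 2 ^- k, c2 x - 2 ^- k, c3 x - 2 ^- k) (2 * 2 ^- k)) y)%:E)%E.
  by rewrite lee_fin !mulr_ge0 ?exprn_ge0 ?mulr_ge0 ?(ltW A0).
have p2 k : (0 <= (rho ^+ 2 * A^-1 ^+ k *
     \1_(cube (c1 x - 2 ^+ k.+1, c2 x - 2 ^+ k.+1, c3 x - 2 ^+ k.+1)
          (2 * 2 ^+ k.+1)) y)%:E)%E.
  by rewrite lee_fin !mulr_ge0 ?exprn_ge0 ?invr_ge0 ?(ltW A0).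
have S10 : (0 <= S1)%E by exact: nneseries_ge0.
have S20 : (0 <= S2)%E by exact: nneseries_ge0.
have powA k : (2 ^+ k) `^ E = A ^+ k.
  elim: k => [|k ih]; first by rewrite !expr0 powR1.
  by rewrite !exprS powRM ?exprn_ge0// ih.
have kle d : 0 < d -> d <= distm x y -> kern s (x, y) <= (d `^ E)^-1.
  move=> d0 dxy; rewrite /kern/= lef_pV2 ?posrE ?powR_gt0//; last first.
    by apply: lt_le_trans d0 _; apply: le_trans dxy (distm_le_dist3 _ _).
  apply: ge0_ler_powR; rewrite ?nnegrE.
  - by rewrite /E; lra.
  - exact: ltW.
  - exact: sqrtr_ge0.
  - exact: le_trans dxy (distm_le_dist3 _ _).
have [d0|d0] := leP (distm x y) 0.
  by rewrite (distm_eq0 d0) subrr expr0n/= mul0r adde_ge0.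
have [d1|d1] := ltP (distm x y) 1.
  (* Near shell: the increment is at most [2^-k] by the Lipschitz bound, and the distance at least
     [2^-(k+1)]. *)
  have [k /andP[k1 k2]] : exists k, 2 ^+ k < (distm x y)^-1 <= 2 ^+ k.+1.
    by apply: dyadic_lt; rewrite invf_gt1.
  have dk : distm x y < 2 ^- k.
    by rewrite -[ltLHS]invrK ltf_pV2 ?posrE ?invr_gt0 ?exprn_gt0.
  have dk1 : 2 ^- k.+1 <= distm x y.
    by rewrite -[leRHS]invrK lef_pV2 ?posrE ?invr_gt0 ?exprn_gt0.
  apply: le_trans (leeDl _ S20); rewrite /S1 (@nneseriesD1 _ _ k)//.
  apply: le_trans (leeDl _ _); last by apply: nneseries_ge0.
  rewrite indicE mem_set; last exact: distm_cube.
  rewrite mulr1 lee_fin exprMn -[leRHS]mulrA; apply: ler_pM; rewrite ?sqr_ge0 ?kern_ge0//.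
    rewrite -[X in X <= _]real_normK ?num_real//.
    have -> : 4^-1 ^+ k = (2 ^- k) ^+ 2 :> R.
      by rewrite -exprVn -exprM mulnC exprM; congr (_ ^+ k); field.
    rewrite ler_sqr ?nnegrE ?normr_ge0 ?invr_ge0 ?exprn_ge0//.
    exact: le_trans (tent_lip _ _ _ _) (ltW dk).
  apply: le_trans (kle _ _ dk1) _; first by rewrite invr_gt0 exprn_gt0.
  by rewrite -exprSr -(powR_inv1 (exprn_ge0 _ _))// powRAC powR_inv1 ?powR_ge0// invrK powA.
(* Far shell: the increment is at most [rho], and the distance at least [2^k]. *)
have [k /andP[k1 k2]] := dyadic_le d1.
apply: le_trans (leeDr _ S10); rewrite /S2 (@nneseriesD1 _ _ k)//.
apply: le_trans (leeDl _ _); last by apply: nneseries_ge0.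
rewrite indicE mem_set; last exact: distm_cube.
rewrite mulr1 lee_fin; apply: ler_pM; rewrite ?sqr_ge0 ?kern_ge0//.
  have := tent_ge0 z rho x; have := tent_ge0 z rho y.
  have := tent_le z x r0; have := tent_le z y r0 => *; nra.
apply: le_trans (kle _ _ k1) _; first by rewrite exprn_gt0.
by rewrite powA exprVn.
Qed.

(** The cubes around the near shells have volume [8 * 8^-k] and give a series of ratio [A / 32],
    below [1] because [s < 1]; those around the far shells have volume [64 * 8^k] and ratio [8 / A],
    below [1] because [s > 0]. *)
Lemma tent_rows (s rho : R) z : 0 < s -> s < 1 -> 0 <= rho ->
  exists2 B : R, 0 <= B & forall x, (\int[mu3]_y
    ((tent z rho x - tent z rho y) ^+ 2 * kern s (x, y))%:E <= B%:E)%E.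
Proof.
move=> s0 s1 r0; set E := 3 + 2 * s; set A := 2 `^ E.
have A0 : 0 < A by rewrite powR_gt0.
have gt1 (e : R) : 0 < e -> 1 < 2 `^ e.
  move=> e0; have := @gt0_ltr_powR R e e0 1 2; rewrite powR1 !nnegrE => ->//; lra.
have A8 : 8 < A.
  have -> : 8 = 2 `^ 3 :> R by rewrite (powR_mulrn 3)//; ring.
  rewrite /A /E (@powRD _ 2 3 (2 * s)) ?pnatr_eq0 ?implybT// ltr_pMr ?powR_gt0//.
  by apply: gt1; lra.
have A32 : A < 32.
  have -> : 32 = A * 2 `^ (2 - 2 * s).
    rewrite /A -powRD ?pnatr_eq0 ?implybT// /E.
    have -> : 3 + 2 * s + (2 - 2 * s) = 5 by ring.
    by rewrite (powR_mulrn 5)//; ring.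
  by rewrite ltr_pMr//; apply: gt1; lra.
exists (8 * A / (1 - A / 32) + 64 * rho ^+ 2 / (1 - 8 / A)).
  have ? : 0 < 1 - A / 32 by lra.
  have ? : 0 < 1 - 8 / A by rewrite subr_gt0 ltr_pdivrMr// mul1r.
  by rewrite addr_ge0// divr_ge0//; first [exact: ltW | by rewrite mulr_ge0 ?sqr_ge0 ?(ltW A0)].
move=> x.
have mF : measurable_fun setT (fun z0 : pt3 R * pt3 R =>
    ((tent z rho z0.1 - tent z rho z0.2) ^+ 2 * kern s z0)%:E).
  by apply/measurable_EFinP; exact: measurable_gagliardo (measurable_tent z rho).
have m1 (c : R) b h : measurable_fun setT (fun y : pt3 R => (c * \1_(cube b h) y)%:E).
  apply/measurable_EFinP; apply: measurable_funM => //.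
  by apply: measurable_indic; exact: measurable_cube.
have i1 (c : R) b h : 0 <= c -> 0 <= h ->
    (\int[mu3]_y (c * \1_(cube b h) y)%:E = (c * h ^+ 3)%:E)%E.
  move=> c0 h0; under eq_integral do rewrite EFinM.
  rewrite ge0_integralZl//; last first.
    by apply/measurable_EFinP; apply: measurable_indic; exact: measurable_cube.
  have mC : measurable (cube b h) := measurable_cube b h.
  rewrite EFinM; congr (c%:E * _)%E.
  by rewrite integral_indic// setIT; exact: leb3_cube.
apply: (@le_trans _ _ (\int[mu3]_y (
   \sum_(0 <= k <oo) ((4^-1 * A) ^+ k * A *
     \1_(cube (c1 x - 2 ^- k, c2 x - 2 ^- k, c3 x - 2 ^- k) (2 * 2 ^- k)) y)%:E +
   \sum_(0 <= k <oo) (rho ^+ 2 * A^-1 ^+ k *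
     \1_(cube (c1 x - 2 ^+ k.+1, c2 x - 2 ^+ k.+1, c3 x - 2 ^+ k.+1)
          (2 * 2 ^+ k.+1)) y)%:E))%E).
  apply: ge0_le_integral => //.
  - by move=> y _; rewrite lee_fin mulr_ge0 ?sqr_ge0 ?kern_ge0.
  - exact: (measurable_fun_pair2 x mF).
  - apply: emeasurable_funD; apply: ge0_emeasurable_sum.
    + by move=> k y _ _; rewrite lee_fin !mulr_ge0 ?exprn_ge0 ?mulr_ge0 ?(ltW A0).
    + by move=> k _; exact: m1.
    + by move=> k y _ _; rewrite lee_fin !mulr_ge0 ?exprn_ge0 ?sqr_ge0 ?invr_ge0 ?(ltW A0).
    + by move=> k _; exact: m1.
  - by move=> y _; exact: tent_shells.
rewrite ge0_integralD//; last 4 first.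
- by move=> y _; apply: nneseries_ge0 => k _ _;
    rewrite lee_fin !mulr_ge0 ?exprn_ge0 ?mulr_ge0 ?(ltW A0).
- apply: ge0_emeasurable_sum => [k y _ _|k _]; last exact: m1.
  by rewrite lee_fin !mulr_ge0 ?exprn_ge0 ?mulr_ge0 ?(ltW A0).
- by move=> y _; apply: nneseries_ge0 => k _ _;
    rewrite lee_fin !mulr_ge0 ?exprn_ge0 ?sqr_ge0 ?invr_ge0 ?(ltW A0).
- apply: ge0_emeasurable_sum => [k y _ _|k _]; last exact: m1.
  by rewrite lee_fin !mulr_ge0 ?exprn_ge0 ?sqr_ge0 ?invr_ge0 ?(ltW A0).
rewrite !integral_nneseries//.
rewrite EFinD; apply: leeD.
- rewrite -nneseries_geometric; [|by rewrite divr_ge0 ?(ltW A0)|lra].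
  rewrite le_eqVlt; apply/orP; left; apply/eqP; apply: eq_eseriesr => k _.
  rewrite i1 ?mulr_ge0 ?exprn_ge0 ?invr_ge0 ?exprn_ge0 ?mulr_ge0 ?(ltW A0)//.
  congr (_%:E); rewrite -exprVn !exprMn -!exprM (mulnC k) exprM.
  have -> : 2^-1 ^+ 3 = 8^-1 :> R by field.
  have -> : 32^-1 = 4^-1 * 8^-1 :> R by field.
  rewrite exprMn.
  ring.
- rewrite -nneseries_geometric; [|by rewrite divr_ge0 ?(ltW A0)|by rewrite ltr_pdivrMr// mul1r].
  rewrite le_eqVlt; apply/orP; left; apply/eqP; apply: eq_eseriesr => k _.
  rewrite i1 ?mulr_ge0 ?exprn_ge0 ?invr_ge0 ?sqr_ge0 ?(ltW A0)//.
  congr (_%:E); rewrite (exprS 2 k) !exprMn -!exprM (mulnC k) exprM.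
  have -> : 2 ^+ 3 = 8 :> R by ring.
  ring.
- by move=> k; exact: m1.
- by move=> k y _; rewrite lee_fin !mulr_ge0 ?exprn_ge0 ?sqr_ge0 ?invr_ge0 ?(ltW A0).
- by move=> k; exact: m1.
- by move=> k y _; rewrite lee_fin !mulr_ge0 ?exprn_ge0 ?mulr_ge0 ?(ltW A0).
Qed.

Lemma bounded_support_integrable (Q : set (pt3 R)) (h : pt3 R -> R) (c : R) :
  measurable Q -> (mu3 Q < +oo)%E -> measurable_fun setT h -> 0 <= c ->
  (forall x, 0 <= h x <= c) -> (forall x, ~ Q x -> h x = 0) ->
  (\int[mu3]_x (h x)%:E < +oo)%E.
Proof.
move=> mQ Qoo mh c0 hc hQ.
apply: (@le_lt_trans _ _ (\int[mu3]_x (c * \1_Q x)%:E)%E).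
  apply: ge0_le_integral => //.
  - by move=> x _; rewrite lee_fin; case/andP: (hc x).
  - exact/measurable_EFinP.
  - by apply/measurable_EFinP; apply: measurable_funM => //; exact: measurable_indic.
  - move=> x _; rewrite lee_fin indicE; case: (pselect (Q x)) => Qx.
      by rewrite mem_set// mulr1; case/andP: (hc x).
    by rewrite memNset// mulr0 hQ.
under eq_integral do rewrite EFinM.
rewrite ge0_integralZl//; last first.
  by apply/measurable_EFinP; exact: measurable_indic.
by rewrite integral_indic// setIT lte_mul_pinfty// ?ge0_fin_numE.
Qed.

(** The integrand vanishes unless [x] or [y] lies in [Q], and it is symmetric; two strips, each
    bounded by [B] times the measure of [Q], therefore suffice. *)
Lemma gagliardo_rows_lty (Q : set (pt3 R)) (s B : R) (w : pt3 R -> R) :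
  measurable Q -> (mu3 Q < +oo)%E -> measurable_fun setT w ->
  (forall x, ~ Q x -> w x = 0) -> 0 <= B ->
  (forall x, (\int[mu3]_y ((w x - w y) ^+ 2 * kern s (x, y))%:E <= B%:E)%E) ->
  (gagliardo s w < +oo)%E.
Proof.
move=> mQ Qoo mw wQ B0 wB.
have mF := measurable_gagliardo s mw.
pose F (z : pt3 R * pt3 R) := (w z.1 - w z.2) ^+ 2 * kern s z.
have F0 (z : pt3 R * pt3 R) : 0 <= F z by rewrite mulr_ge0 ?sqr_ge0 ?kern_ge0.
have mI1 : measurable_fun setT (fun z : pt3 R * pt3 R => \1_Q z.1 : R).
  by apply: measurable_comp_fst; exact: measurable_indic.
have mI2 : measurable_fun setT (fun z : pt3 R * pt3 R => \1_Q z.2 : R).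
  by apply: measurable_comp_snd; exact: measurable_indic.
have m1 : measurable_fun setT (fun z : pt3 R * pt3 R => (\1_Q z.1 * F z)%:E).
  by apply/measurable_EFinP; exact: (measurable_funM mI1 mF).
have m2 : measurable_fun setT (fun z : pt3 R * pt3 R => (\1_Q z.2 * F z)%:E).
  by apply/measurable_EFinP; exact: (measurable_funM mI2 mF).
have rowQ (x : pt3 R) : (\int[mu3]_y (\1_Q x * F (x, y))%:E <= (B * \1_Q x)%:E)%E.
  rewrite indicE; case: (x \in Q) => /=.
    by under eq_integral do rewrite mul1r; rewrite mulr1; exact: wB.
  by under eq_integral do rewrite mul0r; rewrite integral0 mulr0.
have QB : (\int[mu3]_x (B * \1_Q x)%:E < +oo)%E.
  apply: (bounded_support_integrable (c := B) mQ Qoo) => //.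
  - by apply: measurable_funM => //; exact: measurable_indic.
  - move=> x; rewrite indicE; case: (x \in Q); rewrite ?mulr1 ?mulr0 ?lexx ?B0//.
  - by move=> x Qx; rewrite indicE memNset// mulr0.
have mQB : measurable_fun setT (fun x : pt3 R => (B * \1_Q x)%:E).
  by apply/measurable_EFinP; apply: measurable_funM => //; exact: measurable_indic.
rewrite gagliardoE.
apply: (@le_lt_trans _ _ (\int[@leb6 R]_z ((\1_Q z.1 * F z)%:E + (\1_Q z.2 * F z)%:E))%E).
  apply: ge0_le_integral => //.
  - by move=> z _; rewrite lee_fin; exact: F0.
  - by apply/measurable_EFinP.
  - exact: emeasurable_funD.
  - move=> z _; rewrite -EFinD lee_fin !indicE.
    case: (pselect (Q z.1)) => Q1; first by rewrite mem_set// mul1r lerDl mulr_ge0.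
    case: (pselect (Q z.2)) => Q2; first by rewrite (mem_set Q2)// mul1r lerDr mulr_ge0.
    rewrite (wQ _ Q1) (wQ _ Q2) subrr expr0n/= mul0r; exact: addr_ge0 (mulr_ge0 _ _) (mulr_ge0 _ _).
rewrite ge0_integralD//; last 2 first.
- by move=> z _; rewrite lee_fin mulr_ge0.
- by move=> z _; rewrite lee_fin mulr_ge0.
apply: lte_add_pinfty.
- apply: le_lt_trans QB.
  rewrite (@fubini_tonelli1 _ _ _ _ R (@leb3 R) (@leb3 R))//; last first.
    by move=> z; rewrite lee_fin mulr_ge0.
  apply: ge0_le_integral => //.
  + by move=> x _; apply: integral_ge0 => y _; rewrite lee_fin mulr_ge0.
  + by apply: (@measurable_fun_fubini_tonelli_F _ _ _ _ R (@leb3 R) _ m1) => z;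
      rewrite lee_fin mulr_ge0.
  + by move=> x _; exact: rowQ.
- apply: le_lt_trans QB.
  rewrite (@fubini_tonelli2 _ _ _ _ R (@leb3 R) (@leb3 R))//; last first.
    by move=> z; rewrite lee_fin mulr_ge0.
  apply: ge0_le_integral => //.
  + by move=> x _; apply: integral_ge0 => y _; rewrite lee_fin mulr_ge0.
  + by apply: (@measurable_fun_fubini_tonelli_G _ _ _ _ R (@leb3 R) _ m2) => z;
      rewrite lee_fin mulr_ge0.
  + move=> x _; apply: le_trans (rowQ x); rewrite le_eqVlt; apply/orP; left; apply/eqP.
    apply: eq_integral => y _; apply: (congr1 (fun t => (\1_Q x * t)%:E)).
    by rewrite /F /kern /dist3/= -sqrrN opprB; congr (_ * (_ `^ _)^-1);
      congr (Num.sqrt (_ + _ + _)); rewrite -sqrrN opprB.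
Qed.

Lemma tent_gagliardo_lty (s rho : R) z : 0 < s -> s < 1 -> 0 < rho ->
  (gagliardo s (tent z rho) < +oo)%E.
Proof.
move=> s0 s1 r0; have [B B0 rows] := tent_rows z s0 s1 (ltW r0).
pose a : pt3 R := (c1 z - rho, c2 z - rho, c3 z - rho).
apply: (gagliardo_rows_lty (Q := cube a (2 * rho)) (B := B)) => //.
- exact: measurable_cube.
- by rewrite leb3_cube ?ltry// mulr_ge0// ltW.
- exact: measurable_tent.
- move=> x Qx; apply/eqP; rewrite eq_le tent_ge0 andbT leNgt tent_gt0.
  by apply/negP => /distm_cube.
Qed.

(** A tent over a point of the scaled [Omega], small enough that [V] stays bounded where it is
    positive. It provides a ray that meets the Nehari set. *)
Lemma exists_bump (s : R) (V : pt3 R -> R) (V0 eps : R) (Om : set (pt3 R)) p0 :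
  0 < s -> s < 1 -> continuous V -> (forall x, V0 <= V x) -> 0 <= V0 ->
  open Om -> Om p0 -> 0 < eps ->
  exists w : pt3 R -> R, [/\ in_Heps s V eps w, (forall x, 0 <= w x) &
    ~ {ae mu3, forall x, Om (scale3 eps x) -> w x <= 0}].
Proof.
move=> s0 s1 cV V0V V00 oOm Op0 e0.
have nb : nbhs p0 (Om `&` [set x | V x < V p0 + 1]).
  apply: filterI; first exact: open_nbhs_nbhs.
  by apply: (cV p0 [set t : R | t < V p0 + 1]); apply: lt_nbhsl; lra.
have [rho r0 sub] : exists2 rho : R, 0 < rho & forall x, distm p0 x < rho ->
    Om x /\ V x < V p0 + 1.
  have /nbhs_ballP[rho /= r0 sub] := nb; exists rho => // x.
  by rewrite distm_lt => /and3P[*]; apply: sub; split; first split.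
pose z := scale3 eps^-1 p0.
have zE x : distm z x < rho / eps -> distm p0 (scale3 eps x) < rho.
  have H a b : `|eps^-1 * a - b| < rho / eps -> `|a - eps * b| < rho.
    move=> h; have -> : a - eps * b = eps * (eps^-1 * a - b) by field; rewrite gt_eqF.
    by rewrite normrM gtr0_norm// mulrC -ltr_pdivlMr.
  by rewrite !distm_lt => /and3P[*]; apply/and3P; split; exact: H.
have re0 : 0 < rho / eps by rewrite divr_gt0.
set w := tent z (rho / eps).
have w0 x : 0 <= w x by exact: tent_ge0.
have mw : measurable_fun setT w := measurable_tent _ _.
pose a (r : R) : pt3 R := (c1 z - r, c2 z - r, c3 z - r).
have Qoo r : 0 <= r -> (mu3 (cube (a r) (2 * r)) < +oo)%E.
  by move=> rr; rewrite leb3_cube ?ltry// mulr_ge0.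
have wsupp x : ~ cube (a (rho / eps)) (2 * (rho / eps)) x -> w x = 0.
  move=> Qx; apply/eqP; rewrite eq_le w0 andbT leNgt tent_gt0.
  by apply/negP => /distm_cube.
have wle x : w x <= rho / eps by apply: tent_le; exact: ltW.
have w2 x : 0 <= w x ^+ 2 <= (rho / eps) ^+ 2.
  by rewrite sqr_ge0/= ler_sqr ?nnegrE ?(ltW re0).
exists w; split => //.
- split => //.
  + apply: (bounded_support_integrable (c := (rho / eps) ^+ 2) _ (Qoo _ (ltW re0))) => //.
    * exact: measurable_cube.
    * exact: measurable_funX.
    * exact: sqr_ge0.
    * by move=> x /wsupp ->; rewrite expr0n.
  + exact: tent_gagliardo_lty.
  + apply: (bounded_support_integrable (c := (V p0 + 1) * (rho / eps) ^+ 2) _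
      (Qoo _ (ltW re0))) => //.
    * exact: measurable_cube.
    * apply: measurable_funM; last exact: measurable_funX.
      exact: (measurableT_comp (continuous_measurable3 cV) (measurable_scale3 eps)).
    * by rewrite mulr_ge0 ?sqr_ge0//; have := V0V p0; lra.
    * move=> x; have [|] := ltP 0 (w x).
        rewrite tent_gt0 => /zE /sub[_ Vx].
        have := V0V (scale3 eps x) => VV.
        rewrite mulr_ge0 ?sqr_ge0//=; last lra.
        by apply: ler_pM => //; [lra | exact: sqr_ge0 | exact: ltW | case/andP: (w2 x)].
      move=> wx; have -> : w x = 0 by apply/eqP; rewrite eq_le wx w0.
      by rewrite expr0n/= mulr0 lexx mulr_ge0 ?sqr_ge0//; have := V0V p0; lra.
    * by move=> x /wsupp ->; rewrite expr0n mulr0.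
(* The cube of side [2r = rho / eps] centred at [z] lies where the tent is positive, and its measure
   is positive. *)
- pose r := rho / eps / 2; have rr : 0 < r by rewrite divr_gt0.
  move=> [N [mN N0 sN]].
  have : (mu3 (cube (a r) (2 * r)) <= 0)%E.
    rewrite -N0; apply: le_measure; rewrite ?inE//; first exact: measurable_cube.
    move=> x /cubeE Qx; apply: sN => /= h.
    have dx : distm z x < rho / eps.
      have -> : rho / eps = 2 * r by rewrite /r; field; rewrite gt_eqF.
      have H c t : c - r <= t < c - r + 2 * r -> `|c - t| < 2 * r.
        by move: rr; clear=> rr /andP[? ?]; rewrite ltr_norml; apply/andP; split; lra.
      by move: Qx => [/H ? /H ? /H ?]; rewrite distm_lt; apply/and3P.
    have /h : Om (scale3 eps x) by have [] := sub _ (zE _ dx).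
    by rewrite leNgt tent_gt0 dx.
  apply/negP; rewrite -ltNge.
  have rr2 : 0 < 2 * r by rewrite mulr_gt0.
  suff : (0 < @leb3 R (cube (a r) (2 * r)))%E by [].
  by rewrite leb3_cube ?(ltW rr2)// lte_fin exprn_gt0.
Qed.

End bump.

(** * Real integrals over the whole space *)

Section Rintegrable.
Context {d} {T : measurableType d} {R : realType} (mu : {measure set T -> \bar R}).
Implicit Types (f g h k w u v : T -> R).

Definition Rintegrable f : Prop := mu.-integrable setT (EFin \o f).

Lemma RintegrableD f g : Rintegrable f -> Rintegrable g ->
  Rintegrable (fun x => f x + g x).
Proof. exact: integrableRD. Qed.

Lemma RintegrableZ (c : R) f : Rintegrable f -> Rintegrable (fun x => c * f x).
Proof. exact: integrableRZ. Qed.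

Lemma RintegrableB f g : Rintegrable f -> Rintegrable g ->
  Rintegrable (fun x => f x - g x).
Proof.
move=> fi gi; have := RintegrableD fi (RintegrableZ (-1) gi).
by apply: eq_integrableR => // x _; rewrite mulN1r.
Qed.

Lemma le_Rintegrable f g : measurable_fun setT f -> (forall x, `|f x| <= g x) ->
  Rintegrable g -> Rintegrable f.
Proof. by move=> mf fg; apply: le_integrableR. Qed.

Lemma Rintegrable_ge0_lty f : measurable_fun setT f -> (forall x, 0 <= f x) ->
  (\int[mu]_x (f x)%:E < +oo)%E -> Rintegrable f.
Proof. by move=> mf f0 fi; apply: integrable_ge0_lty. Qed.

Lemma Rintegrable_EFin f : Rintegrable f ->
  (\int[mu]_x (f x)%:E)%E = (\int[mu]_x f x)%:E.
Proof. by move=> fi; exact: Rintegral_EFin. Qed.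

Lemma Rintegrable_measurable f : Rintegrable f -> measurable_fun setT f.
Proof. by move=> /measurable_int/measurable_EFinP. Qed.

Lemma RintD f g : Rintegrable f -> Rintegrable g ->
  \int[mu]_x (f x + g x) = \int[mu]_x f x + \int[mu]_x g x.
Proof. by move=> fi gi; rewrite RintegralD. Qed.

Lemma RintB f g : Rintegrable f -> Rintegrable g ->
  \int[mu]_x (f x - g x) = \int[mu]_x f x - \int[mu]_x g x.
Proof. by move=> fi gi; rewrite RintegralB. Qed.

Lemma RintZ (c : R) f : Rintegrable f ->
  \int[mu]_x (c * f x) = c * \int[mu]_x f x.
Proof. by move=> fi; rewrite RintegralZl. Qed.

Lemma Rint_le f g : Rintegrable f -> Rintegrable g -> (forall x, f x <= g x) ->
  \int[mu]_x f x <= \int[mu]_x g x.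
Proof. by move=> fi gi fg; apply: le_Rintegral => // x _; exact: fg. Qed.

(** * Algebra of weighted quadratic forms *)

Section weighted_products.
Variable k : T -> R.
Hypotheses (mk : measurable_fun setT k) (k0 : forall x, 0 <= k x).

Lemma Rintegrable_mul f g : measurable_fun setT f -> measurable_fun setT g ->
  Rintegrable (fun x => k x * f x ^+ 2) -> Rintegrable (fun x => k x * g x ^+ 2) ->
  Rintegrable (fun x => k x * (f x * g x)).
Proof.
move=> mf mg fi gi; apply: le_Rintegrable (RintegrableD fi gi).
  by apply: measurable_funM => //; exact: measurable_funM.
move=> x; rewrite normrM (ger0_norm (k0 x)) -mulrDr ler_wpM2l//.
rewrite normrM -[f x ^+ 2]real_normK ?num_real// -[g x ^+ 2]real_normK ?num_real//.
by have := sqr_ge0 (`|f x| - `|g x|); have := sqr_ge0 (`|f x| + `|g x|); nra.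
Qed.

Lemma Rintegrable_sqr_lin (a b : R) f g :
  measurable_fun setT f -> measurable_fun setT g ->
  Rintegrable (fun x => k x * f x ^+ 2) -> Rintegrable (fun x => k x * g x ^+ 2) ->
  Rintegrable (fun x => k x * (a * f x + b * g x) ^+ 2).
Proof.
move=> mf mg fi gi.
have := RintegrableD (RintegrableZ (a ^+ 2) fi)
  (RintegrableD (RintegrableZ (2 * a * b) (Rintegrable_mul mf mg fi gi))
     (RintegrableZ (b ^+ 2) gi)).
by apply: eq_integrableR => // x _; ring.
Qed.

Lemma Rint_sqr_lin (a b : R) f g :
  measurable_fun setT f -> measurable_fun setT g ->
  Rintegrable (fun x => k x * f x ^+ 2) -> Rintegrable (fun x => k x * g x ^+ 2) ->
  \int[mu]_x (k x * (a * f x + b * g x) ^+ 2) =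
  a ^+ 2 * \int[mu]_x (k x * f x ^+ 2) + 2 * a * b * \int[mu]_x (k x * (f x * g x))
  + b ^+ 2 * \int[mu]_x (k x * g x ^+ 2).
Proof.
move=> mf mg fi gi; have fgi := Rintegrable_mul mf mg fi gi.
rewrite -!RintZ// -RintD; [|exact: RintegrableZ|exact: RintegrableZ].
rewrite -RintD; [|by apply: RintegrableD; exact: RintegrableZ|exact: RintegrableZ].
by apply: eq_Rintegral => x _; ring.
Qed.

Lemma Rint_mul_lin (a b : R) f g h : measurable_fun setT f ->
  measurable_fun setT g -> measurable_fun setT h ->
  Rintegrable (fun x => k x * f x ^+ 2) -> Rintegrable (fun x => k x * g x ^+ 2) ->
  Rintegrable (fun x => k x * h x ^+ 2) ->
  \int[mu]_x (k x * ((a * f x + b * g x) * h x)) =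
  a * \int[mu]_x (k x * (f x * h x)) + b * \int[mu]_x (k x * (g x * h x)).
Proof.
move=> mf mg mh fi gi hi.
have fhi := Rintegrable_mul mf mh fi hi; have ghi := Rintegrable_mul mg mh gi hi.
rewrite -!RintZ// -RintD; [|exact: RintegrableZ|exact: RintegrableZ].
by apply: eq_Rintegral => x _; ring.
Qed.

End weighted_products.

Lemma dominated_Rint (h : nat -> T -> R) f g :
  (forall n, measurable_fun setT (h n)) -> measurable_fun setT f ->
  (forall x, h n x @[n --> \oo] --> f x) -> Rintegrable g ->
  (forall n x, `|h n x| <= g x) ->
  (\int[mu]_x h n x)%R @[n --> \oo] --> (\int[mu]_x f x)%R.
Proof.
move=> mh mf hf gi hg.
have mh' n : measurable_fun setT (EFin \o h n) by exact/measurable_EFinP.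
have mf' : measurable_fun setT (EFin \o f) by exact/measurable_EFinP.
have hf' : {ae mu, forall x, setT x -> EFin (h n x) @[n --> \oo] --> (EFin \o f) x}.
  by apply: aeW => x _; apply: cvg_EFin (hf x); exact: nearW.
have hg' : {ae mu, forall x n, setT x -> (`|(EFin \o h n) x| <= (EFin \o g) x)%E}.
  by apply: aeW => x n _; rewrite /= lee_fin.
have [fi _ cv] := dominated_convergence measurableT mh' mf' hf' gi hg'.
by apply: fine_cvg; rewrite -Rintegrable_EFin.
Qed.

End Rintegrable.

(** * Superposition operators with subcritical growth *)

Section nemytskii.
Context {d} {T : measurableType d} {R : realType} (mu : {measure set T -> \bar R}).
Variables (G g : T -> R -> R) (C q : R).
Hypotheses (C0 : 0 <= C) (q2 : 2 <= q).
Hypotheses (G0 : forall x, G x 0 = 0)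
  (dG : forall x (t : R), is_derive t (1 : R) (G x) (g x t))
  (cg : forall x, continuous (g x))
  (gC : forall x t, `|g x t| <= C * (`|t| + `|t| `^ (q - 1))).
Hypotheses
  (mG : forall w, measurable_fun setT w -> measurable_fun setT (fun x => G x (w x)))
  (mg : forall w, measurable_fun setT w -> measurable_fun setT (fun x => g x (w x))).

Definition in_L2q (w : T -> R) : Prop := [/\ measurable_fun setT w,
  Rintegrable mu (fun x => w x ^+ 2) & Rintegrable mu (fun x => `|w x| `^ q)].

Let measurable_pow (w : T -> R) : measurable_fun setT w ->
  measurable_fun setT (fun x => `|w x| `^ q).
Proof.
move=> mw; apply: (measurableT_comp (measurable_powR _)); exact: measurableT_comp.
Qed.

Lemma in_L2q_le (w e : T -> R) (c : R) : measurable_fun setT w -> 0 <= c ->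
  (forall x, `|w x| <= c * `|e x|) -> in_L2q e -> in_L2q w.
Proof.
move=> mw c0 we [me e2 eq]; split => //.
- apply: le_Rintegrable (RintegrableZ (c ^+ 2) e2).
    exact: measurable_funX.
  move=> x; rewrite ger0_norm ?sqr_ge0// -[w x ^+ 2]real_normK ?num_real//.
  rewrite -[e x ^+ 2]real_normK ?num_real// -exprMn ler_sqr ?nnegrE//.
  by rewrite mulr_ge0.
- apply: le_Rintegrable (RintegrableZ (c `^ q) eq).
    exact: measurable_pow.
  move=> x; rewrite ger0_norm ?powR_ge0// -powRM// ge0_ler_powR// ?nnegrE ?mulr_ge0//.
  by apply: le_trans q2.
Qed.

Lemma in_L2qZ (w : T -> R) (c : R) : in_L2q w -> in_L2q (fun x => c * w x).
Proof.
move=> Lw; have [mw _ _] := Lw; apply: (in_L2q_le (c := `|c|) _ _ _ Lw) => //.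
- exact: measurable_funM.
- by move=> x; rewrite normrM.
Qed.

Lemma in_L2q_sumnorm (u v : T -> R) : in_L2q u -> in_L2q v ->
  in_L2q (fun x => `|u x| + `|v x|).
Proof.
move=> [mu_ u2 uq] [mv v2 vq].
have q0 : 0 <= q by apply: le_trans q2.
have mw : measurable_fun setT (fun x => `|u x| + `|v x|).
  by apply: measurable_funD; apply: measurableT_comp.
split => //.
- apply: le_Rintegrable (RintegrableZ 2 (RintegrableD u2 v2)).
    exact: measurable_funX.
  move=> x; rewrite ger0_norm ?sqr_ge0//.
  rewrite -[u x ^+ 2]real_normK ?num_real// -[v x ^+ 2]real_normK ?num_real//.
  by have := sqr_ge0 (`|u x| - `|v x|); nra.
- apply: le_Rintegrable (RintegrableZ (2 `^ q) (RintegrableD uq vq)).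
    exact: measurable_pow.
  move=> x; rewrite ger0_norm ?powR_ge0// ger0_norm ?addr_ge0//.
  have H a b : 0 <= a -> a <= b -> (a + b) `^ q <= 2 `^ q * (a `^ q + b `^ q).
    move=> a0 ab; have b0 : 0 <= b by exact: le_trans ab.
    apply: (@le_trans _ _ ((2 * b) `^ q)).
      by apply: ge0_ler_powR => //; rewrite ?nnegrE ?addr_ge0 ?mulr_ge0//; lra.
    by rewrite powRM// ler_wpM2l ?powR_ge0// lerDr powR_ge0.
  have [uv|/ltW uv] := leP `|u x| `|v x|; first exact: H.
  by rewrite addrC [X in _ * X]addrC; exact: H.
Qed.

Lemma in_L2q_lin (u v : T -> R) (a b : R) : in_L2q u -> in_L2q v ->
  in_L2q (fun x => a * u x + b * v x).
Proof.
move=> /(in_L2qZ a) Lu /(in_L2qZ b) Lv; have L := in_L2q_sumnorm Lu Lv.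
apply: (in_L2q_le (c := 1) _ _ _ L) => //.
- by case: Lu => ? _ _; case: Lv => ? _ _; apply: measurable_funD.
- by move=> x; rewrite mul1r [leRHS]ger0_norm ?addr_ge0// ler_normD.
Qed.

(** A single envelope [e] bounds both the argument of [g] and the direction, so one function
    dominates all pairings. *)
Let dom (e : T -> R) x := C * (e x ^+ 2 + `|e x| `^ q).

Let dom_integrable e : in_L2q e -> Rintegrable mu (dom e).
Proof. by case=> _ e2 eq; apply: RintegrableZ; exact: RintegrableD. Qed.

Let g_dom (w p e : R) x : `|w| <= e -> `|p| <= e ->
  `|g x w * p| <= C * (e ^+ 2 + `|e| `^ q).
Proof.
move=> we pe; have e0 : 0 <= e by exact: le_trans we.
rewrite normrM; apply: le_trans (ler_pM _ _ (gC x w) pe) _ => //.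
rewrite -mulrA ler_wpM2l// mulrDl (ger0_norm e0) lerD//.
  by rewrite expr2 ler_wpM2r.
rewrite mulrC -(mulr_powRB1 e0); last by move: q2; lra.
by rewrite ler_wpM2l// ge0_ler_powR// ?nnegrE// subr_ge0; move: q2; lra.
Qed.

Let G_dom (w : R) x : `|G x w| <= C * (w ^+ 2 + `|w| `^ q).
Proof.
set D := C * (`|w| + `|w| `^ (q - 1)).
have gD t : `|t| <= `|w| -> `|g x t| <= D.
  move=> tw; apply: le_trans (gC x t) _; rewrite ler_wpM2l// lerD//.
  by rewrite ge0_ler_powR// ?nnegrE// subr_ge0; move: q2; lra.
have -> : C * (w ^+ 2 + `|w| `^ q) = D * `|w|.
  rewrite /D -(mulr_powRB1 (normr_ge0 w)); last by move: q2; lra.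
  by rewrite -[w ^+ 2]real_normK ?num_real//; ring.
have [w0|/ltW w0] := leP 0 w.
  have gD' t : 0 < t < w -> `|g x t| <= D.
    by move=> /andP[t0 tw]; apply: gD; rewrite !ger0_norm// ltW.
  have le1 := @le_increment R (G x) (g x) 0 w D w0 (fun t _ => dG x t).
  have ge1 := @ge_increment R (G x) (g x) 0 w (- D) w0 (fun t _ => dG x t).
  rewrite (ger0_norm w0) ler_norml -mulNr; move: le1 ge1; rewrite G0 !subr0 => le1 ge1.
  by rewrite le1 ?ge1// => t /gD'; rewrite ler_norml => /andP[].
have gD' t : w < t < 0 -> `|g x t| <= D.
  by move=> /andP[tw t0]; apply: gD; rewrite !ler0_norm ?lerN2 ?(ltW t0) ?(ltW tw).
have le1 := @le_increment R (G x) (g x) w 0 D w0 (fun t _ => dG x t).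
have ge1 := @ge_increment R (G x) (g x) w 0 (- D) w0 (fun t _ => dG x t).
rewrite (ler0_norm w0) -normrN ler_norml -mulNr; move: le1 ge1; rewrite G0 !sub0r => le1 ge1.
by rewrite le1 ?ge1// => t /gD'; rewrite ler_norml => /andP[].
Qed.

Lemma nemytskii_integrable (w : T -> R) : in_L2q w ->
  Rintegrable mu (fun x => G x (w x)).
Proof.
move=> Lw; have [mw _ _] := Lw; apply: le_Rintegrable (dom_integrable Lw).
  exact: mG.
by move=> x; exact: G_dom.
Qed.

Lemma nemytskii_pairing_integrable (w p : T -> R) : in_L2q w -> in_L2q p ->
  Rintegrable mu (fun x => g x (w x) * p x).
Proof.
move=> Lw Lp; have [mw _ _] := Lw; have [mp _ _] := Lp.
apply: le_Rintegrable (dom_integrable (in_L2q_sumnorm Lw Lp)).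
  by apply: measurable_funM => //; exact: mg.
by move=> x; apply: g_dom; rewrite ?lerDl ?lerDr.
Qed.

Lemma nemytskii_derive (v p : T -> R) (t : R) : in_L2q v -> in_L2q p ->
  is_derive t (1 : R) (fun t : R => \int[mu]_x G x (v x + t * p x))
    (\int[mu]_x (g x (v x + t * p x) * p x)).
Proof.
move=> Lv Lp; have [mv _ _] := Lv; have [mp _ _] := Lp.
(* The envelope must serve every parameter in [I], where [|z| <= |t| + 1]. *)
pose e x := `|v x| + `|(`|t| + 1) * p x|.
have Le : in_L2q e by apply: in_L2q_sumnorm => //; exact: in_L2qZ.
pose I := `]t - 1, t + 1[%classic : set R.
have Ie z : I z -> `|z| <= `|t| + 1.
  rewrite /I /= in_itv/= => /andP[z1 z2].
  have : `|z - t| <= 1 by rewrite ler_norml; apply/andP; split; lra.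
  by have := ler_normD (z - t) t; rewrite subrK; lra.
have dGz y z : is_derive z (1 : R) (fun z => G y (v y + z * p y))
    (g y (v y + z * p y) * p y).
  have h : is_derive z (1 : R) (fun z : R => v y + z * p y) (p y).
    have := @is_deriveD _ _ _ (cst (v y)) (fun z : R => z * p y) z 1 _ _
      (is_derive_cst _ _ _) (@is_deriveM _ _ id (cst (p y)) z 1 _ _
        (is_derive_id _ _) (is_derive_cst _ _ _)).
    by rewrite /cst/= scaler0 !add0r => /is_derive_eq; apply; rewrite /GRing.scale/= mulr1.
  exact: is_derive1_comp.
have tI : I t by rewrite /I/= in_itv/=; apply/andP; split; lra.
have Ls z : in_L2q (fun x => v x + z * p x).
  rewrite (_ : (fun x => _) = fun x => 1 * v x + z * p x); first exact: in_L2q_lin.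
  by apply/funext => x; rewrite mul1r.
have intf z : I z -> mu.-integrable setT (EFin \o (fun x => G x (v x + z * p x))).
  by move=> _; exact: nemytskii_integrable.
have derf z y : I z -> setT y -> derivable (fun z : R => G y (v y + z * p y)) z 1.
  by move=> _ _; have [] := dGz y z.
have d1E z y : partial1of2 (fun (z : R) y => G y (v y + z * p y)) z y =
    g y (v y + z * p y) * p y.
  by rewrite partial1of2E; have [] := dGz y z.
have G_ub z y : I z -> setT y ->
    `|partial1of2 (fun (z : R) y => G y (v y + z * p y)) z y| <= dom e y.
  move=> Iz _; rewrite d1E; apply: g_dom.
    apply: le_trans (ler_normD _ _) _; rewrite /e lerD2l !normrM ler_wpM2r//.
    by rewrite (ger0_norm (addr_ge0 _ _))// Ie.
  rewrite /e normrM; apply: (@le_trans _ _ (1 * `|p y|)); first by rewrite mul1r.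
  rewrite -[leLHS]add0r lerD// ler_wpM2r// ger0_norm ?addr_ge0// lerDr//.
have G_ge0 y : 0 <= dom e y.
  by rewrite /dom mulr_ge0// addr_ge0 ?sqr_ge0 ?powR_ge0.
have dF := @derivable_under_integral R _ T mu _ setT measurableT t (t - 1) (t + 1)
  tI intf derf (dom e) G_ge0 (dom_integrable Le) G_ub.
have F' := @differentiation_under_integral R _ T mu _ setT measurableT t (t - 1) (t + 1)
  tI intf derf (dom e) G_ge0 (dom_integrable Le) G_ub.
apply: DeriveDef => //; rewrite -derive1E F'.
by apply: eq_Rintegral => y _; exact: d1E.
Qed.

Lemma nemytskii_cvg (u v p : T -> R) (a b : nat -> R) (la lb : R) :
  in_L2q u -> in_L2q v -> in_L2q p ->
  a n @[n --> \oo] --> la -> b n @[n --> \oo] --> lb ->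
  (\int[mu]_x (g x (a n * u x + b n * v x) * p x)) @[n --> \oo] -->
  \int[mu]_x (g x (la * u x + lb * v x) * p x).
Proof.
move=> Lu Lv Lp ca cb; have [mu_ _ _] := Lu; have [mv _ _] := Lv; have [mp _ _] := Lp.
have bnd (z : nat -> R) (l : R) : z n @[n --> \oo] --> l -> exists r : R, forall n, `|z n| <= r.
  move=> cz; have /cvg_seq_bounded[r [_ rz]] : cvgn z by apply/cvg_ex; exists l.
  by exists (r + 1) => n; apply: rz => //; lra.
have [ra ha] := bnd _ _ ca; have [rb hb] := bnd _ _ cb.
pose e x := `| `|ra * u x| + `|rb * v x| | + `|p x|.
have Le : in_L2q e.
  by apply: in_L2q_sumnorm => //; apply: in_L2q_sumnorm; exact: in_L2qZ.
have m z y : measurable_fun setT (fun x => g x (z * u x + y * v x) * p x).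
  apply: measurable_funM => //; apply: mg.
  by apply: measurable_funD; exact: measurable_funM.
apply: (dominated_Rint (g := dom e)) => //.
- move=> x; apply: cvgM; last exact: cvg_cst.
  have h : a n * u x + b n * v x @[n --> \oo] --> la * u x + lb * v x.
    by apply: cvgD; apply: cvgM => //; exact: cvg_cst.
  by apply: (cvg_comp _ _ h); exact: cg.
- exact: dom_integrable.
- move=> n x; apply: g_dom; last by rewrite lerDr.
  have -> : e x = `|ra * u x| + `|rb * v x| + `|p x|.
    by rewrite /e [X in X + _ = _]ger0_norm ?addr_ge0.
  apply: le_trans (ler_normD _ _) _.
  rewrite -[leLHS]addr0 lerD// lerD// !normrM ler_wpM2r//.
    by apply: le_trans (ha n) (ler_norm _).
  by apply: le_trans (hb n) (ler_norm _).
Qed.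

End nemytskii.

(** * The Kirchhoff coefficient and its primitive *)

Section kirchhoff_coefficient.
Context {R : realType} (M : R -> R) (m0 : R).
Hypotheses (cM : {within [set t : R | 0 <= t], continuous M}) (m00 : 0 < m0)
  (M1 : forall t, 0 <= t -> m0 <= M t)
  (M3 : forall t1 t2, 0 < t2 -> t2 <= t1 ->
     M t1 / t1 - M t2 / t2 <= m0 * (1 / t1 - 1 / t2)).

(* [M] is only assumed continuous on the half line; its even extension is
   continuous everywhere and has the same primitive there. *)
Definition even_ext (t : R) : R := M `|t|.

Lemma even_extE t : 0 <= t -> even_ext t = M t.
Proof. by move=> t0; rewrite /even_ext ger0_norm. Qed.

Lemma continuous_even_ext : continuous even_ext.
Proof.
move=> x; have /subspace_continuousP/(_ `|x| (normr_ge0 x)) := cM.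
move=> h U /h; rewrite /within/= => hU.
have hx : nbhs x (Num.norm @^-1` (fun t : R => 0 <= t -> U (M t))).
  exact: (@norm_continuous _ _ x _ hU).
by apply: (filterS _ hx) => y; apply; exact: normr_ge0.
Qed.

Lemma is_derive_int0_even_ext t : is_derive t (1 : R) (int0 even_ext) (even_ext t).
Proof. exact: is_derive_int0 continuous_even_ext. Qed.

Lemma int0_even_ext t : 0 <= t -> int0 even_ext t = int0 M t.
Proof. by move=> t0; apply: eq_int0 => // x; exact: even_extE. Qed.

Lemma even_ext_ge t : m0 <= even_ext t.
Proof. exact: M1. Qed.

Lemma int0_even_ext_incr x y : x <= y ->
  m0 * (y - x) <= int0 even_ext y - int0 even_ext x.
Proof.
move=> xy; apply: (ge_increment xy) => z _.
  exact: is_derive_int0_even_ext.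
exact: even_ext_ge.
Qed.

(** (M3) against the point [1]: [M] grows at most linearly, so along a ray the Kirchhoff part of the
    derivative grows at most like the cube of the parameter. *)
Lemma even_ext_le t : 1 <= t -> even_ext t <= even_ext 1 * t.
Proof.
move=> t1; have t0 : 0 < t by lra.
have := M3 ltr01 t1; rewrite !even_extE ?(ltW t0)// !divr1 mulrBr mulr1 => h.
rewrite -ler_pdivrMr//; have : m0 * (1 / t) <= m0.
  by rewrite ler_piMr ?(ltW m00)// ler_pdivrMr// mul1r.
lra.
Qed.

(** (M3) at the points [t1^2 A] and [t2^2 A], multiplied by [A^2]. *)
Lemma even_ext_fiber A t1 t2 : 0 <= A -> 0 < t2 -> t2 <= t1 ->
  even_ext (t1 ^+ 2 * A) * A / t1 ^+ 2 - even_ext (t2 ^+ 2 * A) * A / t2 ^+ 2 <=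
  m0 * A * (t1 ^- 2 - t2 ^- 2).
Proof.
rewrite le_eqVlt => /predU1P[<-|A0] t20 t21; first by rewrite !(mulr0, mul0r) subrr.
have t10 : 0 < t1 by lra.
have a1 : 0 < t1 ^+ 2 * A by rewrite mulr_gt0 ?exprn_gt0.
have a2 : 0 < t2 ^+ 2 * A by rewrite mulr_gt0 ?exprn_gt0.
have a21 : t2 ^+ 2 * A <= t1 ^+ 2 * A.
  by rewrite ler_pM2r// ler_sqr ?nnegrE// ltW.
have := M3 a2 a21; rewrite !even_extE; [|exact: ltW|exact: ltW] => h.
have := ler_wpM2r (ltW (exprn_gt0 2 A0)) h.
set X := M _; set Y := M _.
have -> : (X / (t1 ^+ 2 * A) - Y / (t2 ^+ 2 * A)) * A ^+ 2 =
    X * A / t1 ^+ 2 - Y * A / t2 ^+ 2.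
  by field; rewrite !gt_eqF.
have -> : m0 * (1 / (t1 ^+ 2 * A) - 1 / (t2 ^+ 2 * A)) * A ^+ 2 =
    m0 * A * (t1 ^- 2 - t2 ^- 2).
  by field; rewrite !gt_eqF.
by [].
Qed.

(** (M3) says that [(M x - m0) / x] is nonincreasing, so on [(0, t]] the graph of [M] lies above the
    segment from [(0, m0)] to [(t, M t)]; the left side is the area under that segment. *)
Lemma int0_even_ext_ge t : 0 <= t ->
  2^-1 * (even_ext t + m0) * t <= int0 even_ext t.
Proof.
rewrite le_eqVlt => /predU1P[<-|t0]; first by rewrite int00 mulr0.
pose c := (even_ext t - m0) / t.
pose P x : R := int0 even_ext x - (m0 * x + c * (x * x) / 2).
have dP x : is_derive x (1 : R) P (even_ext x - (m0 + c * x)).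
  have dx : is_derive x (1 : R) (fun x : R => m0 * x + c * (x * x) / 2) (m0 + c * x).
    apply: is_derive_eq; rewrite /GRing.scale/=; by field.
  exact: (is_deriveB (is_derive_int0_even_ext x) dx).
have := @ge_increment R P (fun x => even_ext x - (m0 + c * x)) 0 t 0 (ltW t0)
  (fun x _ => dP x).
rewrite mul0r subr_ge0 => /(_ _)/wrap[x /andP[x0 xt]|].
  rewrite subr_ge0 /c; have := M3 x0 (ltW xt).
  rewrite !even_extE ?(ltW t0) ?(ltW x0)//.
  move=> h; have := ler_wpM2l (ltW x0) h.
  have -> : x * (M t / t - M x / x) = M t / t * x - M x by field; rewrite !gt_eqF.
  have -> : x * (m0 * (1 / t - 1 / x)) = m0 / t * x - m0 by field; rewrite !gt_eqF.
  by rewrite mulrBl mulrBl; lra.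
rewrite /P int00 !mulr0 mul0r addr0 subr0 subr_ge0; apply: le_trans.
by rewrite /c le_eqVlt; apply/orP; left; apply/eqP; field; rewrite gt_eqF.
Qed.

End kirchhoff_coefficient.

(** * The nonlinearity and its truncation *)

Section nonlinearity.
Context {R : realType} (f : R -> R) (V0 K a q th : R).
Hypotheses (cf : continuous f) (fneg : forall t, t < 0 -> f t = 0).
Hypotheses (q4 : 4 < q) (f2 : f t / t `^ (q - 1) @[t --> +oo] --> 0).
Hypotheses (th4 : 4 < th)
  (f3 : forall t, 0 < t -> 0 < th * int0 f t /\ th * int0 f t <= f t * t).
Hypothesis f4 : forall t1 t2, 0 < t1 -> t1 <= t2 ->
  f t1 / t1 ^+ 3 <= f t2 / t2 ^+ 3.
Hypotheses (V00 : 0 < V0) (K0 : 0 < K) (a0 : 0 < a) (fa : f a = V0 / K * a).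

Lemma f_at0 : f 0 = 0.
Proof.
apply/eqP/negPn/negP => f0; have fp : 0 < `|f 0| by rewrite normr_gt0.
have /cvgrPdist_lt/(_ _ fp)/nbhs_ballP[e /= e0 he] := @cf 0.
have := he (- (e / 2)); rewrite /ball/= sub0r opprK ger0_norm ?divr_ge0 ?(ltW e0)//.
have e2 : e / 2 < e by lra.
by move=> /(_ e2); rewrite (_ : f (- (e / 2)) = 0) ?subr0 ?ltxx// fneg// oppr_lt0 divr_gt0.
Qed.

Lemma f_le0 t : t <= 0 -> f t = 0.
Proof. by rewrite le_eqVlt => /predU1P[->|/fneg//]; exact: f_at0. Qed.

Lemma f_gt0 t : 0 < t -> 0 < f t.
Proof.
by move=> t0; have [F0 Ff] := f3 t0; rewrite -(pmulr_lgt0 _ t0); exact: lt_le_trans Ff.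
Qed.

Lemma f_ge0 t : 0 <= f t.
Proof. by have [/f_gt0/ltW|/f_le0->] := ltP 0 t. Qed.

Lemma int0_vanish (h : R -> R) t : continuous h -> (forall x, x <= 0 -> h x = 0) ->
  t <= 0 -> int0 h t = 0.
Proof.
move=> ch h0 t0; have dh x (_ : t <= x <= 0) := is_derive_int0 x ch.
have := @le_increment R (int0 h) h t 0 0 t0 dh.
have := @ge_increment R (int0 h) h t 0 0 t0 dh.
rewrite int00 mul0r sub0r oppr_ge0 oppr_le0 => le1 ge1.
by apply/eqP; rewrite eq_le le1 ?ge1// => x /andP[_ /ltW/h0 ->].
Qed.

Lemma f_cubic t T : 0 < t -> t <= T -> f t <= t ^+ 3 * (f T / T ^+ 3).
Proof. by move=> t0 tT; rewrite mulrC -ler_pdivrMr ?exprn_gt0// f4. Qed.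

Lemma f_le_right t T : t <= T -> f t <= f T.
Proof.
have [t0 tT|/f_le0 ->] := ltP 0 t; last by rewrite f_ge0.
have T0 : 0 < T by exact: lt_le_trans tT.
apply: le_trans (f_cubic t0 tT) _; rewrite mulrCA ler_piMr ?f_ge0//.
by rewrite ler_pdivrMr ?exprn_gt0// mul1r lerXn2r ?nnegrE// ltW.
Qed.

Lemma f_power (d : R) : 0 < d -> exists2 T, 1 <= T &
  forall t, T <= t -> f t <= d * t `^ (q - 1).
Proof.
move=> d0; have /cvgrPdist_lt/(_ _ d0)[T [_ hT]] := f2.
exists (Num.max 1 (T + 1)); first by rewrite le_max lexx.
move=> t; rewrite ge_max => /andP[t1 tT].
have t0 : 0 < t by lra.
have := hT t; rewrite sub0r normrN => /(_ _)/wrap[|h]; first lra.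
rewrite -ler_pdivrMr ?powR_gt0//; apply: le_trans (ler_norm _) _; exact: ltW.
Qed.

(** Three ranges: on [(0, r]] the cubic bound from (f4) beats the linear term, beyond [T] (f2)
    applies, and in between monotonicity bounds [f] by [f T]. *)
Lemma f_growth (d : R) : 0 < d -> exists2 C, 0 <= C &
  forall t, `|f t| <= d * `|t| + C * `|t| `^ (q - 1).
Proof.
move=> d0; have [T T1 hT] := f_power ltr01.
have T0 : 0 < T by lra.
(* Chosen so that [f 1 * t^3 <= d * t] for [0 < t <= r]. *)
pose r := Num.min 1 (d / (f 1 + 1)).
have f1 : 0 <= f 1 := f_ge0 1.
have r0 : 0 < r by rewrite lt_min ltr01 divr_gt0// ltr_wpDl.
have r1 : r <= 1 by rewrite ge_min lexx.
have rd : r * f 1 <= d.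
  have : r <= d / (f 1 + 1) by rewrite ge_min lexx orbT.
  by rewrite ler_pdivlMr ?ltr_wpDl//; nra.
have C0 : 0 <= f T / r `^ (q - 1) by rewrite divr_ge0 ?f_ge0 ?powR_ge0.
exists (1 + f T / r `^ (q - 1)); first by rewrite addr_ge0.
move=> t; rewrite (ger0_norm (f_ge0 t)).
have [t0|/f_le0 ->] := ltP 0 t; last first.
  by rewrite addr_ge0 ?mulr_ge0 ?addr_ge0 ?powR_ge0// ltW.
rewrite (ger0_norm (ltW t0)); have tp := powR_ge0 t (q - 1).
have [tT|tT] := leP T t.
  apply: le_trans (hT _ tT) _; rewrite -[leLHS]add0r lerD ?mulr_ge0 ?(ltW d0) ?(ltW t0)//.
  by rewrite ler_wpM2r// lerDl.
have [tr|tr] := leP t r.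
  rewrite -[leLHS]addr0 lerD ?mulr_ge0 ?addr_ge0//.
  apply: le_trans (f_cubic t0 (le_trans tr r1)) _; rewrite expr1n divr1.
  rewrite exprS mulrAC -mulrA mulrC ler_wpM2r ?(ltW t0)//.
  apply: le_trans rd; rewrite mulrC ler_wpM2r//.
  by rewrite expr2; nra.
apply: (@le_trans _ _ (f T)); first by apply: f_le_right; exact: ltW.
rewrite -[leLHS]add0r lerD ?mulr_ge0 ?(ltW d0) ?(ltW t0)//.
apply: (@le_trans _ _ (f T / r `^ (q - 1) * t `^ (q - 1))); last first.
  by rewrite ler_wpM2r// lerDr.
rewrite -mulrA ler_peMr ?f_ge0// ler_pdivlMl ?powR_gt0// mulr1.
by apply: ge0_ler_powR; rewrite ?nnegrE ?(ltW r0) ?(ltW t0) ?(ltW tr)//; move: q4; lra.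
Qed.

(** A constant takes the place of the linear term. It is affordable on a set of finite measure, and
    it lets the coefficient of the power be as small as desired, so that a mere bound in [L^q]
    becomes negligible. *)
Lemma f_weak_growth (d : R) : 0 < d -> exists2 C, 0 <= C &
  forall t, f t * t <= d * `|t| `^ q + C.
Proof.
move=> d0; have [T T1 hT] := f_power d0.
have T0 : 0 < T by lra.
exists (f T * T); first by rewrite mulr_ge0 ?f_ge0// ltW.
move=> t; have [t0|t0] := ltP 0 t; last first.
  rewrite (f_le0 t0) mul0r addr_ge0 ?mulr_ge0 ?powR_ge0 ?f_ge0//; exact: ltW.
rewrite (ger0_norm (ltW t0)).
have [tT|/ltW tT] := leP T t.
  apply: (@le_trans _ _ (d * t `^ (q - 1) * t)).
    by rewrite ler_wpM2r ?(ltW t0)// hT.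
  rewrite -mulrA [X in d * X]mulrC mulr_powRB1 ?(ltW t0)//; last by move: q4; lra.
  by rewrite lerDl mulr_ge0 ?f_ge0// ltW.
rewrite -[leLHS]add0r lerD ?mulr_ge0 ?powR_ge0 ?(ltW d0)//.
by apply: ler_pM => //; [exact: f_ge0|exact: ltW|exact: f_le_right].
Qed.

Lemma int0_f_ge0 t : 0 <= int0 f t.
Proof.
have [t0|t0] := ltP 0 t; last by rewrite (int0_vanish cf)//; exact: f_le0.
have [F0 _] := f3 t0; move: F0; rewrite pmulr_rgt0; last by move: th4; lra.
exact: ltW.
Qed.

Lemma int0_f_le t : int0 f t <= 4^-1 * (f t * t).
Proof.
have [t0|t0] := ltP 0 t; last by rewrite (int0_vanish cf) ?f_le0 ?mul0r ?mulr0//; exact: f_le0.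
have [_] := f3 t0; have := int0_f_ge0 t; move: th4; nra.
Qed.

Lemma bernoulli_ineq (x : R) k : 0 <= x -> 1 + k%:R * x <= (1 + x) ^+ k.
Proof.
move=> x0; elim: k => [|k ih]; first by rewrite mul0r addr0 expr0.
rewrite exprS; apply: le_trans (ler_wpM2l _ ih); last by rewrite addr_ge0.
have : 0 <= k%:R * x * x by rewrite !mulr_ge0.
by rewrite -natr1; nra.
Qed.

(** By (f4), [f x >= p x^3] beyond [s]; integrating from [s] to [t = l s] gives
    [p / 4 * (t^4 - s^4)] as a lower bound for the primitive at [t], and (f3) turns this back into a
    bound for [f t]. The factor gained exceeds [1] for large [l] because [th > 4]. *)
Lemma f_ratio_step (s l : R) : 0 < s -> 1 <= l ->
  th / 4 * (1 - l^-1) * (f s / s ^+ 3) <= f (l * s) / (l * s) ^+ 3.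
Proof.
move=> s0 l1; have l0 : 0 < l by lra.
set p := f s / s ^+ 3; set t := l * s.
have t0 : 0 < t by rewrite mulr_gt0.
have st : s <= t by rewrite ler_peMl// ltW.
have p0 : 0 <= p by rewrite divr_ge0 ?f_ge0 ?exprn_ge0// ltW.
pose P x : R := int0 f x - p / 4 * (x * x * (x * x)).
have dP x : is_derive x (1 : R) P (f x - p * x ^+ 3).
  have dx : is_derive x (1 : R) (fun x : R => p / 4 * (x * x * (x * x))) (p * x ^+ 3).
    apply: is_derive_eq; rewrite /GRing.scale/=; by field.
  exact: (is_deriveB (is_derive_int0 x cf) dx).
have := @ge_increment R P (fun x => f x - p * x ^+ 3) s t 0 st (fun x _ => dP x).
rewrite mul0r => /(_ _)/wrap[x /andP[sx _]|h].
  have x0 : 0 < x by exact: lt_trans sx.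
  by rewrite subr_ge0 -ler_pdivlMr ?exprn_gt0// f4// ltW.
have F0 := int0_f_ge0 s; have [_ Ft] := f3 t0.
rewrite ler_pdivlMr ?exprn_gt0//.
have h1 : p / 4 * (t ^+ 4 - s ^+ 4) <= int0 f t by move: h; rewrite /P; nra.
have s4 : s ^+ 4 <= l^-1 * t ^+ 4.
  have -> : l^-1 * t ^+ 4 = l ^+ 3 * s ^+ 4 by rewrite /t; field; rewrite gt_eqF.
  by rewrite ler_peMl ?exprn_ge0 ?exprn_ege1// ltW.
have h2 : th * (p / 4 * ((1 - l^-1) * t ^+ 4)) <= f t * t.
  apply: le_trans Ft; rewrite ler_wpM2l//; first by move: th4; lra.
  apply: le_trans h1; apply: ler_wpM2l; first by rewrite divr_ge0.
  by rewrite mulrBl mul1r lerB.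
rewrite -(ler_pM2r t0); apply: le_trans h2.
by rewrite le_eqVlt; apply/orP; left; apply/eqP; ring.
Qed.

(** Each use of [f_ratio_step] along the powers of [l] multiplies the lower bound on [f t / t^3] by
    [1 + x > 1], so the ratio is unbounded; (f4) extends the bound from those points to all larger
    [t]. *)
Lemma f_superquartic (L : R) : exists2 T, 0 < T &
  forall t, T <= t -> L <= f t / t ^+ 3.
Proof.
(* With this [l] the factor [th / 4 * (1 - 1/l)] is [(th + 4) / 8 = 1 + x]. *)
pose l := 2 * th / (th - 4); pose x := (th - 4) / 8.
have th0 : 0 < th by move: th4; lra.
have th4' : 0 < th - 4 by move: th4; lra.
have l1 : 1 <= l by rewrite ler_pdivlMr//; move: th4; lra.
have x0 : 0 < x by rewrite divr_gt0.
have E : th / 4 * (1 - l^-1) = 1 + x.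
  by rewrite /l /x; field; rewrite !gt_eqF.
have iter k : (1 + x) ^+ k * f 1 <= f (l ^+ k) / (l ^+ k) ^+ 3.
  elim: k => [|k ih]; first by rewrite !expr0 mul1r expr1n divr1.
  rewrite (exprS (1 + x)) -mulrA; apply: le_trans (ler_wpM2l _ ih) _.
    by rewrite addr_ge0// ltW.
  by rewrite -E (exprS l); apply: (f_ratio_step _ l1); rewrite exprn_gt0//; lra.
pose k := (Num.truncn `|L / (x * f 1)|).+1.
have f10 := f_gt0 ltr01.
exists (l ^+ k); first by rewrite exprn_gt0//; lra.
move=> t lt; apply: (@le_trans _ _ (f (l ^+ k) / (l ^+ k) ^+ 3)); last first.
  by apply: f4 => //; rewrite exprn_gt0//; lra.
apply: le_trans (iter k).
apply: (@le_trans _ _ (k%:R * x * f 1)); last first.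
  rewrite ler_wpM2r ?(ltW f10)//; apply: le_trans (bernoulli_ineq k (ltW x0)).
  by rewrite lerDr.
rewrite -mulrA -ler_pdivrMr ?mulr_gt0//; apply: le_trans (ler_norm _) _.
by apply: ltW; exact: truncnS_gt.
Qed.

Lemma continuous_ftilde : continuous (ftilde f V0 K a).
Proof.
(* The condition on [f a] makes the two branches match at [a], which this sum of continuous
   functions displays. *)
have -> : ftilde f V0 K a = fun t => f (Num.min t a) + V0 / K * (Num.max t a - a).
  apply/funext => t; rewrite /ftilde; case: (leP t a) => ta.
    by rewrite subrr mulr0 addr0.
  by rewrite fa; ring.
move=> t; apply: cvgD.
  have h : Num.min x a @[x --> t] --> Num.min t a.
    by apply: continuous_min; [exact: cvg_id|exact: cvg_cst].
  exact: (cvg_comp _ _ h (@cf _)).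
apply: cvgM; first exact: cvg_cst.
apply: cvgB; last exact: cvg_cst.
by apply: continuous_max; [exact: cvg_id|exact: cvg_cst].
Qed.

Lemma ftilde_le0 t : t <= 0 -> ftilde f V0 K a t = 0.
Proof.
by move=> t0; rewrite /ftilde (le_trans t0 (ltW a0)); exact: f_le0.
Qed.

Lemma ftilde_ge0 t : 0 <= ftilde f V0 K a t.
Proof.
rewrite /ftilde; case: ifPn => [_|]; first exact: f_ge0.
rewrite -ltNge => ta; apply: mulr_ge0; first by rewrite divr_ge0 ?ltW.
by apply: ltW; exact: lt_trans ta.
Qed.

Lemma ftilde_le t : ftilde f V0 K a t <= V0 / K * `|t|.
Proof.
have VK : 0 < V0 / K by rewrite divr_gt0.
have [t0|t0] := ltP 0 t; last by rewrite ftilde_le0// mulr_ge0// ltW.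
rewrite (ger0_norm (ltW t0)) /ftilde; case: ifPn => // ta.
apply: le_trans (f_cubic t0 ta) _; rewrite fa.
have -> : t ^+ 3 * (V0 / K * a / a ^+ 3) = V0 / K * t * (t / a) ^+ 2.
  by field; rewrite !gt_eqF.
apply: ler_piMr; first by apply: mulr_ge0; exact: ltW.
by apply: exprn_ile1; rewrite ?divr_ge0 ?ler_pdivrMr ?mul1r ?(ltW t0) ?(ltW a0).
Qed.

Lemma int0_ftilde_le t : int0 (ftilde f V0 K a) t <= V0 / (2 * K) * t ^+ 2.
Proof.
have VK : 0 <= V0 / (2 * K) by rewrite divr_ge0 ?mulr_ge0 ?ltW.
have [/ltW t0|t0] := ltP 0 t; last first.
  rewrite (int0_vanish continuous_ftilde)//; last exact: ftilde_le0.
  by rewrite mulr_ge0 ?sqr_ge0.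
pose P x : R := int0 (ftilde f V0 K a) x - V0 / (2 * K) * (x * x).
have dP x : is_derive x (1 : R) P (ftilde f V0 K a x - V0 / K * x).
  have dx : is_derive x (1 : R) (fun x : R => V0 / (2 * K) * (x * x)) (V0 / K * x).
    by apply: is_derive_eq; rewrite /GRing.scale/=; field; rewrite gt_eqF.
  exact: (is_deriveB (is_derive_int0 x continuous_ftilde) dx).
have := le_increment (C := 0) t0 (fun x (_ : 0 <= x <= t) => dP x).
rewrite mul0r => /(_ _)/wrap[x /andP[/ltW x0 _]|].
  by rewrite subr_le0; have := ftilde_le x; rewrite ger0_norm.
by rewrite /P int00 !mulr0 subrr subr0 subr_le0 expr2.
Qed.

(** Beyond [a] the truncation is linear and the quarter bound of [int0_f_le] is lost. The bound
    [V0 / (2K) t^2] then splits evenly into a quarter of [ftilde t * t] and the defect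
    [V0 / (4K) t^2]. *)
Lemma int0_ftilde_quarter t : int0 (ftilde f V0 K a) t <=
  4^-1 * (ftilde f V0 K a t * t) + V0 / (4 * K) * t ^+ 2.
Proof.
have VK : 0 <= V0 / (4 * K) by rewrite divr_ge0 ?mulr_ge0 ?ltW.
have [t0|t0] := ltP 0 t; last first.
  rewrite (int0_vanish continuous_ftilde) ?ftilde_le0//; last exact: ftilde_le0.
  by rewrite mul0r mulr0 add0r mulr_ge0 ?sqr_ge0.
have [ta|ta] := leP t a; last first.
  apply: le_trans (int0_ftilde_le t) _; rewrite [in leRHS]/ftilde [t <= a]leNgt ta/=.
  by rewrite le_eqVlt; apply/orP; left; apply/eqP; field; rewrite gt_eqF.
have -> : int0 (ftilde f V0 K a) t = int0 f t.
  rewrite /int0 (ltW t0); apply: eq_Rintegral => x.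
  by rewrite inE/= in_itv/= /ftilde => /andP[_ xt]; rewrite (le_trans xt ta).
rewrite /ftilde ta; apply: le_trans (int0_f_le t) _.
by rewrite lerDl mulr_ge0 ?sqr_ge0.
Qed.

Lemma f_fiber v t1 t2 : 0 < t2 -> t2 <= t1 ->
  f (t2 * v) * v / t2 ^+ 3 <= f (t1 * v) * v / t1 ^+ 3.
Proof.
move=> t20 t21; have t10 : 0 < t1 by exact: lt_le_trans t21.
have [v0|v0] := ltP 0 v; last first.
  by rewrite !f_le0 ?mul0r//; rewrite pmulr_rle0.
have h := f4 (mulr_gt0 t20 v0) (ler_wpM2r (ltW v0) t21).
have := ler_wpM2r (ltW (exprn_gt0 4 v0)) h.
set X := f _; set Y := f _.
have -> : X / (t2 * v) ^+ 3 * v ^+ 4 = X * v / t2 ^+ 3 by field; rewrite !gt_eqF.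
by have -> : Y / (t1 * v) ^+ 3 * v ^+ 4 = Y * v / t1 ^+ 3 by field; rewrite !gt_eqF.
Qed.

(** The linear branch satisfies this with equality, and below [a] monotonicity gives more. In the
    mixed case the value at [t2] is at most the linear one, while that at [t1] equals it. *)
Lemma ftilde_fiber v t1 t2 : 0 < t2 -> t2 <= t1 ->
  ftilde f V0 K a (t2 * v) * v / t2 ^+ 3 - ftilde f V0 K a (t1 * v) * v / t1 ^+ 3 <=
  V0 / K * v ^+ 2 * (t2 ^- 2 - t1 ^- 2).
Proof.
move=> t20 t21; have t10 : 0 < t1 by exact: lt_le_trans t21.
have VK : 0 < V0 / K by rewrite divr_gt0.
have tt : 0 <= t2 ^- 2 - t1 ^- 2.
  by rewrite subr_ge0 lef_pV2 ?posrE ?exprn_gt0// ler_sqr ?nnegrE// ltW.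
have rhs0 : 0 <= V0 / K * v ^+ 2 * (t2 ^- 2 - t1 ^- 2).
  by apply: mulr_ge0 => //; apply: mulr_ge0; [exact: ltW|exact: sqr_ge0].
have [v0|v0] := ltP 0 v; last first.
  by rewrite !ftilde_le0 ?mul0r ?subrr//; rewrite pmulr_rle0.
have lin t : 0 < t -> V0 / K * (t * v) * v / t ^+ 3 = V0 / K * v ^+ 2 * t ^- 2.
  by move=> ?; field; rewrite !gt_eqF.
have up t : 0 < t -> ftilde f V0 K a (t * v) * v / t ^+ 3 <= V0 / K * v ^+ 2 * t ^- 2.
  move=> t0; rewrite -lin// ler_wpM2r ?invr_ge0 ?exprn_ge0 ?(ltW t0)//.
  rewrite ler_wpM2r ?(ltW v0)//; have := ftilde_le (t * v).
  by rewrite ger0_norm// mulr_ge0// ltW.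
have [t1a|t1a] := leP (t1 * v) a.
  have t2a : t2 * v <= a by apply: le_trans t1a; rewrite ler_wpM2r// ltW.
  by rewrite /ftilde t1a t2a; apply: le_trans rhs0; rewrite subr_le0 f_fiber.
rewrite [ftilde _ _ _ _ (t1 * v)]/ftilde [_ <= a]leNgt t1a/= lin// mulrBr lerB//.
exact: up.
Qed.

End nonlinearity.

(** * Null sets in a product *)

Section ae_product.
Context {d} {T : measurableType d} {R : realType}.
Variable m : {sigma_finite_measure set T -> \bar R}.

(** Transfers convergence almost everywhere to pairs of points, as Fatou's lemma for the seminorm
    requires. *)
Lemma ae_pair (P : T -> Prop) : {ae m, forall x, P x} ->
  {ae (m \x m)%E, forall z, P z.1 /\ P z.2}.
Proof.
move=> [N [mN N0 sN]].
have mN1 : measurable (N `*` [set: T]) by exact: measurableX.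
have mN2 : measurable ([set: T] `*` N) by exact: measurableX.
exists (N `*` setT `|` setT `*` N); split; first exact: measurableU.
- apply/eqP; rewrite eq_le measure_ge0 andbT.
  apply: le_trans (measureU2 _ mN1 mN2) _.
  by rewrite /= !product_measure1E//= -[m N]/(m N) N0 mul0e mule0 adde0.
- move=> z /= Pz; have [P1|/sN] := pselect (P z.1); last by left.
  by right; split => //; apply: sN => P2; exact: Pz.
Qed.

End ae_product.

(** * The energy space and its bilinear form *)

Section energy_space.
Context {R : realType} (s : R) (V : pt3 R -> R) (V0 eps q : R).
Hypotheses (s0 : 0 < s) (s1 : s < 1) (cV : continuous V)
  (V0V : forall x, V0 <= V x) (V00 : 0 < V0).
Hypotheses (q2 : 2 <= q) (qp : q < pstar s).
Local Notation mu3 := (@leb3 R).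
Local Notation mu6 := (@leb6 R).
Local Notation H := (in_Heps s V eps).
Local Notation A := (normeps2 s V eps).
Implicit Types (u v w : pt3 R -> R).

Definition Veps (x : pt3 R) : R := V (scale3 eps x).
Definition diff2 u (z : pt3 R * pt3 R) : R := u z.1 - u z.2.

Lemma measurable_Veps : measurable_fun setT Veps.
Proof.
exact: (measurableT_comp (continuous_measurable3 cV) (measurable_scale3 eps)).
Qed.

Lemma Veps_ge0 x : 0 <= Veps x.
Proof. by apply: le_trans (V0V _); exact: ltW. Qed.

Lemma measurable_diff2 u : measurable_fun setT u -> measurable_fun setT (diff2 u).
Proof.
move=> mu; apply: measurable_funB.
- exact: measurable_comp_fst.
- exact: measurable_comp_snd.
Qed.

Lemma H_measurable u : H u -> measurable_fun setT u.
Proof. by case. Qed.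

Lemma H_kern u : H u -> Rintegrable mu6 (fun z => kern s z * diff2 u z ^+ 2).
Proof.
case=> mu _ gu _; have mg := measurable_gagliardo s mu.
have : Rintegrable mu6 (fun z => (u z.1 - u z.2) ^+ 2 * kern s z).
  apply: Rintegrable_ge0_lty => //.
  by move=> z; rewrite mulr_ge0 ?sqr_ge0 ?kern_ge0.
by apply: eq_integrableR => // z _; rewrite mulrC.
Qed.

Lemma H_V u : H u -> Rintegrable mu3 (fun x => Veps x * u x ^+ 2).
Proof.
case=> mu _ _ Vu; apply: Rintegrable_ge0_lty => //.
- by apply: measurable_funM; [exact: measurable_Veps|exact: measurable_funX].
- by move=> x; rewrite mulr_ge0 ?sqr_ge0 ?Veps_ge0.
Qed.

Lemma H_sqr u : H u -> Rintegrable mu3 (fun x => u x ^+ 2).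
Proof.
case=> mu lu _ _; apply: Rintegrable_ge0_lty => //; first exact: measurable_funX.
by move=> x; exact: sqr_ge0.
Qed.

(** The seminorm part and the potential part are kept apart because only the latter absorbs the
    nonlinearity in the limit. *)
Definition Agag u : R := \int[mu6]_z (kern s z * diff2 u z ^+ 2).
Definition Apot u : R := \int[mu3]_x (Veps x * u x ^+ 2).
Definition Bform u v : R := \int[mu6]_z (kern s z * (diff2 u z * diff2 v z)) +
  \int[mu3]_x (Veps x * (u x * v x)).

Lemma normeps2E u : A u = Agag u + Apot u.
Proof.
rewrite /normeps2; congr (_ + _); rewrite gagliardoE /Agag /Rintegral; congr fine.
by apply: eq_integral => z _; rewrite mulrC.
Qed.

Lemma gagliardo_Agag u : H u -> gagliardo s u = (Agag u)%:E.
Proof.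
move=> Hu; rewrite -(Rintegrable_EFin (H_kern Hu)) gagliardoE.
by apply: eq_integral => z _; rewrite mulrC.
Qed.

Lemma Vsq_Apot u : H u -> Vsq V eps u = (Apot u)%:E.
Proof. by move=> Hu; rewrite -(Rintegrable_EFin (H_V Hu)). Qed.

Lemma Agag_ge0 u : 0 <= Agag u.
Proof. by apply: Rintegral_ge0 => z _; rewrite mulr_ge0 ?sqr_ge0 ?kern_ge0. Qed.

Lemma Apot_ge0 u : 0 <= Apot u.
Proof. by apply: Rintegral_ge0 => z _; rewrite mulr_ge0 ?sqr_ge0 ?Veps_ge0. Qed.

Lemma A_ge0 u : 0 <= A u.
Proof. by rewrite normeps2E addr_ge0 ?Agag_ge0 ?Apot_ge0. Qed.

(** As [V >= V0 > 0], the potential integral already controls the integral of [u^2]. *)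
Lemma in_H u : measurable_fun setT u -> (gagliardo s u < +oo)%E ->
  (Vsq V eps u < +oo)%E -> H u.
Proof.
move=> mu gu Vu; split => //; have m2 := measurable_funX 2 mu.
have mV : measurable_fun setT (fun x => V0^-1 * (Veps x * u x ^+ 2)).
  by apply: measurable_funM => //; apply: measurable_funM => //; exact: measurable_Veps.
apply: (@le_lt_trans _ _ (\int[mu3]_x (V0^-1 * (Veps x * u x ^+ 2))%:E)%E).
  apply: ge0_le_integral => //.
  - by move=> x _; rewrite lee_fin sqr_ge0.
  - exact/measurable_EFinP.
  - exact/measurable_EFinP.
  - move=> x _; rewrite lee_fin mulrA ler_peMl ?sqr_ge0//.
    by rewrite ler_pdivlMl// mulr1; exact: V0V.
have Vi : Rintegrable mu3 (fun x => Veps x * u x ^+ 2).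
  apply: Rintegrable_ge0_lty => //.
  - by apply: measurable_funM; [exact: measurable_Veps|exact: measurable_funX].
  - by move=> x; rewrite mulr_ge0 ?sqr_ge0 ?Veps_ge0.
by rewrite (Rintegrable_EFin (RintegrableZ V0^-1 Vi)) ltry.
Qed.

Lemma in_H_Rintegrable u : measurable_fun setT u ->
  Rintegrable mu6 (fun z => kern s z * diff2 u z ^+ 2) ->
  Rintegrable mu3 (fun x => Veps x * u x ^+ 2) -> H u.
Proof.
move=> mu gu Vu; apply: in_H => //.
  have -> : gagliardo s u = (\int[mu6]_z (kern s z * diff2 u z ^+ 2)%:E)%E.
    by rewrite gagliardoE; apply: eq_integral => z _; rewrite mulrC.
  by rewrite (Rintegrable_EFin gu) ltry.
by rewrite -[X in (X < _)%E]/(\int[mu3]_x (Veps x * u x ^+ 2)%:E)%E (Rintegrable_EFin Vu) ltry.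
Qed.

Let diff2_lin a b u v : diff2 (fun x => a * u x + b * v x) =
  fun z => a * diff2 u z + b * diff2 v z.
Proof. by apply/funext => z; rewrite /diff2; ring. Qed.

Lemma H_lin a b u v : H u -> H v -> H (fun x => a * u x + b * v x).
Proof.
move=> Hu Hv; have mu := H_measurable Hu; have mv := H_measurable Hv.
apply: in_H_Rintegrable.
- by apply: measurable_funD; exact: measurable_funM.
- rewrite diff2_lin; apply: Rintegrable_sqr_lin (H_kern Hu) (H_kern Hv).
  + exact: measurable_kern.
  + exact: kern_ge0.
  + exact: measurable_diff2.
  + exact: measurable_diff2.
- apply: Rintegrable_sqr_lin (H_V Hu) (H_V Hv) => //.
  + exact: measurable_Veps.
  + exact: Veps_ge0.
Qed.

Lemma A_lin a b u v : H u -> H v -> A (fun x => a * u x + b * v x) =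
  a ^+ 2 * A u + 2 * a * b * Bform u v + b ^+ 2 * A v.
Proof.
move=> Hu Hv; have mu := H_measurable Hu; have mv := H_measurable Hv.
rewrite !normeps2E /Agag /Apot diff2_lin.
have -> : \int[mu6]_z (kern s z * (a * diff2 u z + b * diff2 v z) ^+ 2) =
    a ^+ 2 * Agag u + 2 * a * b * \int[mu6]_z (kern s z * (diff2 u z * diff2 v z)) +
    b ^+ 2 * Agag v.
  apply: Rint_sqr_lin (H_kern Hu) (H_kern Hv).
  - exact: measurable_kern.
  - exact: kern_ge0.
  - exact: measurable_diff2.
  - exact: measurable_diff2.
have -> : \int[mu3]_x (Veps x * (a * u x + b * v x) ^+ 2) =
    a ^+ 2 * Apot u + 2 * a * b * \int[mu3]_x (Veps x * (u x * v x)) +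
    b ^+ 2 * Apot v.
  apply: Rint_sqr_lin (H_V Hu) (H_V Hv) => //.
  - exact: measurable_Veps.
  - exact: Veps_ge0.
by rewrite /Bform /Agag /Apot; ring.
Qed.

Lemma Bform_lin a b u v w : H u -> H v -> H w ->
  Bform (fun x => a * u x + b * v x) w = a * Bform u w + b * Bform v w.
Proof.
move=> Hu Hv Hw; have mu := H_measurable Hu; have mv := H_measurable Hv.
have mw := H_measurable Hw; rewrite /Bform diff2_lin.
have -> : \int[mu6]_z (kern s z * ((a * diff2 u z + b * diff2 v z) * diff2 w z)) =
    a * \int[mu6]_z (kern s z * (diff2 u z * diff2 w z)) +
    b * \int[mu6]_z (kern s z * (diff2 v z * diff2 w z)).
  apply: Rint_mul_lin (H_kern Hu) (H_kern Hv) (H_kern Hw).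
  - exact: measurable_kern.
  - exact: kern_ge0.
  - exact: measurable_diff2.
  - exact: measurable_diff2.
  - exact: measurable_diff2.
have -> : \int[mu3]_x (Veps x * ((a * u x + b * v x) * w x)) =
    a * \int[mu3]_x (Veps x * (u x * w x)) + b * \int[mu3]_x (Veps x * (v x * w x)).
  apply: Rint_mul_lin (H_V Hu) (H_V Hv) (H_V Hw) => //.
  - exact: measurable_Veps.
  - exact: Veps_ge0.
by ring.
Qed.

Lemma Bform_sym u v : Bform u v = Bform v u.
Proof.
by rewrite /Bform; congr (_ + _); apply: eq_Rintegral => x _; rewrite [X in _ * X]mulrC.
Qed.

Lemma Bform_self u : Bform u u = A u.
Proof. by rewrite normeps2E. Qed.

Lemma H_scale a u : H u -> H (fun x => a * u x).
Proof.
move=> Hu; rewrite (_ : (fun x => _) = fun x => a * u x + 0 * u x); first exact: H_lin.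
by apply/funext => x; rewrite mul0r addr0.
Qed.

Lemma A_scale a u : H u -> A (fun x => a * u x) = a ^+ 2 * A u.
Proof.
move=> Hu; rewrite (_ : (fun x => _) = fun x => a * u x + 0 * u x).
  by rewrite A_lin// mulr0 mul0r expr0n/= !mul0r !addr0.
by apply/funext => x; rewrite mul0r addr0.
Qed.

Lemma Bform_scale a u w : H u -> H w -> Bform (fun x => a * u x) w = a * Bform u w.
Proof.
move=> Hu Hw; rewrite (_ : (fun x => _) = fun x => a * u x + 0 * u x).
  by rewrite Bform_lin// mul0r addr0.
by apply/funext => x; rewrite mul0r addr0.
Qed.

Lemma A_ge_sqr u : H u -> V0 * \int[mu3]_x (u x ^+ 2) <= A u.
Proof.
move=> Hu; rewrite normeps2E -RintZ; last exact: H_sqr.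
rewrite -[leLHS]add0r lerD ?Agag_ge0//.
apply: Rint_le; [exact: RintegrableZ (H_sqr Hu)|exact: H_V|].
by move=> x; rewrite ler_wpM2r ?sqr_ge0// V0V.
Qed.

Lemma L2sq_Rint u : H u -> L2sq u = (\int[mu3]_x (u x ^+ 2))%:E.
Proof. by move=> Hu; rewrite -(Rintegrable_EFin (H_sqr Hu)). Qed.

Lemma nontrivial_A_gt0 u : H u -> nontrivial u -> 0 < A u.
Proof.
move=> Hu nu; rewrite lt_neqAle A_ge0 andbT; apply/negP => /eqP A0; apply: nu.
have I0 : \int[mu3]_x (u x ^+ 2) = 0.
  apply/eqP; rewrite eq_le; apply/andP; split.
    by rewrite -(pmulr_rle0 _ V00) A0 A_ge_sqr.
  by apply: Rintegral_ge0 => x _; exact: sqr_ge0.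
have m2 := measurable_funX 2 (H_measurable Hu).
have := L2sq_Rint Hu; rewrite I0 /L2sq => I0'.
have me : measurable_fun setT (fun x => (u x ^+ 2)%:E) by exact/measurable_EFinP.
have [h _] := @ae_eq_integral_abs _ _ _ mu3 setT measurableT _ me.
have {h}/h : (\int[mu3]_x `|(u x ^+ 2)%:E| = 0)%E.
  by rewrite -[RHS]I0'; apply: eq_integral => x _; rewrite gee0_abs ?lee_fin ?sqr_ge0.
by apply: ae_imp => x /(_ I)[/eqP]; rewrite sqrf_eq0 => /eqP.
Qed.

Lemma energy_sobolev : exists2 C : R, 0 < C & forall u r, H u -> 0 < r ->
  A u <= r ^+ 2 -> Rintegrable mu3 (fun x => `|u x| `^ q) /\
  \int[mu3]_x (`|u x| `^ q) <= C * r `^ q.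
Proof.
have [C C0 hC] := sobolev s0 s1 q2 qp.
(* With this [m], the length [m * r] bounds both the seminorm and the [L^2] norm of [u]. *)
pose m := Num.max 1 (Num.sqrt V0^-1).
have m1 : 1 <= m by rewrite le_max lexx.
have m0 : 0 < m by lra.
have mV : V0^-1 <= m ^+ 2.
  rewrite -[leLHS]sqr_sqrtr ?invr_ge0 ?(ltW V00)// ler_sqr ?nnegrE ?sqrtr_ge0 ?(ltW m0)//.
  by rewrite le_max lexx orbT.
exists (C * m `^ q); first by rewrite mulr_gt0// powR_gt0.
move=> u r Hu r0 Ar; have mu := H_measurable Hu.
have mr0 : 0 < m * r by rewrite mulr_gt0.
have := hC u (m * r) mu mr0; rewrite (gagliardo_Agag Hu) (L2sq_Rint Hu) !lee_fin.
have r2 : 0 <= r ^+ 2 by exact: sqr_ge0.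
move=> /(_ _ _)/wrap[||hI].
- rewrite exprMn; apply: (@le_trans _ _ (r ^+ 2)).
    by apply: le_trans Ar; rewrite normeps2E lerDl Apot_ge0.
  by rewrite ler_peMl ?sqr_ge0// exprn_ege1.
- have := le_trans (A_ge_sqr Hu) Ar; rewrite -ler_pdivlMl// => h.
  by apply: le_trans h _; rewrite exprMn ler_wpM2r.
have Ii : Rintegrable mu3 (fun x => `|u x| `^ q).
  apply: Rintegrable_ge0_lty.
  - apply: (measurableT_comp (measurable_powR _)); exact: measurableT_comp.
  - by move=> x; exact: powR_ge0.
  - exact: le_lt_trans hI (ltry _).
split => //; rewrite -lee_fin -Rintegrable_EFin//.
by apply: le_trans hI _; rewrite lee_fin powRM ?mulrA// ltW.
Qed.

Lemma H_L2q u : H u -> in_L2q mu3 q u.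
Proof.
move=> Hu; have [C _ hC] := energy_sobolev.
have r0 : 0 < A u + 1 by rewrite ltr_wpDl ?A_ge0.
have Ar : A u <= (A u + 1) ^+ 2 by have := A_ge0 u; nra.
have [Ii _] := hC u (A u + 1) Hu r0 Ar.
by split => //; [exact: H_measurable|exact: H_sqr].
Qed.

Definition pospart u (x : pt3 R) : R := Num.max 0 (u x).

Lemma pospart_ge0 u x : 0 <= pospart u x.
Proof. by rewrite le_max lexx. Qed.

(** The positive part is [1]-Lipschitz. *)
Lemma pospart_diff u z : diff2 (pospart u) z ^+ 2 <= diff2 u z ^+ 2.
Proof.
rewrite /diff2 /pospart; case: (leP 0 (u z.1)) => h1; case: (leP 0 (u z.2)) => h2 //;
  rewrite ?subrr ?expr0n/= ?sqr_ge0//; nra.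
Qed.

Lemma pospart_sqr u x : pospart u x ^+ 2 <= u x ^+ 2.
Proof. by rewrite /pospart; case: (leP 0 (u x)) => // h; rewrite expr0n/= sqr_ge0. Qed.

Lemma H_pospart u : H u -> H (pospart u) /\ A (pospart u) <= A u.
Proof.
move=> Hu; have mu := H_measurable Hu.
have mp : measurable_fun setT (pospart u) by exact: measurable_maxr.
have g1 : Rintegrable mu6 (fun z => kern s z * diff2 (pospart u) z ^+ 2).
  apply: le_Rintegrable (H_kern Hu).
    apply: measurable_funM; first exact: measurable_kern.
    by apply: measurable_funX; exact: measurable_diff2.
  move=> z; rewrite ger0_norm ?(mulr_ge0 (kern_ge0 _ _) (sqr_ge0 _))//.
  by rewrite ler_wpM2l ?kern_ge0// pospart_diff.
have V1 : Rintegrable mu3 (fun x => Veps x * pospart u x ^+ 2).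
  apply: le_Rintegrable (H_V Hu).
    by apply: measurable_funM; [exact: measurable_Veps|exact: measurable_funX].
  move=> x; rewrite ger0_norm ?(mulr_ge0 (Veps_ge0 _) (sqr_ge0 _))//.
  by rewrite ler_wpM2l ?Veps_ge0// pospart_sqr.
split; first exact: in_H_Rintegrable.
rewrite !normeps2E lerD//; apply: Rint_le => //.
- exact: H_kern.
- by move=> z; rewrite ler_wpM2l ?kern_ge0// pospart_diff.
- exact: H_V.
- by move=> x; rewrite ler_wpM2l ?Veps_ge0// pospart_sqr.
Qed.

(** Fatou's lemma applied to each part of the energy on its own; it takes the place of weak lower
    semicontinuity. *)
Lemma H_ae_cvg (u : nat -> pt3 R -> R) v (g p : R) : (forall n, H (u n)) ->
  measurable_fun setT v -> {ae mu3, forall x, u n x @[n --> \oo] --> v x} ->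
  Agag (u n) @[n --> \oo] --> g -> Apot (u n) @[n --> \oo] --> p ->
  [/\ H v, Agag v <= g & Apot v <= p].
Proof.
move=> Hu mv uv cg cp.
have mu n := H_measurable (Hu n).
have VE w : (\int[mu3]_x (Veps x * w x ^+ 2)%:E)%E = Vsq V eps w by [].
have Vp : (Vsq V eps v <= p%:E)%E.
  rewrite -VE; apply: (@fatou_real _ _ _ mu3 (fun n x => Veps x * u n x ^+ 2)
    (fun x => Veps x * v x ^+ 2) (fun n => Apot (u n)) p) => //.
  - move=> n; apply: measurable_funM; first exact: measurable_Veps.
    exact: (measurable_funX 2 (mu n)).
  - by apply: measurable_funM; [exact: measurable_Veps|exact: measurable_funX].
  - by move=> n x; rewrite (mulr_ge0 (Veps_ge0 _) (sqr_ge0 _)).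
  - by move=> x; rewrite (mulr_ge0 (Veps_ge0 _) (sqr_ge0 _)).
  - apply: ae_imp uv => x ux; apply: cvgM; first exact: cvg_cst.
    by rewrite !expr2; exact: cvgM.
  - by move=> n; rewrite VE Vsq_Apot.
have Gg : (gagliardo s v <= g%:E)%E.
  rewrite gagliardoE; apply: (@fatou_real _ _ _ mu6
    (fun n z => (u n z.1 - u n z.2) ^+ 2 * kern s z)
    (fun z => (v z.1 - v z.2) ^+ 2 * kern s z) (fun n => Agag (u n)) g) => //.
  - by move=> n; exact: measurable_gagliardo.
  - exact: measurable_gagliardo.
  - by move=> n z; rewrite (mulr_ge0 (sqr_ge0 _) (kern_ge0 _ _)).
  - by move=> z; rewrite (mulr_ge0 (sqr_ge0 _) (kern_ge0 _ _)).
  - apply: ae_imp (ae_pair uv) => z [z1 z2].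
    by apply: cvgM; [rewrite !expr2; apply: cvgM; exact: cvgB|exact: cvg_cst].
  - by move=> n; rewrite -gagliardoE gagliardo_Agag.
have Hv : H v by apply: in_H => //; [exact: le_lt_trans Gg (ltry _)|exact: le_lt_trans Vp (ltry _)].
split => //; first by rewrite -lee_fin -gagliardo_Agag.
by rewrite -lee_fin -Vsq_Apot.
Qed.

End energy_space.

(** * Sequences of real numbers *)

Section real_sequences.
Context {R : realType}.

Lemma cvg_norm_powR (q : R) (w : nat -> R) (z : R) : 1 <= q ->
  w n @[n --> \oo] --> z -> `|w n| `^ q @[n --> \oo] --> `|z| `^ q.
Proof.
move=> q1 wz; have nwz : `|w n| @[n --> \oo] --> `|z| by exact: cvg_norm.
have q0 : 0 < q by lra.
(* The differentiability of the power covers positive bases; at [0] the bound [y^q <= y] for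
   [0 <= y <= 1] is used instead. *)
have [z0|z0] := eqVneq z 0.
  move: nwz; rewrite z0 normr0 powR0 ?gt_eqF// => nwz.
  have /cvgr_lt/(_ 1 ltr01) w1 := nwz.
  apply: (squeeze_cvgr (f := cst 0) (h := fun n => `|w n|)) nwz; last exact: cvg_cst.
  near=> n; rewrite powR_ge0/=; have := normr_ge0 (w n).
  rewrite le_eqVlt => /predU1P[<-|w0]; first by rewrite powR0 ?gt_eqF.
  by apply: ge1r_powR => //; rewrite w0/= ltW//; near: n.
have dz : {for `|z|, continuous (@powR R ^~ q)}.
  apply: differentiable_continuous; apply/derivable1_diffP.
  by apply: derivable_powR; rewrite in_itv/= andbT normr_gt0.
exact: (cvg_comp _ _ nwz dz).
Unshelve. all: by end_near. Qed.

(** [phi] may fail to be increasing: [k <= phi k] already sends it to infinity. *)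
Lemma cvg_subseq (x : nat -> R) (l : R) (phi : nat -> nat) : (forall k, (k <= phi k)%N) ->
  x n @[n --> \oo] --> l -> x (phi k) @[k --> \oo] --> l.
Proof.
move=> hphi xl; apply: (cvg_comp phi x) xl; apply/cvgnyPge => N.
near=> n; apply: leq_trans (hphi n); near: n; exact: nbhs_infty_ge.
Unshelve. all: by end_near. Qed.

Lemma bounded_pair_subseq (x y : nat -> R) (B : R) :
  (forall n, `|x n| <= B) -> (forall n, `|y n| <= B) ->
  exists (phi : nat -> nat) (l m : R), [/\ forall k, (k <= phi k)%N,
    x (phi k) @[k --> \oo] --> l & y (phi k) @[k --> \oo] --> m].
Proof.
move=> xB yB; have [U [UU oU]] := @ultraFilterLemma nat \oo _.
have [l hl] := bounded_ultra_cvg UU xB; have [m hm] := bounded_ultra_cvg UU yB.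
have ex k : exists n, [/\ (k <= n)%N, `|x n - l| < k.+1%:R^-1 & `|y n - m| < k.+1%:R^-1].
  have k0 : 0 < k.+1%:R^-1 :> R by rewrite invr_gt0.
  have Uk : U [set n | (k <= n)%N] by apply: oU; exact: nbhs_infty_ge.
  have Uklm : U ([set n | (k <= n)%N] `&`
      ([set n | `|x n - l| < k.+1%:R^-1] `&` [set n | `|y n - m| < k.+1%:R^-1])).
    by apply: filterI => //; apply: filterI; [exact: hl|exact: hm].
  by have /filter_ex[n [/= ? [? ?]]] := Uklm; exists n.
have [phi hphi] := choice ex; exists phi, l, m; split.
- by move=> k; have [] := hphi k.
- apply/cvgrPdist_lt => e e0; near=> k; have [_ h _] := hphi k.
  rewrite distrC; apply: lt_trans h _; near: k; exact: near_infty_natSinv_lt (PosNum e0).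
- apply/cvgrPdist_lt => e e0; near=> k; have [_ _ h] := hphi k.
  rewrite distrC; apply: lt_trans h _; near: k; exact: near_infty_natSinv_lt (PosNum e0).
Unshelve. all: by end_near. Qed.

End real_sequences.

(** * The energy functional and its derivative along lines *)

Section energy_functional.
Context {R : realType} (s : R) (M : R -> R) (m0 : R) (V : pt3 R -> R) (V0 : R)
  (f : R -> R) (Omega : set (pt3 R)) (K a eps q th : R).
Hypotheses (s0 : 0 < s) (s1 : s < 1).
Hypotheses (cM : {within [set t : R | 0 <= t], continuous M}) (m00 : 0 < m0)
  (M1 : forall t, 0 <= t -> m0 <= M t)
  (M3 : forall t1 t2, 0 < t2 -> t2 <= t1 ->
     M t1 / t1 - M t2 / t2 <= m0 * (1 / t1 - 1 / t2)).
Hypotheses (cV : continuous V) (V0V : forall x, V0 <= V x) (V00 : 0 < V0).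
Hypotheses (cf : continuous f) (fneg : forall t, t < 0 -> f t = 0).
Hypotheses (q4 : 4 < q) (qp : q < pstar s)
  (f2 : f t / t `^ (q - 1) @[t --> +oo] --> 0).
Hypotheses (th4 : 4 < th)
  (f3 : forall t, 0 < t -> 0 < th * int0 f t /\ th * int0 f t <= f t * t).
Hypothesis f4 : forall t1 t2, 0 < t1 -> t1 <= t2 ->
  f t1 / t1 ^+ 3 <= f t2 / t2 ^+ 3.
Hypothesis oOmega : open Omega.
Hypotheses (Km : 2 / m0 < K) (a0 : 0 < a) (fa : f a = V0 / K * a).

Local Notation mu3 := (@leb3 R).
Local Notation H := (in_Heps s V eps).
Local Notation A := (normeps2 s V eps).
Local Notation B := (Bform s V eps).
Local Notation Me := (even_ext M).
Local Notation ft := (ftilde f V0 K a).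
Local Notation J := (Jeps s M V Omega f V0 K a eps).
Implicit Types (u v w p : pt3 R -> R).

Let K0 : 0 < K.
Proof. by apply: lt_trans Km; rewrite divr_gt0. Qed.

Let K_inv : K^-1 < m0 / 2.
Proof. by rewrite -[ltRHS]invrK ltf_pV2 ?posrE ?invr_gt0 ?divr_gt0// invf_div. Qed.

Let A0 w : 0 <= A w.
Proof. exact: (A_ge0 _ _ V0V V00). Qed.

Let q2 : 2 <= q. Proof. by move: q4; lra. Qed.

Definition in_Om (x : pt3 R) : Prop := Omega (scale3 eps x).
Definition gx (x : pt3 R) (t : R) : R := gfun Omega f V0 K a (scale3 eps x) t.
Definition Gx (x : pt3 R) (t : R) : R := Gfun Omega f V0 K a (scale3 eps x) t.
Definition chi (x : pt3 R) : R := \1_Omega (scale3 eps x).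

Lemma measurable_chi : measurable_fun setT chi.
Proof. by apply: measurable_indic_scale; exact: open_measurable3. Qed.

(** Destructing [gxP x] replaces [chi x] by [1] or [0] in the goal and identifies [gx x] and [Gx x]
    with the branch in force. *)
Variant gx_spec x : R -> Prop :=
| Gx_in of in_Om x & gx x = f & Gx x = int0 f : gx_spec x 1
| Gx_out of ~ in_Om x & gx x = ft & Gx x = int0 ft : gx_spec x 0.

Lemma gxP x : gx_spec x (chi x).
Proof.
rewrite /chi indicE; have [Ox|Ox] := pselect (Omega (scale3 eps x)).
  have E : gx x = f.
    by apply/funext => t; rewrite /gx /gfun indicE mem_set//= mul1r subrr mul0r addr0.
  rewrite mem_set//; apply: Gx_in => //; apply/funext => t.
  by rewrite /Gx /Gfun -[X in int0 X]/(gx x) E.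
have E : gx x = ft.
  by apply/funext => t; rewrite /gx /gfun indicE memNset//= mul0r subr0 mul1r add0r.
rewrite memNset//; apply: Gx_out => //; apply/funext => t.
by rewrite /Gx /Gfun -[X in int0 X]/(gx x) E.
Qed.

Let cft : continuous ft := @continuous_ftilde _ _ _ _ _ (@cf) fa.
Let ftle0 t : t <= 0 -> ft t = 0 := @ftilde_le0 _ _ V0 K _ (@cf) fneg a0 t.
Let fle0 t : t <= 0 -> f t = 0 := @f_le0 _ _ (@cf) fneg t.

Lemma continuous_gx x : continuous (gx x).
Proof. by case: (gxP x) => _ -> _; [exact: cf|exact: cft]. Qed.

Lemma is_derive_Gx x (t : R) : is_derive t (1 : R) (Gx x) (gx x t).
Proof. by case: (gxP x) => _ -> ->; apply: is_derive_int0. Qed.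

Lemma Gx0 x : Gx x 0 = 0.
Proof. exact: int00. Qed.

Lemma gx_ge0 x t : 0 <= gx x t.
Proof.
case: (gxP x) => _ -> _; first exact: (f_ge0 (@cf) fneg f3).
exact: (ftilde_ge0 (@cf) fneg f3).
Qed.

Lemma gx_le0 x t : t <= 0 -> gx x t = 0.
Proof. by move=> t0; case: (gxP x) => _ -> _; [exact: fle0|exact: ftle0]. Qed.

Lemma gx_mul_ge0 x t r : 0 < r -> 0 <= gx x (r * t) * t.
Proof.
move=> r0; have [t0|t0] := leP 0 t; first by rewrite mulr_ge0 ?gx_ge0.
by rewrite gx_le0 ?mul0r// pmulr_rle0// ltW.
Qed.

Lemma gx_growth : exists2 C : R, 0 <= C &
  forall x t, `|gx x t| <= C * (`|t| + `|t| `^ (q - 1)).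
Proof.
have [C C0 hC] := f_growth (@cf) fneg q4 (@f2) f3 f4 ltr01.
have VK : 0 <= V0 / K by rewrite divr_ge0 ?ltW.
exists (1 + C + V0 / K); first by rewrite !addr_ge0.
move=> x t; have n0 := normr_ge0 t; have p0 := powR_ge0 `|t| (q - 1).
have nt : 0 <= `|t| + `|t| `^ (q - 1) by rewrite addr_ge0.
case: (gxP x) => _ -> _.
  by apply: le_trans (hC t) _; rewrite mul1r !mulrDl; nra.
rewrite (ger0_norm (ftilde_ge0 (@cf) fneg f3 V00 K0 a0 t)).
apply: le_trans (ftilde_le (@cf) fneg f4 V00 K0 a0 fa t) _.
by rewrite !mulrDl; nra.
Qed.

Lemma continuous_int0 (h : R -> R) : continuous h -> continuous (int0 h).
Proof.
move=> ch t; apply: differentiable_continuous; apply/derivable1_diffP.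
by have [] := is_derive_int0 t ch.
Qed.

Lemma measurable_gx w : measurable_fun setT w -> measurable_fun setT (fun x => gx x (w x)).
Proof.
move=> mw; apply: measurable_funD; apply: measurable_funM.
- exact: measurable_chi.
- exact: measurableT_comp (continuous_measurable_fun (@cf)) mw.
- by apply: measurable_funB => //; exact: measurable_chi.
- exact: measurableT_comp (continuous_measurable_fun (@cft)) mw.
Qed.

Lemma GxE x t : Gx x t = chi x * int0 f t + (1 - chi x) * int0 ft t.
Proof.
by case: (gxP x) => _ _ ->; rewrite ?subrr ?subr0 !(mul1r, mul0r) ?addr0 ?add0r.
Qed.

Lemma measurable_Gx w : measurable_fun setT w -> measurable_fun setT (fun x => Gx x (w x)).
Proof.
move=> mw; under eq_fun do rewrite GxE.
apply: measurable_funD; apply: measurable_funM.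
- exact: measurable_chi.
- exact: measurableT_comp (continuous_measurable_fun (continuous_int0 (@cf))) mw.
- by apply: measurable_funB => //; exact: measurable_chi.
- exact: measurableT_comp (continuous_measurable_fun (continuous_int0 (@cft))) mw.
Qed.

Lemma Gx_integrable u : H u -> Rintegrable mu3 (fun x => Gx x (u x)).
Proof.
move=> Hu; have [C C0 hC] := gx_growth.
apply: (@nemytskii_integrable _ _ _ mu3 Gx gx C q) => //.
- exact: Gx0.
- exact: is_derive_Gx.
- exact: measurable_Gx.
- exact: H_L2q Hu.
Qed.

Lemma gx_integrable u p : H u -> H p -> Rintegrable mu3 (fun x => gx x (u x) * p x).
Proof.
move=> Hu Hp; have [C C0 hC] := gx_growth.
apply: (@nemytskii_pairing_integrable _ _ _ mu3 gx C q) => //.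
- exact: measurable_gx.
- exact: H_L2q Hu.
- exact: H_L2q Hp.
Qed.

(** The derivative [J'(u) p], as [J_derive] shows; the factor [2^-1] in [J] cancels the [2] that
    differentiating [A] produces. *)
Definition Dform u p : R := Me (A u) * B u p - \int[mu3]_x (gx x (u x) * p x).

Lemma JE u : J u = 2^-1 * int0 Me (A u) - \int[mu3]_x Gx x (u x).
Proof. by rewrite /Jeps int0_even_ext//; exact: A_ge0. Qed.

(** Along a line [A] is the quadratic polynomial [P], and the nonlinear part is differentiated under
    the integral. *)
Lemma J_derive u p (t : R) : H u -> H p ->
  is_derive t (1 : R) (fun t : R => J (fun x => u x + t * p x))
    (Dform (fun x => u x + t * p x) p).
Proof.
move=> Hu Hp; have [C C0 hC] := gx_growth.
have up z : (fun x => u x + z * p x) = fun x => 1 * u x + z * p x.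
  by apply/funext => x; rewrite mul1r.
pose P (z : R) : R := A u + (2 * B u p * z + A p * (z * z)).
have AP z : A (fun x => u x + z * p x) = P z.
  by rewrite up (A_lin (@cV) V0V V00)// /P; ring.
have dP : is_derive t (1 : R) P (2 * B u p + 2 * A p * t).
  by rewrite /P; apply: is_derive_eq; rewrite /GRing.scale/=; ring.
have dMP : is_derive t (1 : R) (fun z => 2^-1 * int0 Me (P z))
    (2^-1 * (Me (P t) * (2 * B u p + 2 * A p * t))).
  have d1 := @is_derive1_comp R (int0 Me) P t _ _
    (is_derive_int0_even_ext cM (P t)) dP.
  exact: (@is_deriveZ _ _ _ (int0 Me \o P) 2^-1 t 1 _ d1).
have dG : is_derive t (1 : R) (fun z : R => \int[mu3]_x Gx x (u x + z * p x))
    (\int[mu3]_x (gx x (u x + t * p x) * p x)).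
  apply: (@nemytskii_derive _ _ _ mu3 Gx gx C q) => //.
  - exact: Gx0.
  - exact: is_derive_Gx.
  - exact: measurable_Gx.
  - exact: H_L2q Hu.
  - exact: H_L2q Hp.
have -> : (fun z : R => J (fun x => u x + z * p x)) =
    fun z => 2^-1 * int0 Me (P z) - \int[mu3]_x Gx x (u x + z * p x).
  by apply/funext => z; rewrite JE AP.
rewrite /Dform AP up (Bform_lin (@cV) V0V V00)// Bform_self mul1r.
have -> : Me (P t) * (B u p + t * A p) =
    2^-1 * (Me (P t) * (2 * B u p + 2 * A p * t)) by field.
exact: is_deriveB dMP dG.
Qed.

(** Continuity of the derivative on the plane spanned by two fixed functions, by dominated
    convergence; the arguments on rays and perturbed rays use exactly this. *)
Lemma Dform_cvg u v p (b c : nat -> R) (lb lc : R) : H u -> H v -> H p ->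
  b n @[n --> \oo] --> lb -> c n @[n --> \oo] --> lc ->
  Dform (fun x => b n * u x + c n * v x) p @[n --> \oo] -->
  Dform (fun x => lb * u x + lc * v x) p.
Proof.
move=> Hu Hv Hp cb cc; have [C C0 hC] := gx_growth.
rewrite /Dform; apply: cvgB; last first.
  apply: (@nemytskii_cvg _ _ _ mu3 gx C q) => //.
  - exact: continuous_gx.
  - exact: measurable_gx.
  - exact: H_L2q Hu.
  - exact: H_L2q Hv.
  - exact: H_L2q Hp.
have cA : A (fun x => b n * u x + c n * v x) @[n --> \oo] -->
    A (fun x => lb * u x + lc * v x).
  rewrite (A_lin (@cV) V0V V00)//; under eq_fun do rewrite (A_lin (@cV) V0V V00)//.
  rewrite !expr2; under eq_fun do rewrite !expr2.
  apply: cvgD; first apply: cvgD.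
  - by apply: cvgM; [exact: cvgM|exact: cvg_cst].
  - by apply: cvgM; [apply: cvgM => //; apply: cvgM => //; exact: cvg_cst|exact: cvg_cst].
  - by apply: cvgM; [exact: cvgM|exact: cvg_cst].
apply: cvgM; first by apply: (cvg_comp _ _ cA); exact: continuous_even_ext.
rewrite (Bform_lin (@cV) V0V V00)//; under eq_fun do rewrite (Bform_lin (@cV) V0V V00)//.
by apply: cvgD; apply: cvgM => //; exact: cvg_cst.
Qed.

Lemma Dform_lin u v w (b c : R) : H u -> H v -> H w ->
  Dform w (fun x => b * u x + c * v x) = b * Dform w u + c * Dform w v.
Proof.
move=> Hu Hv Hw; rewrite /Dform [B w _]Bform_sym (Bform_lin (@cV) V0V V00)//.
have -> : \int[mu3]_x (gx x (w x) * (b * u x + c * v x)) =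
    b * \int[mu3]_x (gx x (w x) * u x) + c * \int[mu3]_x (gx x (w x) * v x).
  rewrite -RintZ; last exact: gx_integrable.
  rewrite -RintZ; last exact: gx_integrable.
  rewrite -RintD; [|apply: RintegrableZ; exact: gx_integrable..].
  by apply: eq_Rintegral => x _; ring.
by rewrite [B u w]Bform_sym [B v w]Bform_sym; ring.
Qed.

Lemma Dform_scale t u : H u ->
  Dform (fun x => t * u x) u =
  Me (t ^+ 2 * A u) * (t * A u) - \int[mu3]_x (gx x (t * u x) * u x).
Proof.
move=> Hu; rewrite /Dform (A_scale (@cV) V0V V00)//.
by rewrite (Bform_scale (@cV) V0V V00)// Bform_self.
Qed.

Lemma Dform_mulr t u w : H u -> H w ->
  Dform w (fun x => t * u x) = t * Dform w u.
Proof.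
move=> Hu Hw; rewrite (_ : (fun x => _) = fun x => t * u x + 0 * u x).
  by rewrite Dform_lin// mul0r addr0.
by apply/funext => x; rewrite mul0r addr0.
Qed.

Lemma Dform_ray_cvg w p (t : nat -> R) (l : R) : H w -> H p -> t n @[n --> \oo] --> l ->
  Dform (fun x => t n * w x) p @[n --> \oo] --> Dform (fun x => l * w x) p.
Proof.
move=> Hw Hp tl; have E r : (fun x => r * w x) = fun x => r * w x + 0 * w x.
  by apply/funext => x; rewrite mul0r addr0.
rewrite E; under eq_fun do rewrite E.
by apply: (Dform_cvg (b := t) (c := cst 0)) => //; exact: cvg_cst.
Qed.

Lemma continuous_Dform_ray w : H w -> continuous (fun t : R => Dform (fun x => t * w x) w).
Proof. by move=> Hw l; apply/(@cvg_nbhsP _ R^o) => t tl; exact: Dform_ray_cvg. Qed.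

Lemma gx_fiber x (v t1 t2 : R) : 0 < t2 -> t2 <= t1 ->
  gx x (t2 * v) * v / t2 ^+ 3 - gx x (t1 * v) * v / t1 ^+ 3 <=
  V0 / K * v ^+ 2 * (t2 ^- 2 - t1 ^- 2).
Proof.
move=> t20 t21; case: (gxP x) => _ -> _; last exact: (ftilde_fiber (@cf) fneg f4).
apply: (@le_trans _ _ 0); first by rewrite subr_le0; exact: (f_fiber (@cf) fneg f4).
apply: mulr_ge0.
  by apply: mulr_ge0; [apply: divr_ge0; exact: ltW|exact: sqr_ge0].
rewrite subr_ge0 lef_pV2 ?posrE ?exprn_gt0 ?(lt_le_trans t20 t21)//.
by rewrite ler_sqr ?nnegrE ?(ltW t20) ?(ltW (lt_le_trans t20 t21)).
Qed.

(* Along a ray, [D(tv)(v) / t^3] is strictly decreasing: by (M3) the Kirchhoff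
   term decreases at rate [m0], while (f4) and the truncation bound the growth
   of the nonlinear term at rate [1 / K < m0]. *)
Lemma Dform_fiber v t1 t2 : H v -> 0 < t2 -> t2 <= t1 ->
  (m0 - K^-1) * A v * (t2 ^- 2 - t1 ^- 2) <=
  Dform (fun x => t2 * v x) v / t2 ^+ 3 - Dform (fun x => t1 * v x) v / t1 ^+ 3.
Proof.
move=> Hv t20 t21; have t10 : 0 < t1 by exact: lt_le_trans t21.
rewrite !Dform_scale//.
have := even_ext_fiber M3 (A0 v) t20 t21.
set X1 := Me _; set X2 := Me _ => hM.
have tt : 0 <= t2 ^- 2 - t1 ^- 2.
  by rewrite subr_ge0 lef_pV2 ?posrE ?exprn_gt0// ler_sqr ?nnegrE// ltW.
have gi t : Rintegrable mu3 (fun x => gx x (t * v x) * v x).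
  by apply: (@gx_integrable (fun x => t * v x) v) => //; exact: H_scale.
have hG : (\int[mu3]_x (gx x (t2 * v x) * v x)) / t2 ^+ 3 -
    (\int[mu3]_x (gx x (t1 * v x) * v x)) / t1 ^+ 3 <= K^-1 * A v * (t2 ^- 2 - t1 ^- 2).
  rewrite ![_ / _ ^+ 3]mulrC -!RintZ//.
  rewrite -RintB; [|exact: RintegrableZ|exact: RintegrableZ].
  apply: (@le_trans _ _ (\int[mu3]_x (V0 / K * (t2 ^- 2 - t1 ^- 2) * v x ^+ 2))).
    apply: Rint_le.
    - by apply: RintegrableB; exact: RintegrableZ.
    - by apply: RintegrableZ; exact: H_sqr Hv.
    - move=> x; have := gx_fiber x (v x) t20 t21.
      by rewrite ![_^-1 * _]mulrC [X in _ <= X]mulrAC.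
  rewrite RintZ; last exact: H_sqr Hv.
  rewrite mulrAC ler_wpM2r// mulrAC mulrC ler_wpM2l ?invr_ge0 ?(ltW K0)//.
  exact: (A_ge_sqr (@cV) V0V V00).
have -> : (X2 * (t2 * A v) - \int[mu3]_x (gx x (t2 * v x) * v x)) / t2 ^+ 3 -
    (X1 * (t1 * A v) - \int[mu3]_x (gx x (t1 * v x) * v x)) / t1 ^+ 3 =
  - (X1 * A v / t1 ^+ 2 - X2 * A v / t2 ^+ 2) -
  ((\int[mu3]_x (gx x (t2 * v x) * v x)) / t2 ^+ 3 -
    (\int[mu3]_x (gx x (t1 * v x) * v x)) / t1 ^+ 3).
  by field; rewrite !gt_eqF.
by move: hM hG; lra.
Qed.

(** * The Nehari set *)

Definition nehari v : Prop := [/\ H v, 0 < A v & Dform v v = 0].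

Let mK : 0 < m0 - K^-1.
Proof. by move: m00 K_inv; lra. Qed.

Let mul1f w : (fun x => 1 * w x) = w.
Proof. by apply/funext => x; rewrite mul1r. Qed.

Lemma nehari_below v t : nehari v -> 0 < t -> t < 1 -> 0 < Dform (fun x => t * v x) v.
Proof.
move=> [Hv Av Dv] t0 t1; have := Dform_fiber Hv t0 (ltW t1).
rewrite mul1f Dv mul0r subr0 => h.
have : 0 < Dform (fun x => t * v x) v / t ^+ 3.
  apply: lt_le_trans h; rewrite !mulr_gt0// subr_gt0 expr1n invr1.
  by rewrite invf_gt1 ?exprn_gt0// exprn_ilt1 ?(ltW t0).
by rewrite pmulr_lgt0// invr_gt0 exprn_gt0.
Qed.

Lemma nehari_above v t : nehari v -> 1 < t -> Dform (fun x => t * v x) v < 0.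
Proof.
move=> [Hv Av Dv] t1; have t0 : 0 < t by lra.
have := Dform_fiber Hv ltr01 (ltW t1).
rewrite mul1f Dv mul0r sub0r => h.
have : 0 < - (Dform (fun x => t * v x) v / t ^+ 3).
  apply: lt_le_trans h; rewrite !mulr_gt0// subr_gt0 expr1n invr1.
  by rewrite invf_lt1 ?exprn_gt0// exprn_egt1.
by rewrite oppr_gt0 pmulr_llt0// invr_gt0 exprn_gt0.
Qed.

Lemma J_ray_derive v (t : R) : H v ->
  is_derive t (1 : R) (fun t : R => J (fun x => t * v x)) (Dform (fun x => t * v x) v).
Proof.
move=> Hv; have Hv0 : H (fun x => 0 * v x) by exact: (H_scale (@cV) V0V V00 0 Hv).
have E r : (fun x => r * v x) = fun x => 0 * v x + r * v x.
  by apply/funext => x; rewrite mul0r add0r.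
have -> : (fun r : R => J (fun x => r * v x)) = fun r => J (fun x => 0 * v x + r * v x).
  by apply/funext => r; rewrite E.
by rewrite (E t); apply: J_derive.
Qed.

Lemma nehari_max v t : nehari v -> 0 < t -> J (fun x => t * v x) <= J v.
Proof.
move=> Nv t0; have [Hv _ _] := Nv.
rewrite -[in leRHS](mul1f v); have [t1|/ltW t1] := leP t 1.
  have := @ge_increment R (fun t => J (fun x => t * v x)) _ t 1 0 t1 (fun r _ => J_ray_derive r Hv).
  rewrite mul0r subr_ge0; apply => r /andP[tr r1]; apply: ltW; apply: nehari_below => //.
  exact: lt_trans tr.
have := @le_increment R (fun t => J (fun x => t * v x)) _ 1 t 0 t1 (fun r _ => J_ray_derive r Hv).
rewrite mul0r subr_le0; apply => r /andP[tr r1]; apply: ltW; exact: nehari_above.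
Qed.

(** Subtract a quarter of [Dform v v = 0]: the Kirchhoff term leaves [m0 / 4 * A v] by
    [int0_even_ext_ge], and the truncation defect costs at most [A v / (4K) <= m0 / 8 * A v]. *)
Lemma nehari_energy v : nehari v -> m0 / 8 * A v <= J v.
Proof.
move=> [Hv Av Dv]; rewrite JE.
have Ge x : Gx x (v x) <= 4^-1 * (gx x (v x) * v x) + V0 / (4 * K) * v x ^+ 2.
  case: (gxP x) => _ -> ->; last exact: (int0_ftilde_quarter (@cf) fneg th4 f3 f4).
  apply: le_trans (int0_f_le (@cf) fneg th4 f3 _) _.
  by rewrite lerDl mulr_ge0 ?sqr_ge0 ?divr_ge0 ?mulr_ge0 ?(ltW V00) ?(ltW K0).
have gi := gx_integrable Hv Hv; have v2 := H_sqr Hv.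
have IG : \int[mu3]_x Gx x (v x) <=
    4^-1 * \int[mu3]_x (gx x (v x) * v x) + V0 / (4 * K) * \int[mu3]_x (v x ^+ 2).
  rewrite -!RintZ// -RintD; [|exact: RintegrableZ|exact: RintegrableZ].
  apply: Rint_le => //; first exact: Gx_integrable.
  by apply: RintegrableD; exact: RintegrableZ.
have hV := A_ge_sqr (@cV) V0V V00 Hv.
have hM := int0_even_ext_ge cM M3 (A0 v).
move: Dv; rewrite /Dform Bform_self => Dv.
have hVK : V0 / (4 * K) * \int[mu3]_x (v x ^+ 2) <= m0 / 8 * A v.
  apply: (@le_trans _ _ (K^-1 / 4 * A v)).
    have -> : V0 / (4 * K) * \int[mu3]_x (v x ^+ 2) =
      K^-1 / 4 * (V0 * \int[mu3]_x (v x ^+ 2)) by field; rewrite gt_eqF.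
    by rewrite ler_wpM2l// divr_ge0// invr_ge0 ltW.
  by rewrite ler_wpM2r ?A0//; move: K_inv; lra.
by move: IG hM hVK Dv; set X := Me _; lra.
Qed.

Lemma gx_pair_le : exists2 C : R, 0 <= C & forall x (w t : R), 0 < t ->
  gx x (t * w) * w <= (V0 / K + m0 * V0 / 4) * t * w ^+ 2 +
                      C * t `^ (q - 1) * `|w| `^ q.
Proof.
(* This value of [d] uses up [m0 / 4] of the Kirchhoff coefficient; with the [K^-1 < m0 / 2] of the
   truncation, at least [m0 / 4] remains for [Dform_lower]. *)
have d0 : 0 < m0 * V0 / 4 by rewrite divr_gt0 ?mulr_gt0.
have [C C0 hC] := f_growth (@cf) fneg q4 (@f2) f3 f4 d0.
exists C => // x w t t0.
have r1 : 0 <= C * t `^ (q - 1) * `|w| `^ q by rewrite !mulr_ge0 ?powR_ge0.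
have VK : 0 < V0 / K by rewrite divr_gt0.
have [w0|w0] := ltP 0 w; last first.
  rewrite gx_le0 ?mul0r; last by rewrite pmulr_rle0.
  by apply: addr_ge0 => //; 
    rewrite mulr_ge0 ?sqr_ge0 ?mulr_ge0 ?(ltW t0) ?addr_ge0 ?(ltW VK) ?(ltW d0).
have tw0 : 0 < t * w by rewrite mulr_gt0.
have tw2 : 0 <= t * w ^+ 2 by rewrite mulr_ge0 ?sqr_ge0// ltW.
case: (gxP x) => _ -> _; last first.
  have := ftilde_le (@cf) fneg f4 V00 K0 a0 fa (t * w); rewrite (gtr0_norm tw0) => h.
  have := ler_wpM2r (ltW w0) h; move: d0 tw2 r1; nra.
have := le_trans (ler_norm _) (hC (t * w)); rewrite (gtr0_norm tw0) => h.
rewrite (gtr0_norm w0); have := ler_wpM2r (ltW w0) h.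
rewrite powRM ?(ltW t0) ?(ltW w0)//.
rewrite -(@mulr_powRB1 _ w q (ltW w0)); last by move: q4; lra.
set X := t `^ _; set Y := w `^ _; move: (mulr_ge0 (ltW VK) tw2); lra.
Qed.

Lemma Dform_lower : exists2 C : R, 0 <= C & forall w t, H w -> 0 < t ->
  m0 / 4 * t * A w - C * t `^ (q - 1) * \int[mu3]_x (`|w x| `^ q) <=
  Dform (fun x => t * w x) w.
Proof.
have [C C0 hC] := gx_pair_le; exists C => // w t Hw t0.
have [_ w2 wq] := H_L2q s0 s1 (@cV) V0V V00 q2 qp Hw.
rewrite Dform_scale//.
have gi : Rintegrable mu3 (fun x => gx x (t * w x) * w x).
  by apply: (@gx_integrable (fun x => t * w x) w) => //; exact: H_scale.
have IG : \int[mu3]_x (gx x (t * w x) * w x) <=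
    (V0 / K + m0 * V0 / 4) * t * \int[mu3]_x (w x ^+ 2) +
    C * t `^ (q - 1) * \int[mu3]_x (`|w x| `^ q).
  rewrite -!RintZ// -RintD; [|exact: RintegrableZ|exact: RintegrableZ].
  apply: Rint_le => //; first by apply: RintegrableD; exact: RintegrableZ.
  by move=> x; exact: hC.
have hV := A_ge_sqr (@cV) V0V V00 Hw.
have hM : m0 * (t * A w) <= Me (t ^+ 2 * A w) * (t * A w).
  by rewrite ler_wpM2r ?mulr_ge0 ?A0 ?(ltW t0)//; exact: even_ext_ge M1 _.
have h1 : (V0 / K + m0 * V0 / 4) * t * \int[mu3]_x (w x ^+ 2) <=
    (K^-1 + m0 / 4) * t * A w.
  have -> : (V0 / K + m0 * V0 / 4) * t * \int[mu3]_x (w x ^+ 2) =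
    (K^-1 + m0 / 4) * t * (V0 * \int[mu3]_x (w x ^+ 2)) by field; rewrite gt_eqF.
  rewrite ler_wpM2l// mulr_ge0 ?(ltW t0)// addr_ge0 ?invr_ge0 ?(ltW K0)//.
  by rewrite divr_ge0 ?(ltW m00).
have h2 : K^-1 * (t * A w) <= m0 / 2 * (t * A w).
  by rewrite ler_wpM2r ?(ltW K_inv)// mulr_ge0 ?A0 ?(ltW t0).
move: IG hM h1 h2; set I := \int[mu3]_x (gx _ _ * _).
set X := Me _; lra.
Qed.

(** At [t = 1], [Dform_lower] and the embedding give [m0 / 4 * A v <= C * C' * (A v)^(q/2)],
    impossible for small positive [A v] as [q > 2]. *)
Lemma nehari_lower : exists2 al : R, 0 < al & forall v, nehari v -> al <= A v.
Proof.
have [C C0 hC] := Dform_lower.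
have [C' C'0 hC'] := energy_sobolev eps s0 s1 (@cV) V0V V00 q2 qp.
pose D := C * C' + 1; have D0 : 0 < D by rewrite ltr_wpDl// mulr_ge0// ltW.
pose rho := Num.min 1 (m0 / (8 * D)).
have rho0 : 0 < rho by rewrite lt_min ltr01 divr_gt0// mulr_gt0.
exists (rho ^+ 2); first by rewrite exprn_gt0.
move=> v [Hv Av Dv]; rewrite leNgt; apply/negP => Ar.
pose r := Num.sqrt (A v).
have r0 : 0 < r by rewrite sqrtr_gt0.
have r2 : r ^+ 2 = A v by rewrite sqr_sqrtr// ltW.
have rr : r < rho.
  by rewrite -(ltr_pXn2r (n := 2))// ?nnegrE ?(ltW r0) ?(ltW rho0)// r2.
have r1 : r <= 1 by apply: ltW; apply: lt_le_trans rr _; rewrite ge_min lexx.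
have rD : r * D < m0 / 8.
  have : r < m0 / (8 * D) by apply: lt_le_trans rr _; rewrite ge_min lexx orbT.
  by rewrite ltr_pdivlMr ?mulr_gt0//; lra.
have := hC v 1 Hv ltr01; rewrite mul1f Dv powR1 !mulr1.
have Ar2 : A v <= r ^+ 2 by rewrite r2.
have [_ Iq] := hC' v r Hv r0 Ar2.
(* Since [r <= 1] and [q > 3], the cube is a sufficient and simpler power. *)
have rq : r `^ q <= r ^+ 2 * r.
  have -> : r ^+ 2 * r = r `^ 3 by rewrite (powR_mulrn 3 (ltW r0)); ring.
  by apply: ger_powR; rewrite ?r0 ?r1//; move: q4; lra.
have h1 : C * \int[mu3]_x (`|v x| `^ q) <= D * (r ^+ 2 * r).
  apply: (@le_trans _ _ (C * (C' * r `^ q))); first by rewrite ler_wpM2l.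
  rewrite mulrA; apply: ler_pM; rewrite ?powR_ge0// ?mulr_ge0 ?(ltW C'0)//.
  by rewrite lerDl.
have h2 : D * (r ^+ 2 * r) <= m0 / 8 * r ^+ 2.
  rewrite (_ : D * _ = r * D * r ^+ 2); last by ring.
  by rewrite ler_wpM2r ?sqr_ge0// ltW.
have mA : 0 < m0 * A v by rewrite mulr_gt0.
by move: h1 h2 mA; rewrite r2; set I := \int[mu3]_x _; lra.
Qed.

(** Outside [Omega] the nonlinear term is at most [V0 / K * v^2], which half of [m0 * A v] pays for.
    The other half must come from inside; this keeps minimising sequences from vanishing there. *)
Lemma nehari_mass v : nehari v ->
  Rintegrable mu3 (fun x => chi x * (f (v x) * v x)) /\
  m0 / 2 * A v <= \int[mu3]_x (chi x * (f (v x) * v x)).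
Proof.
move=> [Hv Av Dv]; have mv := H_measurable Hv.
have fm : measurable_fun setT (fun x => chi x * (f (v x) * v x)).
  apply: measurable_funM; first exact: measurable_chi.
  apply: measurable_funM => //.
  exact: measurableT_comp (continuous_measurable_fun (@cf)) mv.
have gi := gx_integrable Hv Hv; have v2 := H_sqr Hv.
have ci : Rintegrable mu3 (fun x => chi x * (f (v x) * v x)).
  apply: le_Rintegrable gi => // x.
  have := gx_mul_ge0 x (v x) ltr01; rewrite mul1r.
  by case: (gxP x) => _ -> _ h; rewrite ?mul1r ?mul0r ?normr0// ger0_norm.
split => //.
have gle x : gx x (v x) * v x <= chi x * (f (v x) * v x) + V0 / K * v x ^+ 2.
  have VK : 0 <= V0 / K by rewrite divr_ge0 ?ltW.
  case: (gxP x) => _ -> _; first by rewrite mul1r lerDl mulr_ge0 ?sqr_ge0.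
  rewrite mul0r add0r; have [v0|v0] := ltP 0 (v x); last first.
    by rewrite ftle0// mul0r mulr_ge0 ?sqr_ge0.
  rewrite expr2 mulrA ler_wpM2r ?(ltW v0)//.
  by have := ftilde_le (@cf) fneg f4 V00 K0 a0 fa (v x); rewrite (gtr0_norm v0).
have IG : \int[mu3]_x (gx x (v x) * v x) <=
    \int[mu3]_x (chi x * (f (v x) * v x)) + V0 / K * \int[mu3]_x (v x ^+ 2).
  rewrite -RintZ// -RintD//; last exact: RintegrableZ.
  by apply: Rint_le => //; apply: RintegrableD => //; exact: RintegrableZ.
have hV := A_ge_sqr (@cV) V0V V00 Hv.
have hM : m0 * A v <= Me (A v) * A v by rewrite ler_wpM2r ?A0//; exact: even_ext_ge M1 _.
move: Dv; rewrite /Dform Bform_self => Dv.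
have h1 : V0 / K * \int[mu3]_x (v x ^+ 2) <= m0 / 2 * A v.
  have -> : V0 / K * \int[mu3]_x (v x ^+ 2) = K^-1 * (V0 * \int[mu3]_x (v x ^+ 2)).
    by rewrite mulrCA mulrA.
  apply: (@le_trans _ _ (K^-1 * A v)); first by rewrite ler_wpM2l// invr_ge0 ltW.
  by rewrite ler_wpM2r ?A0// ltW.
by move: IG hM Dv h1; set X := Me _; lra.
Qed.

Lemma measurable_in_Om : measurable (in_Om : set (pt3 R)).
Proof.
by have := measurable_scale3 eps measurableT (open_measurable3 oOmega); rewrite setTI.
Qed.

(** If the sets with threshold [1 / (n + 1)] were all null, so would be their countable union. *)
Lemma exists_superlevel_Om w : measurable_fun setT w ->
  ~ {ae mu3, forall x, in_Om x -> w x <= 0} ->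
  exists d : R, 0 < d /\ measurable [set x | in_Om x /\ d <= w x] /\
    mu3 [set x | in_Om x /\ d <= w x] <> 0%E.
Proof.
move=> mw nw; pose E (n : nat) : set (pt3 R) := [set x | in_Om x /\ n.+1%:R^-1 <= w x].
have mE n : measurable (E n).
  have h := mw measurableT `[n.+1%:R^-1, +oo[%classic (measurable_itv _).
  have -> : E n = in_Om `&` (setT `&` w @^-1` `[n.+1%:R^-1, +oo[%classic).
    apply/seteqP; split => x /=; rewrite in_itv/= andbT; first by case.
    by case=> ? [].
  by apply: measurableI => //; exact: measurable_in_Om.
apply: contrapT => h; apply: nw.
have E0 n : mu3 (E n) = 0%E.
  apply: contrapT => En; apply: h; exists n.+1%:R^-1; split.
    by rewrite invr_gt0 ltr0n.
  by split; [exact: mE|exact: En].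
have mU : measurable (\bigcup_n E n) by apply: bigcup_measurable => n _; exact: mE.
exists (\bigcup_n E n); split; first exact: mU.
- apply/eqP; rewrite -measure_le0.
  have S0 : (\sum_(0 <= n <oo) mu3 (E n) = 0)%E by rewrite eseries0// => n _ _; exact: E0.
  by rewrite -S0; apply: measure_sigma_subadditive.
- move=> x /= /not_implyP[Ox /negP]; rewrite -ltNge => wx.
  exists (Num.truncn (w x)^-1) => //; split => //.
  rewrite invf_ple ?posrE ?ltr0n//; apply: ltW; exact: truncnS_gt.
Qed.

(** On the ray of [w] the derivative is positive for small [t], by [Dform_lower], and negative for
    some large [t]; the intermediate value theorem gives a zero. The negative sign is drawn from the
    part of [w] inside [Omega], since outside the nonlinearity is at most linear. *)
Lemma nehari_exists w : H w -> ~ {ae mu3, forall x, in_Om x -> w x <= 0} ->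
  exists2 t : R, 0 < t & nehari (fun x => t * w x).
Proof.
move=> Hw nw; have mw := H_measurable Hw.
have Aw : 0 < A w.
  apply: (nontrivial_A_gt0 (@cV) V0V V00 Hw) => w0; apply: nw.
  by apply: ae_imp w0 => x -> _.
have [d [d0 [mE nE]]] := exists_superlevel_Om mw nw.
set E := [set x | in_Om x /\ d <= w x] in mE nE.
have w2 := H_sqr Hw.
have Ei : Rintegrable mu3 (\1_E : pt3 R -> R).
  apply: le_Rintegrable (RintegrableZ (d ^- 2) w2); first exact: measurable_indic.
  move=> x; rewrite indicE; case: (pselect (E x)) => Ex.
    rewrite mem_set// normr1 ler_pdivlMl ?exprn_gt0// mulr1.
    by case: Ex => _ dw; rewrite ler_sqr ?nnegrE ?(ltW d0) ?(le_trans (ltW d0) dw).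
  by rewrite memNset// normr0 mulr_ge0 ?sqr_ge0// invr_ge0 exprn_ge0// ltW.
pose I := \int[mu3]_x (\1_E x : R).
have I0 : 0 < I.
  rewrite lt_neqAle; apply/andP; split; last by apply: Rintegral_ge0.
  apply/negP => /eqP I0; apply: nE; have := Rintegrable_EFin Ei.
  by rewrite -/I -I0 integral_indic// setIT.
(* for large [t] the superquartic growth wins on the set where [w >= d] *)
have [t1 [t11 Dt1]] : exists t1, 1 <= t1 /\ Dform (fun x => t1 * w x) w < 0.
  (* [L * d^4 * I] exceeds by [1] the coefficient of [t^3] in the bound of the Kirchhoff term. *)
  pose L := (Me 1 * A w ^+ 2 + 1) / (d ^+ 4 * I).
  have Me1 : 0 <= Me 1 by apply: le_trans (ltW m00) (even_ext_ge M1 1).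
  have L0 : 0 < L by rewrite divr_gt0 ?mulr_gt0 ?exprn_gt0// ltr_wpDl// mulr_ge0 ?sqr_ge0.
  have [T T0 hT] := f_superquartic (@cf) fneg th4 f3 f4 L.
  (* The three terms ensure [t >= 1], [t^2 * A w >= 1] (the range of [even_ext_le]) and [t * w >= T]
     wherever [w >= d]. *)
  pose t := Num.max 1 (Num.max (A w)^-1 (T / d)).
  have t1 : 1 <= t by rewrite le_max lexx.
  have tA : (A w)^-1 <= t by rewrite !le_max lexx orbT.
  have tT : T / d <= t by rewrite !le_max lexx !orbT.
  have t0 : 0 < t by lra.
  exists t; split => //; rewrite Dform_scale//.
  have gi : Rintegrable mu3 (fun x => gx x (t * w x) * w x).
    by apply: (@gx_integrable (fun x => t * w x) w) => //; exact: H_scale.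
  have h1 : L * (d ^+ 4 * t ^+ 3) * I <= \int[mu3]_x (gx x (t * w x) * w x).
    rewrite -RintZ//; apply: Rint_le => //; first exact: RintegrableZ.
    move=> x; rewrite indicE; case: (pselect (E x)) => Ex; last first.
      by rewrite memNset// mulr0 gx_mul_ge0.
    rewrite mem_set// mulr1; case: Ex => Ox dw.
    have wx0 : 0 < w x by exact: lt_le_trans dw.
    case: (gxP x) => [_ -> _|//].
    have : T <= t * w x.
      by move: tT; rewrite ler_pdivrMr// => h; apply: le_trans h _; rewrite ler_wpM2l// ltW.
    move=> /hT; rewrite ler_pdivlMr ?exprn_gt0 ?mulr_gt0// => h.
    have := ler_wpM2r (ltW wx0) h; apply: le_trans.
    have -> : L * (t * w x) ^+ 3 * w x = L * (w x ^+ 4 * t ^+ 3) by ring.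
    rewrite ler_wpM2l ?(ltW L0)// ler_wpM2r ?exprn_ge0 ?(ltW t0)//.
    by rewrite lerXn2r ?nnegrE ?(ltW d0) ?(ltW wx0).
  have tA1 : 1 <= t ^+ 2 * A w.
    have : 1 <= t * A w by rewrite -ler_pdivrMr// mul1r.
    by move=> h; apply: le_trans h _; rewrite expr2 ler_wpM2r ?A0// ler_peMl// ltW.
  have h2 : Me (t ^+ 2 * A w) * (t * A w) <= t ^+ 3 * (Me 1 * A w ^+ 2).
    have -> : t ^+ 3 * (Me 1 * A w ^+ 2) = Me 1 * (t ^+ 2 * A w) * (t * A w) by ring.
    rewrite ler_wpM2r ?mulr_ge0 ?A0 ?(ltW t0)//.
    exact: (even_ext_le m00 M3).
  have h3 : L * (d ^+ 4 * t ^+ 3) * I = t ^+ 3 * (Me 1 * A w ^+ 2) + t ^+ 3.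
    by rewrite /L; field; rewrite !gt_eqF.
  have t30 : 0 < t ^+ 3 by rewrite exprn_gt0.
  by move: h1 h2; rewrite h3; set X := Me (_ * _); set Y := \int[mu3]_x (gx _ _ * _); lra.
have [t0 [t00 t01 Dt0]] : exists t0, [/\ 0 < t0, t0 <= 1 & 0 < Dform (fun x => t0 * w x) w].
  have [C C0 hC] := Dform_lower.
  pose Q := \int[mu3]_x (`|w x| `^ q).
  have Q0 : 0 <= Q by apply: Rintegral_ge0 => x _; exact: powR_ge0.
  have CQ : 0 < C * Q + 1 by rewrite ltr_wpDl ?mulr_ge0.
  (* Small enough that the superlinear term, at most [C * Q * t^2], stays below
     [m0 / 4 * t * A w]. *)
  pose t := Num.min 1 (m0 * A w / (8 * (C * Q + 1))).
  have t0 : 0 < t by rewrite lt_min ltr01 divr_gt0 ?mulr_gt0.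
  have tle1 : t <= 1 by rewrite ge_min lexx.
  have tC : t * (C * Q + 1) <= m0 * A w / 8.
    have : t <= m0 * A w / (8 * (C * Q + 1)) by rewrite ge_min lexx orbT.
    by rewrite ler_pdivlMr ?mulr_gt0//; lra.
  exists t; split => //; apply: lt_le_trans (hC w t Hw t0).
  have tq : t `^ (q - 1) <= t ^+ 2.
    rewrite -(powR_mulrn 2 (ltW t0)); apply: ger_powR; rewrite ?t0 ?tle1//.
    by move: q4; lra.
  rewrite -/Q subr_gt0; apply: (@le_lt_trans _ _ (C * t ^+ 2 * Q)).
    by rewrite ler_wpM2r// ler_wpM2l.
  have -> : C * t ^+ 2 * Q = t * (t * (C * Q)) by ring.
  have -> : m0 / 4 * t * A w = t * (m0 * A w / 4) by ring.
  rewrite ltr_pM2l//; have mA : 0 < m0 * A w by rewrite mulr_gt0.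
  by move: tC t0 mA; lra.
have t0t1 : t0 <= t1 by exact: le_trans t11.
have cD : {within `[t0, t1], continuous (fun t : R => Dform (fun x => t * w x) w)}.
  by apply: continuous_subspaceT; exact: continuous_Dform_ray.
have [|c] := IVT (v := 0) t0t1 cD.
  by rewrite ge_min le_max (ltW Dt0) (ltW Dt1) orbT.
rewrite in_itv/= => /andP[t0c _] Dc; have c0 : 0 < c by exact: lt_le_trans t0c.
exists c => //; have Hc := H_scale (@cV) V0V V00 c Hw; split => //.
- by rewrite (A_scale (@cV) V0V V00)// mulr_gt0// exprn_gt0.
- by rewrite Dform_mulr// Dc mulr0.
Qed.

(** * Limits of minimising sequences *)

Hypotheses (s12 : 1 / 2 <= s) (bOmega : bounded3 Omega) (eps0 : 0 < eps).

Lemma chi_ge0 x : 0 <= chi x.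
Proof. by rewrite /chi indicE. Qed.

(** The scaled [Omega] is bounded, hence of finite measure: additive constants on it become
    integrable. *)
Lemma chi_integrable : Rintegrable mu3 chi.
Proof.
have [r hr] := bOmega; pose b := `|r| / eps + 1.
have b0 : 0 <= b by rewrite addr_ge0// divr_ge0// ltW.
apply: Rintegrable_ge0_lty; [exact: measurable_chi|exact: chi_ge0|].
pose c : pt3 R := (- b, - b, - b).
apply: (bounded_support_integrable (Q := cube c (2 * b)) (c := 1)) => //.
- exact: measurable_cube.
- by rewrite leb3_cube ?ltry// mulr_ge0.
- exact: measurable_chi.
- by move=> x; case: (gxP x) => _ _ _; rewrite lexx ler01.
- move=> x Qx; case: (gxP x) => [Ox _ _|//]; exfalso; apply: Qx; apply/cubeE.
  have h z : `|eps * z| <= r -> - b <= z < - b + 2 * b.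
    rewrite normrM (gtr0_norm eps0) => zr.
    have : `|z| <= `|r| / eps.
      by rewrite ler_pdivlMr// mulrC; apply: le_trans zr (ler_norm _).
    by rewrite ler_norml /b => /andP[? ?]; apply/andP; split; lra.
  by have [] := hr _ Ox; rewrite /c1 /c2 /c3/= => /h ? /h ? /h ?.
Qed.

Let L2q u : H u -> in_L2q mu3 q u := @H_L2q _ _ _ _ eps _ s0 s1 (@cV) V0V V00 q2 qp u.

Lemma chi_pow_integrable u : H u -> Rintegrable mu3 (fun x => chi x * `|u x| `^ q) /\
  \int[mu3]_x (chi x * `|u x| `^ q) <= \int[mu3]_x (`|u x| `^ q).
Proof.
move=> /L2q[mu _ uq]; have cle x : chi x * `|u x| `^ q <= `|u x| `^ q.
  by case: (gxP x) => _ _ _; rewrite ?mul1r ?mul0r ?powR_ge0.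
have ci : Rintegrable mu3 (fun x => chi x * `|u x| `^ q).
  apply: le_Rintegrable uq.
    apply: measurable_funM; first exact: measurable_chi.
    by apply: (measurableT_comp (measurable_powR _)); exact: measurableT_comp.
  by move=> x; rewrite ger0_norm// mulr_ge0 ?powR_ge0 ?chi_ge0.
by split => //; apply: Rint_le.
Qed.

Lemma Rint_chi_ge0 u : 0 <= \int[mu3]_x (chi x * `|u x| `^ q).
Proof. by apply: Rintegral_ge0 => x _; rewrite mulr_ge0 ?chi_ge0 ?powR_ge0. Qed.

Section minimizing_sequence.
Variables (u : nat -> pt3 R -> R) (v : pt3 R -> R) (c g p Q : R).
Hypotheses (Nu : forall n, nehari (u n)) (mv : measurable_fun setT v).
Hypothesis uv : {ae mu3, forall x, u n x @[n --> \oo] --> v x}.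
Hypotheses (cJ : J (u n) @[n --> \oo] --> c)
  (cg : Agag s (u n) @[n --> \oo] --> g) (cp : Apot V eps (u n) @[n --> \oo] --> p).
Hypothesis uQ : forall n, \int[mu3]_x (`|u n x| `^ q) <= Q.

Let Hu n : H (u n). Proof. by have [] := Nu n. Qed.

Lemma limit_in_H : [/\ H v, Agag s v <= g & Apot V eps v <= p].
Proof. exact: (H_ae_cvg (@cV) V0V V00 Hu mv uv cg cp). Qed.

(* The subcritical growth makes [v |-> \int_Omega f(v) v] upper semicontinuous
   along the sequence, by Fatou's lemma for [d |v|^q + C - f(v) v]. *)
Lemma limit_nonvanishing : ~ {ae mu3, forall x, in_Om x -> v x <= 0}.
Proof.
move=> v0; have [al al0 hal] := nehari_lower.
pose be := m0 / 2 * al; have be0 : 0 < be by rewrite mulr_gt0// divr_gt0.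
have Q0 : 0 <= Q by apply: le_trans (uQ 0); apply: Rintegral_ge0 => x _; exact: powR_ge0.
(* Makes the [L^q] contribution [d * Q] smaller than [be], the mass that [nehari_mass] and
   [nehari_lower] guarantee inside [Omega]. *)
pose d := be / (2 * (Q + 1)).
have d0 : 0 < d by rewrite divr_gt0// mulr_gt0// ltr_wpDl.
have dQ : d * Q < be.
  rewrite /d mulrAC ltr_pdivrMr ?mulr_gt0 ?ltr_wpDl//; move: be0 Q0; nra.
have [C C0 hC] := f_weak_growth (@cf) fneg q4 (@f2) f3 f4 d0.
pose h (w : R) x : R := chi x * (d * `|w| `^ q + C - f w * w).
have h0 (w : R) x : 0 <= h w x by rewrite mulr_ge0 ?chi_ge0// subr_ge0.
have mh w : measurable_fun setT w -> measurable_fun setT (fun x => h (w x) x).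
  move=> mw; apply: measurable_funM; first exact: measurable_chi.
  apply: measurable_funB; last first.
    apply: measurable_funM => //.
    exact: measurableT_comp (continuous_measurable_fun (@cf)) mw.
  apply: measurable_funD => //; apply: measurable_funM => //.
  by apply: (measurableT_comp (measurable_powR _)); exact: measurableT_comp.
pose m := \int[mu3]_x chi x.
pose l := d * Q + C * m - be.
have ub n : (\int[mu3]_x (h (u n x) x)%:E <= l%:E)%E.
  have [ci cle] := chi_pow_integrable (Hu n).
  have [fi fm] := nehari_mass (Nu n).
  have hE x : h (u n x) x = d * (chi x * `|u n x| `^ q) + C * chi x -
      chi x * (f (u n x) * u n x) by rewrite /h; ring.
  have i1 := RintegrableD (RintegrableZ d ci) (RintegrableZ C chi_integrable).
  have -> : (\int[mu3]_x (h (u n x) x)%:E)%E = (\int[mu3]_x (d * (chi x * `|u n x| `^ q) +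
      C * chi x - chi x * (f (u n x) * u n x)))%:E.
    rewrite -Rintegrable_EFin; last exact: RintegrableB.
    by apply: eq_integral => x _; rewrite hE.
  rewrite lee_fin RintB// RintD//; [|exact: RintegrableZ|exact: RintegrableZ chi_integrable].
  rewrite !RintZ//; last exact: chi_integrable.
  rewrite /l lerB ?lerD// ?ler_wpM2l ?(ltW d0)//.
    by apply: le_trans cle (uQ n).
  apply: le_trans fm; rewrite /be ler_wpM2l ?hal//.
  by rewrite divr_ge0// ltW.
have Fh : (\int[mu3]_x (h (v x) x)%:E <= l%:E)%E.
  apply: (@fatou_real _ _ _ mu3 (fun n x => h (u n x) x) (fun x => h (v x) x) (cst l) l) => //.
  - by move=> n; apply: mh; exact: (H_measurable (Hu n)).
  - exact: mh.
  - apply: ae_imp uv => x ux; apply: cvgM; first exact: cvg_cst.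
    apply: cvgB; last by apply: cvgM => //; apply: (cvg_comp _ _ ux); exact: cf.
    apply: cvgD; last exact: cvg_cst.
    by apply: cvgM; [exact: cvg_cst|apply: cvg_norm_powR => //; move: q4; lra].
  - exact: cvg_cst.
(* If [v <= 0] in [Omega], then [f v = 0] there and the integrand is at least [C]; together with
   [Fh] this forces [be <= d * Q]. *)
have : ((C * m)%:E <= l%:E)%E.
  apply: le_trans Fh; rewrite /m -RintZ; last exact: chi_integrable.
  rewrite -Rintegrable_EFin; last exact: RintegrableZ chi_integrable.
  apply: ae_ge0_le_integral => //.
  - by move=> x _; rewrite lee_fin mulr_ge0// chi_ge0.
  - by apply/measurable_EFinP; apply: measurable_funM => //; exact: measurable_chi.
  - by move=> x _; rewrite lee_fin h0.
  - by apply/measurable_EFinP; exact: mh.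
  - apply: ae_imp v0 => x vx _; rewrite lee_fin /h.
    case: (gxP x) vx => [Ox _ _ /(_ Ox) vx|_ _ _ _]; last by rewrite mulr0 mul0r.
    by rewrite fle0// mul0r subr0 mulr1 mul1r lerDr mulr_ge0 ?powR_ge0// ltW.
by rewrite lee_fin /l; move: dQ; lra.
Qed.

(** As [u n] is on the Nehari set, [J (t u n) <= J (u n)], so it suffices to pass to the limit in
    [J (t u n)]. Fatou's lemma handles [G] after [m0 / 2 * V w^2] and a subcritical term on [Omega]
    are added. The added potential energy is recovered from the drop of the Kirchhoff primitive
    between [t^2 (g + p)] and [t^2 * A v]; the subcritical term leaves an error proportional to [d],
    which is arbitrary. *)
Lemma limit_energy t : 0 < t -> J (fun x => t * v x) <= c.
Proof.
move=> t0; have [Hv Ag Ap] := limit_in_H.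
have Q0 : 0 <= Q by apply: le_trans (uQ 0); apply: Rintegral_ge0 => x _; exact: powR_ge0.
have Htv := H_scale (@cV) V0V V00 t Hv.
have Htu n := H_scale (@cV) V0V V00 t (Hu n).
suff key d : 0 < d -> J (fun x => t * v x) <= c + d * (t `^ q * Q).
  apply/ler_addgt0Pr => e e0; have tQ : 0 < t `^ q * Q + 1.
    by rewrite ltr_wpDl// mulr_ge0// powR_ge0.
  apply: le_trans (key (e / (t `^ q * Q + 1)) _) _; first by rewrite divr_gt0.
  rewrite lerD2l mulrAC ler_pdivrMr// ler_wpM2l ?(ltW e0)//.
  by rewrite lerDl.
move=> d0; have [C C0 hC] := f_weak_growth (@cf) fneg q4 (@f2) f3 f4 d0.
(* Outside [Omega] the potential term dominates [G] because [1 / K < m0]; inside, [G <= f w * w / 4]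
   is below the two middle terms. *)
pose h (w : R) x : R := m0 / 2 * (Veps V eps x * w ^+ 2) + d * (chi x * `|w| `^ q) +
  C * chi x - Gx x w.
have h0 (w : R) x : 0 <= h w x.
  have V1 : V0 / (2 * K) * w ^+ 2 <= m0 / 2 * (Veps V eps x * w ^+ 2).
    have -> : V0 / (2 * K) * w ^+ 2 = K^-1 / 2 * (V0 * w ^+ 2) by field; rewrite gt_eqF.
    apply: ler_pM; rewrite ?divr_ge0 ?invr_ge0 ?(ltW K0)//.
    - by rewrite mulr_ge0 ?sqr_ge0 ?(ltW V00).
    - by move: K_inv m00; lra.
    - by rewrite ler_wpM2r ?sqr_ge0//; exact: V0V.
  have V2 : 0 <= m0 / 2 * (Veps V eps x * w ^+ 2).
    by apply: le_trans V1; rewrite mulr_ge0 ?sqr_ge0// divr_ge0 ?mulr_ge0 ?ltW.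
  rewrite /h subr_ge0; case: (gxP x) => _ _ ->.
    rewrite mul1r mulr1; have f1 := int0_f_le (@cf) fneg th4 f3 w.
    have f5 := hC w; have p0 : 0 <= d * `|w| `^ q by rewrite mulr_ge0 ?powR_ge0 ?(ltW d0).
    by move: V2 C0; lra.
  rewrite mul0r !mulr0 !addr0; apply: le_trans V1.
  exact: (int0_ftilde_le (@cf) fneg f4).
have mh w : measurable_fun setT w -> measurable_fun setT (fun x => h (w x) x).
  move=> mw; apply: measurable_funB; last exact: measurable_Gx.
  apply: measurable_funD; first apply: measurable_funD.
  - apply: measurable_funM => //; apply: measurable_funM; last exact: measurable_funX.
    exact: measurable_Veps.
  - apply: measurable_funM => //; apply: measurable_funM; first exact: measurable_chi.
    by apply: (measurableT_comp (measurable_powR _)); exact: measurableT_comp.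
  - by apply: measurable_funM => //; exact: measurable_chi.
pose m := \int[mu3]_x chi x.
have Ih w : H w -> (\int[mu3]_x (h (w x) x)%:E)%E =
    (m0 / 2 * Apot V eps w + d * \int[mu3]_x (chi x * `|w x| `^ q) + C * m -
     \int[mu3]_x Gx x (w x))%:E.
  move=> Hw; have [ci _] := chi_pow_integrable Hw.
  have i1 := RintegrableZ (m0 / 2) (H_V (@cV) V0V V00 Hw).
  have i2 := RintegrableZ d ci; have i3 := RintegrableZ C chi_integrable.
  have iG := Gx_integrable Hw.
  have i12 := RintegrableD i1 i2; have i123 := RintegrableD i12 i3.
  rewrite -[LHS]/(\int[mu3]_x (m0 / 2 * (Veps V eps x * w x ^+ 2) +
     d * (chi x * `|w x| `^ q) + C * chi x - Gx x (w x))%:E)%E.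
  rewrite Rintegrable_EFin; last exact: RintegrableB.
  rewrite RintB// RintD// RintD// !RintZ//; first exact: chi_integrable.
  exact: (H_V (@cV) V0V V00 Hw).
have AtE w : H w -> Apot V eps (fun x => t * w x) = t ^+ 2 * Apot V eps w.
  move=> Hw; rewrite /Apot -RintZ; last exact: (H_V (@cV) V0V V00 Hw).
  by apply: eq_Rintegral => x _; ring.
(* The bound for the integral of [h] along [t u n], with [J (t u n)] already replaced by
   [J (u n)]. *)
pose cn n := m0 / 2 * (t ^+ 2 * Apot V eps (u n)) + d * (t `^ q * Q) + C * m +
  J (u n) - 2^-1 * int0 Me (t ^+ 2 * (Agag s (u n) + Apot V eps (u n))).
pose l := m0 / 2 * (t ^+ 2 * p) + d * (t `^ q * Q) + C * m + c -
  2^-1 * int0 Me (t ^+ 2 * (g + p)).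
have cnl : cn n @[n --> \oo] --> l.
  have c1 : t ^+ 2 * Apot V eps (u n) @[n --> \oo] --> t ^+ 2 * p.
    by apply: cvgM => //; exact: cvg_cst.
  have c2 : t ^+ 2 * (Agag s (u n) + Apot V eps (u n)) @[n --> \oo] --> t ^+ 2 * (g + p).
    by apply: cvgM; [exact: cvg_cst|exact: cvgD].
  apply: cvgB.
    apply: cvgD => //; apply: cvgD; last exact: cvg_cst.
    by apply: cvgD; [apply: cvgM => //; exact: cvg_cst|exact: cvg_cst].
  apply: cvgM; first exact: cvg_cst.
  by apply: (cvg_comp _ _ c2); apply: continuous_int0; exact: continuous_even_ext.
have powt w x : `|t * w x| `^ q = t `^ q * `|w x| `^ q.
  by rewrite normrM (gtr0_norm t0) powRM// ltW.
have ub n : (\int[mu3]_x (h (t * u n x) x)%:E <= (cn n)%:E)%E.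
  rewrite (Ih _ (Htu n)) lee_fin AtE// /cn.
  have [_ cle] := chi_pow_integrable (Hu n).
  have cQ : d * \int[mu3]_x (chi x * `|t * u n x| `^ q) <= d * (t `^ q * Q).
    rewrite ler_wpM2l ?(ltW d0)//; under eq_Rintegral do rewrite powt mulrCA.
    rewrite RintZ; last by have [] := chi_pow_integrable (Hu n).
    by rewrite ler_wpM2l ?powR_ge0//; apply: le_trans cle (uQ n).
  have := nehari_max (Nu n) t0; rewrite [X in X <= _ -> _]JE.
  rewrite (A_scale (@cV) V0V V00)// normeps2E.
  move: cQ; move: (\int[mu3]_x Gx _ _) (int0 _ _) (J _) (\int[mu3]_x (_ * _)) => X Y Z W.
  by move: (t ^+ 2 * _) (d * (_ * _)) => *; lra.
have Fh : (\int[mu3]_x (h (t * v x) x)%:E <= l%:E)%E.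
  apply: (@fatou_real _ _ _ mu3 (fun n x => h (t * u n x) x) (fun x => h (t * v x) x) cn l) => //.
  - by move=> n; apply: mh; exact: (H_measurable (Htu n)).
  - exact: mh (H_measurable Htv).
  - apply: ae_imp uv => x ux.
    have tux : t * u n x @[n --> \oo] --> t * v x by apply: cvgM => //; exact: cvg_cst.
    apply: cvgB; last first.
      by apply: (cvg_comp _ _ tux); case: (gxP x) => _ _ ->; exact: continuous_int0.
    apply: cvgD; last exact: cvg_cst.
    apply: cvgD.
      by apply: cvgM; [exact: cvg_cst|apply: cvgM; [exact: cvg_cst|rewrite !expr2; exact: cvgM]].
    apply: cvgM; first exact: cvg_cst.
    by apply: cvgM; [exact: cvg_cst|apply: cvg_norm_powR => //; move: q4; lra].
have := Fh; rewrite (Ih _ Htv) lee_fin AtE// => h1.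
have h2 := Rint_chi_ge0 (fun x => t * v x).
have h3 : 0 <= d * \int[mu3]_x (chi x * `|t * v x| `^ q) by rewrite mulr_ge0 ?(ltW d0).
have XY : t ^+ 2 * A v <= t ^+ 2 * (g + p).
  by rewrite ler_wpM2l ?sqr_ge0// normeps2E lerD.
(* [M >= m0] turns the lost energy into at least [m0 t^2 (p - Apot v)]; half of it cancels the
   potential terms in [h1]. *)
have h4 := int0_even_ext_incr cM M1 XY.
have h5 : m0 * (t ^+ 2 * (p - Apot V eps v)) <= m0 * (t ^+ 2 * (g + p) - t ^+ 2 * A v).
  rewrite ler_wpM2l ?(ltW m00)// -mulrBr ler_wpM2l ?sqr_ge0// normeps2E.
  by move: Ag; lra.
rewrite JE (A_scale (@cV) V0V V00)//.
move: h1 h3 h4 h5; rewrite /l mulrBr mulrBr.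
set X := \int[mu3]_x Gx _ _; set Y := int0 _ _; set Z := int0 _ _.
set W := \int[mu3]_x _; set P := t ^+ 2 * p; set S := t ^+ 2 * Apot _ _ _.
lra.
Qed.

End minimizing_sequence.

(** * Existence of a nonnegative minimiser *)

(** The positive part has no larger energy norm, and [G] ignores negative values because [g]
    vanishes there. *)
Lemma J_pospart v t : H v -> 0 < t ->
  J (fun x => t * pospart v x) <= J (fun x => t * v x).
Proof.
move=> Hv t0; have [Hp Ap] := H_pospart (@cV) V0V V00 Hv.
rewrite [leLHS]JE [leRHS]JE (A_scale (@cV) V0V V00 t Hp) (A_scale (@cV) V0V V00 t Hv).
have -> : \int[mu3]_x Gx x (t * pospart v x) = \int[mu3]_x Gx x (t * v x).
  apply: eq_Rintegral => x _; rewrite /pospart; case: (leP 0 (v x)) => // vx.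
  have tv : t * v x <= 0 by rewrite pmulr_rle0// ltW.
  rewrite mulr0 Gx0; case: (gxP x) => _ _ ->; rewrite int0_vanish//.
have AA : t ^+ 2 * A (pospart v) <= t ^+ 2 * A v by rewrite ler_wpM2l ?sqr_ge0.
have h := int0_even_ext_incr cM M1 AA.
have h1 : 0 <= m0 * (t ^+ 2 * A v - t ^+ 2 * A (pospart v)).
  by rewrite mulr_ge0 ?(ltW m00)// subr_ge0.
move: (le_trans h1 h).
move: (int0 Me (t ^+ 2 * A v)) (int0 Me (t ^+ 2 * A (pospart v))) (\int[mu3]_x _).
by move=> {h h1 AA Ap} X Y Z; lra.
Qed.

Lemma nehari_minimizer w0 : H w0 -> ~ {ae mu3, forall x, in_Om x -> w0 x <= 0} ->
  exists u, [/\ nehari u, (forall x, 0 <= u x) & forall v, nehari v -> J u <= J v].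
Proof.
move=> Hw0 nw0; pose E := [set r : R | exists2 v, nehari v & J v = r].
have E0 : E !=set0.
  by have [t t0 Nt] := nehari_exists Hw0 nw0; exists (J (fun x => t * w0 x)), (fun x => t * w0 x).
have lbE : has_lbound E.
  exists 0 => _ [v Nv <-]; apply: le_trans (nehari_energy Nv).
  by rewrite mulr_ge0 ?A0// divr_ge0// ltW.
pose c := inf E.
have cE v : nehari v -> c <= J v by move=> Nv; apply: ge_inf => //; exists v.
have ex n : exists v, nehari v /\ J v < c + n.+1%:R^-1.
  have n0 : 0 < n.+1%:R^-1 :> R by rewrite invr_gt0.
  by have [_ [v Nv <-] Jv] := inf_adherent n0 (conj E0 lbE); exists v.
have [w hw] := choice ex.
have Nw n : nehari (w n) by have [] := hw n.
have Hw n : H (w n) by have [] := Nw n.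
have Jw : J (w n) @[n --> \oo] --> c.
  apply/cvgrPdist_lt => e e0; near=> n; have [Nn Jn] := hw n.
  rewrite distrC ger0_norm ?subr_ge0 ?cE// ltrBlDl; apply: lt_trans Jn _.
  by rewrite ltrD2l; near: n; exact: near_infty_natSinv_lt (PosNum e0).
have n1 n : n.+1%:R^-1 <= 1 :> R by rewrite invf_le1// ler1n.
(* [nehari_energy] with [J < c + 1] gives this bound on the energy norms. *)
pose B := 8 / m0 * (c + 1).
have AB n : A (w n) <= B.
  have := nehari_energy (Nw n); have [_ /ltW Jn] := hw n.
  rewrite -ler_pdivlMl ?divr_gt0// invf_div => h; apply: le_trans h _.
  rewrite /B ler_wpM2l ?divr_ge0 ?(ltW m00)//; apply: le_trans Jn _.
  by rewrite lerD2l n1.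
have B0 : 0 <= B by apply: le_trans (AB 0); exact: A0.
have gB n : Agag s (w n) <= B.
  by apply: le_trans (AB n); rewrite normeps2E lerDl; exact: (Apot_ge0 _ V0V V00).
have pB n : Apot V eps (w n) <= B.
  by apply: le_trans (AB n); rewrite normeps2E lerDr; exact: Agag_ge0.
(* One constant for both the seminorm and the [L^2] norm, as [rellich] asks. *)
pose B1 := B * (1 + V0^-1).
have BB1 : B <= B1 by rewrite /B1 ler_peMr// lerDl invr_ge0 ltW.
have gB1 n : (gagliardo s (w n) <= B1%:E)%E.
  by rewrite (gagliardo_Agag (Hw n)) lee_fin; exact: le_trans (gB n) BB1.
have lB1 n : (L2sq (w n) <= B1%:E)%E.
  rewrite (L2sq_Rint (Hw n)) lee_fin; apply: (@le_trans _ _ (V0^-1 * B)).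
    rewrite -ler_pdivrMl ?invr_gt0// invrK.
    by apply: le_trans (AB n); exact: (A_ge_sqr (@cV) V0V V00).
  by rewrite /B1 mulrC ler_wpM2l// lerDr.
have [phi [v [hphi mv wv]]] := rellich s12 s1 (fun n => H_measurable (Hw n)) gB1 lB1.
have nB (x : nat -> R) : (forall n, 0 <= x n <= B) -> forall n, `|x n| <= B.
  by move=> hx n; have /andP[x0 xB] := hx n; rewrite ger0_norm.
(* A further subsequence along which both parts of the energy have limits. *)
have [psi [g [p [hpsi cg cp]]]] := bounded_pair_subseq
  (nB (fun n => Agag s (w (phi n))) (fun n => introT andP (conj (Agag_ge0 _ _) (gB _))))
  (nB (fun n => Apot V eps (w (phi n)))
    (fun n => introT andP (conj (Apot_ge0 _ V0V V00 _) (pB _)))).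
pose u n := w (phi (psi n)).
have Nu n : nehari (u n) by exact: Nw.
have uv : {ae mu3, forall x, u n x @[n --> \oo] --> v x}.
  apply: ae_imp wv => x wx.
  exact: (@cvg_subseq R (fun k => w (phi k) x) (v x) psi hpsi wx).
have Ju : J (u n) @[n --> \oo] --> c.
  apply: (@cvg_subseq R (fun n => J (w n)) c (fun n => phi (psi n))) => //.
  by move=> k; apply: leq_trans (hpsi k) (hphi _).
have [C C0 hC] := energy_sobolev eps s0 s1 (@cV) V0V V00 q2 qp.
have uQ n : \int[mu3]_x (`|u n x| `^ q) <= C * (B + 1) `^ q.
  have B10 : 0 < B + 1 by rewrite ltr_wpDl.
  have AB2 : A (u n) <= (B + 1) ^+ 2 by apply: le_trans (AB _) _; move: B0; nra.
  by have [] := hC (u n) (B + 1) (Hw _) B10 AB2.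
have nv := limit_nonvanishing Nu mv uv uQ.
have lJ := limit_energy Nu mv uv Ju cg cp uQ.
have [Hv _ _] := limit_in_H Nu mv uv cg cp.
have [Hp _] := H_pospart (@cV) V0V V00 Hv.
have [t t0 Nt] : exists2 t : R, 0 < t & nehari (fun x => t * pospart v x).
  apply: nehari_exists => // np; apply: nv; apply: ae_imp np => x px Ox.
  by apply: le_trans (px Ox); rewrite /pospart le_max lexx orbT.
exists (fun x => t * pospart v x); split; first exact: Nt.
- by move=> x; rewrite mulr_ge0 ?(ltW t0)// pospart_ge0.
- move=> z Nz; apply: le_trans (cE _ Nz).
  by apply: le_trans (J_pospart Hv t0) _; exact: lJ.
Unshelve. all: by end_near. Qed.

(* Perturbing the minimiser in a direction [p] and projecting back onto the
   Nehari set cannot decrease [J]; the mean value theorem then yields points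
   near [u] where the derivative in the direction [p] is nonnegative. *)
Lemma minimizer_perturb u p (e : R) : nehari u -> (forall v, nehari v -> J u <= J v) ->
  H p -> 0 < e -> e < 1 -> exists t r : R, [/\ `|t - 1| <= e, 0 <= r, r <= 2 * e &
    0 <= Dform (fun x => t * u x + r * p x) p].
Proof.
move=> Nu umin Hp e0 e1; have [Hu Au Du] := Nu.
pose w (z : R) x := 1 * u x + z * p x.
have Hw z : H (w z) by exact: (H_lin (@cV) V0V V00 1 z Hu Hp).
have tw t z : (fun x => t * w z x) = fun x => t * u x + (t * z) * p x.
  by apply/funext => x; rewrite /w; ring.
have Htw t z : H (fun x => t * w z x) by exact: (H_scale (@cV) V0V V00 t (Hw z)).
(* [harmonic n] is the size of the perturbation in the direction [p], sent to [0]. *)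
have hh : harmonic n @[n --> \oo] --> (0 : R) by exact: cvg_harmonic.
have kc (c : R) : (fun=> c) n @[n --> \oo] --> c by exact: cvg_cst.
have cw t : Dform (fun x => t * w (harmonic n) x) (w (harmonic n)) @[n --> \oo] -->
    Dform (fun x => t * u x) u.
  have E n : Dform (fun x => t * w (harmonic n) x) (w (harmonic n)) =
      1 * Dform (fun x => t * u x + (t * harmonic n) * p x) u +
      harmonic n * Dform (fun x => t * u x + (t * harmonic n) * p x) p.
    by rewrite -tw -Dform_lin.
  have E0 : (fun x => t * u x + (t * 0) * p x) = fun x => t * u x.
    by apply/funext => x; rewrite mulr0 mul0r addr0.
  have ch : t * harmonic n @[n --> \oo] --> t * (0 : R).
    by apply: cvgM => //; exact: cvg_cst.
  have cu := Dform_cvg Hu Hp Hu (kc t) ch.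
  have cp := Dform_cvg Hu Hp Hp (kc t) ch.
  have c1 : 1 * Dform (fun x => t * u x + (t * harmonic n) * p x) u +
      harmonic n * Dform (fun x => t * u x + (t * harmonic n) * p x) p @[n --> \oo] -->
      1 * Dform (fun x => t * u x + (t * 0) * p x) u +
      0 * Dform (fun x => t * u x + (t * 0) * p x) p.
    by apply: cvgD; [apply: cvgM; [exact: kc|exact: cu]|apply: cvgM; [exact: hh|exact: cp]].
  rewrite E0 mul1r mul0r addr0 in c1; apply: cvg_trans c1.
  by apply: near_eq_cvg; apply: nearW => n; rewrite E.
have cA : A (w (harmonic n)) @[n --> \oo] --> A u.
  have c1 : A u + 2 * harmonic n * B u p + harmonic n * harmonic n * A p @[n --> \oo] -->
      A u + 2 * 0 * B u p + 0 * 0 * A p.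
    apply: cvgD; first apply: cvgD.
    - exact: kc.
    - by apply: cvgM; [apply: cvgM; [exact: kc|exact: hh]|exact: kc].
    - by apply: cvgM; [apply: cvgM; exact: hh|exact: kc].
  rewrite !mulr0 !mul0r !addr0 in c1; apply: cvg_trans c1.
  apply: near_eq_cvg; apply: nearW => n.
  by rewrite /w (A_lin (@cV) V0V V00 1 _ Hu Hp) expr1n mul1r mulr1 expr2.
have em0 : 0 < 1 - e by rewrite subr_gt0.
have em1 : 1 - e < 1 by rewrite gtrBl.
have ep1 : 1 < 1 + e by rewrite ltrDl.
(* At [1 - e] and [1 + e] the derivative along [u] has strict opposite signs. Both survive a small
   perturbation, so the perturbed ray meets the Nehari set at a parameter within [e] of [1]. *)
have Dm := nehari_below Nu em0 em1; have Dp := nehari_above Nu ep1.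
have [n [hm hp hA he]] : exists n, [/\
    0 < Dform (fun x => (1 - e) * w (harmonic n) x) (w (harmonic n)),
    Dform (fun x => (1 + e) * w (harmonic n) x) (w (harmonic n)) < 0,
    0 < A (w (harmonic n)) & harmonic n <= e].
  near \oo => n; exists n; split; near: n.
  - exact: cvgr_gt (cw (1 - e)) _ Dm.
  - exact: cvgr_lt (cw (1 + e)) _ Dp.
  - exact: cvgr_gt cA _ Au.
  - exact: cvgr_le hh _ e0.
set z : R := harmonic n in hm hp hA he.
have z0 : 0 < z by rewrite /z /harmonic/= invr_gt0.
have ee : 1 - e <= 1 + e by rewrite lerD2l ge0_cp// ltW.
have cD : {within `[1 - e, 1 + e], continuous (fun t : R => Dform (fun x => t * w z x) (w z))}.
  by apply: continuous_subspaceT; exact: continuous_Dform_ray.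
have [|t] := IVT (v := 0) ee cD.
  by rewrite ge_min le_max (ltW hm) (ltW hp) orbT.
rewrite in_itv/= => /andP[tm tp] Dt.
have t0 : 0 < t by exact: lt_le_trans tm.
have Nt : nehari (fun x => t * w z x).
  split; first exact: Htw.
  - by rewrite (A_scale (@cV) V0V V00)// mulr_gt0// exprn_gt0.
  - by rewrite Dform_mulr// Dt mulr0.
have tz0 : 0 < t * z by rewrite mulr_gt0.
pose phi (r : R) : R := J (fun x => t * u x + r * p x).
have Htu := H_scale (@cV) V0V V00 t Hu.
have dphi r : is_derive r (1 : R) phi (Dform (fun x => t * u x + r * p x) p).
  exact: (@J_derive (fun x => t * u x) p r).
(* [J (t u) <= J u <= J (t u + t z p)]: [u] is the maximum on its own ray, and the perturbed point
   is on the Nehari set. *)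
have phi0 : phi 0 <= phi (t * z).
  rewrite /phi -tw; apply: le_trans (umin _ Nt).
  rewrite (_ : (fun x => t * u x + 0 * p x) = fun x => t * u x).
    exact: nehari_max.
  by apply/funext => x; rewrite mul0r addr0.
have cphi : {within `[0, t * z], continuous phi}.
  by apply: derivable_within_continuous => r _; have [] := dphi r.
have [r] := MVT tz0 (fun r _ => dphi r) cphi.
rewrite in_itv/= subr0 => /andP[r0 rtz] E.
exists t, r; split.
- by rewrite ler_norml lerBrDr lerBlDr ![_ + 1]addrC tm tp.
- exact: ltW.
- apply: ltW; apply: lt_le_trans rtz _; apply: ler_pM => //; try exact: ltW.
  by apply: le_trans tp _; change (1 + e <= 1 + 1); rewrite lerD2l ltW.
- by rewrite -(pmulr_lge0 _ tz0) -E subr_ge0.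
Unshelve. all: by end_near. Qed.

(** As [e] tends to [0] the points of [minimizer_perturb] tend to [u] within a plane, and the sign
    passes to the limit. *)
Lemma minimizer_Dform_ge0 u p : nehari u -> (forall v, nehari v -> J u <= J v) ->
  H p -> 0 <= Dform u p.
Proof.
move=> Nu umin Hp; have [Hu _ _] := Nu.
(* The shift [n.+2] keeps [e = 1 / (n + 2)] below [1]. *)
have ex (n : nat) : exists tr : R * R, [/\ `|tr.1 - 1| <= n.+2%:R^-1, 0 <= tr.2,
    tr.2 <= 2 * n.+2%:R^-1 & 0 <= Dform (fun x => tr.1 * u x + tr.2 * p x) p].
  have e0 : 0 < n.+2%:R^-1 :> R by rewrite invr_gt0.
  have e1 : n.+2%:R^-1 < 1 :> R by rewrite invf_lt1// ltr1n.
  by have [t [r h]] := minimizer_perturb Nu umin Hp e0 e1; exists (t, r).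
have [tr htr] := choice ex.
have h0 : n.+2%:R^-1 @[n --> \oo] --> (0 : R).
  exact: (@cvg_subseq R harmonic 0 S (fun k => leqnSn k) (@cvg_harmonic R)).
have ct : (tr n).1 @[n --> \oo] --> (1 : R).
  apply/cvgrPdist_le => e e0; near=> n; have [h _ _ _] := htr n.
  rewrite distrC; apply: le_trans h _; near: n.
  exact: cvgr_le h0 _ e0.
have cr : (tr n).2 @[n --> \oo] --> (0 : R).
  apply: (squeeze_cvgr (f := cst 0) (h := fun n => 2 * n.+2%:R^-1)).
  - by apply: nearW => n; have [_ h1 h2 _] := htr n; rewrite h1.
  - exact: cvg_cst.
  - by rewrite -(mulr0 2); apply: cvgM => //; exact: cvg_cst.
have := Dform_cvg Hu Hp Hp ct cr.
rewrite (_ : (fun x => 1 * u x + 0 * p x) = u); last first.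
  by apply/funext => x; rewrite mul1r mul0r addr0.
move=> cD; apply: (cvgr_to_ge cD); apply: nearW => n; by have [] := htr n.
Unshelve. all: by end_near. Qed.

Lemma minimizer_critical u p : nehari u -> (forall v, nehari v -> J u <= J v) ->
  H p -> Dform u p = 0.
Proof.
move=> Nu umin Hp; have [Hu _ _] := Nu.
have Hn := H_scale (@cV) V0V V00 (-1) Hp.
have := minimizer_Dform_ge0 Nu umin Hn; rewrite Dform_mulr// mulN1r oppr_ge0 => h.
by apply/eqP; rewrite eq_le h minimizer_Dform_ge0.
Qed.

(** * The ground state *)

Lemma dir_deriv_zeroE u p : H u -> H p -> dir_deriv_zero J u p <-> Dform u p = 0.
Proof.
move=> Hu Hp; have d := @J_derive u p 0 Hu Hp.
have u0 : (fun x => u x + 0 * p x) = u by apply/funext => x; rewrite mul0r addr0.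
move: d; rewrite u0 => d; split => [d0|D0]; last by move: d; rewrite D0.
by have := @derive_val _ _ _ _ _ _ _ d0; rewrite derive_val.
Qed.

Lemma exists_ground_state w0 : H w0 -> ~ {ae mu3, forall x, in_Om x -> w0 x <= 0} ->
  exists u, [/\ H u, (forall x, 0 <= u x), nontrivial u,
    (forall p, H p -> dir_deriv_zero J u p) &
    (forall v, H v -> nontrivial v -> dir_deriv_zero J v v -> J u <= J v)].
Proof.
move=> Hw nw; have [u [Nu u0 umin]] := nehari_minimizer Hw nw.
have [Hu Au Du] := Nu; exists u; split.
- exact: Hu.
- exact: u0.
(* If [u] vanished almost everywhere, so would the mass inside [Omega], which [nehari_mass] bounds
   below by [m0 / 2 * A u > 0]. *)
- move=> uz; have [mi m] := nehari_mass Nu.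
  have : (\int[mu3]_x (chi x * (f (u x) * u x))%:E <= \int[mu3]_x 0%:E)%E.
    apply: ae_ge0_le_integral => //.
    + move=> x _; rewrite lee_fin mulr_ge0 ?chi_ge0// mulr_ge0//.
      exact: (f_ge0 (@cf) fneg f3).
    + by apply/measurable_EFinP; exact: Rintegrable_measurable mi.
    + by apply: ae_imp uz => x -> _; rewrite !mulr0.
  rewrite integral0 Rintegrable_EFin// lee_fin => m1.
  have := le_trans m m1; apply/negP; rewrite -ltNge.
  by rewrite mulr_gt0// divr_gt0.
- by move=> p Hp; apply/dir_deriv_zeroE => //; exact: minimizer_critical.
- move=> v Hv nv /(dir_deriv_zeroE Hv Hv) Dv; apply: umin; split => //.
  exact: (nontrivial_A_gt0 (@cV) V0V V00 Hv nv).
Qed.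

End energy_functional.

Unset Implicit Arguments.
Set Strict Implicit.

Theorem theorem3p1 (R : realType) (s : R) (M : R -> R) (m0 : R)
  (V : pt3 R -> R) (V0 : R) (f : R -> R) (Omega : set (pt3 R)) (K a : R) :
  (* s in (3/4, 1) *)
  3 / 4 < s -> s < 1 ->
  (* M : [0,oo) -> [0,oo) continuous, (M1), (M2), (M3) *)
  {within [set t : R | 0 <= t], continuous M} ->
  0 < m0 ->
  (forall t, 0 <= t -> m0 <= M t) ->
  (forall t1 t2, 0 <= t1 -> t1 < t2 -> M t1 < M t2) ->
  (forall t1 t2, 0 < t2 -> t2 <= t1 ->
     M t1 / t1 - M t2 / t2 <= m0 * (1 / t1 - 1 / t2)) ->
  (* V continuous, V0 = inf V > 0 *)
  continuous V ->
  (forall x, V0 <= V x) ->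
  (forall e : R, 0 < e -> exists x, V x < V0 + e) ->
  0 < V0 ->
  (* f continuous, f = 0 on (-oo,0), (f1)-(f4) *)
  continuous f ->
  (forall t, t < 0 -> f t = 0) ->
  (f t / t ^+ 3 @[t --> 0^'+] --> 0) ->
  (exists q : R, [/\ 4 < q, q < 6 / (3 - 2 * s)
                  & f t / t `^ (q - 1) @[t --> +oo] --> 0]) ->
  (exists th : R, [/\ 4 < th, th < 6 / (3 - 2 * s)
                   & forall t, 0 < t -> 0 < th * int0 f t /\ th * int0 f t <= f t * t]) ->
  (forall t1 t2, 0 < t1 -> t1 <= t2 -> f t1 / t1 ^+ 3 <= f t2 / t2 ^+ 3) ->
  (* Omega: bounded Lipschitz domain, V0 < min_{boundary} V, V attains V0 in Omega *)
  bounded_lipschitz_domain Omega ->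
  (forall x, boundary3 Omega x -> V0 < V x) ->
  (exists x, Omega x /\ V x = V0) ->
  (* K > 2/m0, a > 0 with f(a) = (V0/K) a *)
  2 / m0 < K -> 0 < a -> f a = V0 / K * a ->
  forall eps : R, 0 < eps ->
  exists u : pt3 R -> R,
    [/\ in_Heps s V eps u,
        (forall x, 0 <= u x),
        nontrivial u,
        (forall phi, in_Heps s V eps phi ->
           dir_deriv_zero (Jeps s M V Omega f V0 K a eps) u phi)
      & (forall v, in_Heps s V eps v -> nontrivial v ->
           dir_deriv_zero (Jeps s M V Omega f V0 K a eps) v v ->
           Jeps s M V Omega f V0 K a eps u <= Jeps s M V Omega f V0 K a eps v)].
Proof.
move=> s34 s1 cM m00 M1 _ M3 cV V0V _ V00 cf fneg _ [q [q4 qp f2]] [th [th4 _ f3]] f4.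
move=> [oOmega _ _ bOmega _] _ [x0 [Ox0 _]] Km a0 fa eps eps0.
have s0 : 0 < s by lra.
have s12 : 1 / 2 <= s by lra.
(* The bump is centred at [x0 / eps], inside the scaled [Omega]. *)
have [w [Hw _ nw]] := exists_bump s0 s1 cV V0V (ltW V00) oOmega Ox0 eps0.
exact: (exists_ground_state s0 s1 cM m00 M1 M3 cV V0V V00 cf fneg q4 qp f2 th4 f3 f4
  oOmega Km a0 fa s12 bOmega eps0 Hw nw).
Qed.
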